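(* Let $\mathbb{G}$ be a locally compact quantum group, let $(N_1,\Delta_{N_1})$ and $(N_2,\Delta_{N_2})$ be quantum homogeneous spaces of $\mathbb{G}$, and let $\mathbb{D}_1$, $\mathbb{D}_2$ be their respective $C^*$-algebraic versions. Suppose that there exists a $\mathbb{G}$-isomorphism $\pi\in\mathrm{Mor}_{\mathbb{G}}(\mathbb{D}_1,\mathbb{D}_2)$. Then $\pi$ extends to a $\mathbb{G}$-isomorphism $\pi:N_1\to N_2$, i.e. to an isomorphism of von Neumann algebras such that $\Delta_{N_2}\circ\pi=(\iota\otimes\pi)\circ\Delta_{N_1}$.
   Context: Conventions. $\mathbb{G}$ is a locally compact quantum group in the sense of Kustermans–Vaes: a von Neumann algebra $L^\infty(\mathbb{G})$ with a normal unital coassociative $*$-homomorphism $\Delta_{\mathbb{G}}:L^\infty(\mathbb{G})\to L^\infty(\mathbb{G})\bar\otimes L^\infty(\mathbb{G})$ admitting left and right invariant normal semifinite faithful weights. $L^2(\mathbb{G})$ is the GNS space of the left invariant weight, and $C_0(\mathbb{G})\subset L^\infty(\mathbb{G})\subset B(L^2(\mathbb{G}))$ is the associated (reduced) $C^*$-algebra. $\mathcal{K}(L^2(\mathbb{G}))$ denotes the compact operators, $\otimes$ is the minimal tensor product of $C^*$-algebras, $\mathrm{M}(A)$ is the multiplier algebra, $\mathrm{Mor}(A,B)$ is the set of nondegenerate $*$-homomorphisms $A\to \mathrm{M}(B)$, and $[\,\cdot\,]$ denotes closed linear span. For a $C^*$-algebra $D$, $\mathcal{L}(L^2(\mathbb{G})\otimes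 D)$ is the algebra of adjointable operators on the Hilbert $D$-module $L^2(\mathbb{G})\otimes D$, identified with $\mathrm{M}(\mathcal{K}(L^2(\mathbb{G}))\otimes D)$. Coaction on a von Neumann algebra. A (left) coaction of $\mathbb{G}$ on $N$ is an injective normal unital $*$-homomorphism $\Delta_N:N\to L^\infty(\mathbb{G})\bar\otimes N$ with $(\iota\otimes\Delta_N)\circ\Delta_N=(\Delta_{\mathbb{G}}\otimes\iota)\circ\Delta_N$. It is ergodic if $\{x\in N:\Delta_N(x)=1\otimes x\}=\mathbb{C}1$. $\mathbb{G}$-$C^*$-algebra. A pair $\mathbb{D}=(C_0(\mathbb{D}),\Delta_{\mathbb{D}})$ where $C_0(\mathbb{D})$ is a $C^*$-algebra and $\Delta_{\mathbb{D}}\in\mathrm{Mor}(C_0(\mathbb{D}),C_0(\mathbb{G})\otimes C_0(\mathbb{D}))$ is injective, satisfies $(\iota\otimes\Delta_{\mathbb{D}})\circ\Delta_{\mathbb{D}}=(\Delta_{\mathbb{G}}\otimes\iota)\circ\Delta_{\mathbb{D}}$, and is continuous: $[\Delta_{\mathbb{D}}(C_0(\mathbb{D}))(C_0(\mathbb{G})\otimes 1)]=C_0(\mathbb{G})\otimes C_0(\mathbb{D})$. A $\mathbb{G}$-morphism $\pi\in\mathrm{Mor}_{\mathbb{G}}(\mathbb{B},\mathbb{D})$ is a $\pi\in\mathrm{Mor}(C_0(\mathbb{B}),C_0(\mathbb{D}))$ with $\Delta_{\mathbb{D}}\circ\pi=(\iota\otimes\pi)\circ\Delta_{\mathbb{B}}$;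 it is a $\mathbb{G}$-isomorphism if in addition it is a $*$-isomorphism of $C_0(\mathbb{B})$ onto $C_0(\mathbb{D})$. Strictness. A unital $*$-homomorphism $\pi:N\to\mathcal{L}(\mathcal{E})$ ($\mathcal{E}$ a Hilbert $C^*$-module) is strict if it is $*$-strongly continuous on the unit ball of $N$: for every uniformly bounded $*$-strongly convergent net $x_i\in N$ and every $v\in\mathcal{E}$, the nets $\pi(x_i)v$ and $\pi(x_i^* )v$ converge in norm (to the values at the limit). Quantum homogeneous space (QHS). A von Neumann algebra $N$ with an ergodic coaction $\Delta_N:N\to L^\infty(\mathbb{G})\bar\otimes N$ is a quantum homogeneous space of $\mathbb{G}$ if there exists a $\mathbb{G}$-$C^*$-algebra $\mathbb{D}$ such that: (1) $C_0(\mathbb{D})$ is a strongly dense $C^*$-subalgebra of $N$; (2) $\Delta_{\mathbb{D}}$ is the restriction of $\Delta_N$ to $C_0(\mathbb{D})$; (3) $\Delta_N(N)\subset \mathrm{M}(\mathcal{K}(L^2(\mathbb{G}))\otimes C_0(\mathbb{D}))$ and the map $\Delta_N:N\to\mathcal{L}(L^2(\mathbb{G})\otimes C_0(\mathbb{D}))$ is strict. Such a $\mathbb{D}$ is unique and is called the $C^*$-algebraic version of $(N,\Delta_N)$. *)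

(* Defs.v *)
From HB Require Import structures.
From mathcomp Require Import all_boot all_order all_algebra.
From mathcomp Require Import sesquilinear complex.
From mathcomp Require Import all_classical all_reals all_analysis.

Set Implicit Arguments.
Unset Strict Implicit.
Unset Printing Implicit Defensive.

Import Order.TTheory GRing.Theory Num.Theory.
Import numFieldNormedType.Exports.

Local Open Scope classical_set_scope.
Local Open Scope ring_scope.
Local Open Scope complex_scope.

(* Operator algebras are represented concretely: an algebra on a Hilbert space *)
(* H is a set of functions H -> H, and a map between algebras on H and K is a  *)
(* total function (H -> H) -> (K -> K) of which only the values on the source  *)
(* algebra matter.  Inner products are linear in the first variable.           *)

Record hilbert (R : realType) := Hilbert {
  hcar :> completeNormedModType R[i];
  dot : {dot hcar for (@Num.conj R[i])};
  dot_norm : forall x : hcar, `|x| ^+ 2 = dot x x }.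

Definition lspan (R : realType) (V : lmodType R[i]) (S : set V) : set V :=
  [set v | exists (n : nat) (c : 'I_n -> R[i]) (s : 'I_n -> V),
     (forall i, S (s i)) /\ v = \sum_(i < n) c i *: s i].

Section Operators.
Variable R : realType.
Implicit Types H K : hilbert R.

Definition bop H K : set (H -> K) := [set T | linear T /\ continuous T].

Definition adj H K (T : H -> K) : K -> H :=
  xget (fun=> 0)
    [set S | bop S /\ forall x y, dot K (T x) y = dot H x (S y)].

Definition op_closure H K (A : set (H -> K)) : set (H -> K) :=
  [set T | bop T /\ forall e : R[i], 0 < e ->
     exists2 S, A S & forall x, `|T x - S x| <= e * `|x|].

(* [ A ], the norm-closed linear span *)
Definition clspan H K (A : set (H -> K)) : set (H -> K) :=
  op_closure (lspan A).

Definition opmul H (A B : set (H -> H)) : set (H -> H) :=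
  [set T | exists a b, [/\ A a, B b & T = a \o b]].

Definition compact_op H : set (H -> H) :=
  [set T | bop T /\ compact (closure (T @` [set h | `|h| <= 1]))].

Definition commutant H (A : set (H -> H)) : set (H -> H) :=
  [set T | bop T /\ forall S, A S -> T \o S = S \o T].

Record von_neumann_algebra H (M : set (H -> H)) : Prop := {
  vna_bop : M `<=` @bop H H;
  vna_adj : forall x, M x -> M (adj x);
  vna_bicommutant : commutant (commutant M) = M }.

Definition nondegenerate H (A : set (H -> H)) : Prop :=
  closure (lspan [set v | exists a h, A a /\ v = a h]) = setT.

Record cstar_algebra H (A : set (H -> H)) : Prop := {
  csa_bop : A `<=` @bop H H;
  csa_span : lspan A `<=` A;
  csa_mul : forall x y, A x -> A y -> A (x \o y);
  csa_adj : forall x, A x -> A (adj x);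
  csa_closed : op_closure A `<=` A }.

(* This is M(A) for a nondegenerate C*-algebra A on H. *)
Definition multipliers H (A : set (H -> H)) : set (H -> H) :=
  [set T | bop T /\ forall a, A a -> A (T \o a) /\ A (a \o T)].

Record star_hom H K (A : set (H -> H)) (f : (H -> H) -> (K -> K)) : Prop := {
  shom_bop : forall x, A x -> bop (f x);
  shom_linear : forall (c : R[i]) x y, A x -> A y ->
    f (c *: x + y) = c *: f x + f y;
  shom_mul : forall x y, A x -> A y -> f (x \o y) = f x \o f y;
  shom_adj : forall x, A x -> f (adj x) = adj (f x) }.

(* f \in Mor(A, B) *)
Record cstar_mor H K (A : set (H -> H)) (B : set (K -> K))
    (f : (H -> H) -> (K -> K)) : Prop := {
  cmor_hom : star_hom A f;
  cmor_mult : forall a, A a -> multipliers B (f a);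
  cmor_nondegenerate : clspan (opmul (f @` A) B) = B }.

(* Y = f(m), where f \in Mor(A, B) is extended to m \in M(A): the unique Y     *)
(* with Y f(a) = f(m a) for all a in A.                                        *)
Definition mor_ext H K (A : set (H -> H)) (f : (H -> H) -> (K -> K))
    (m : H -> H) (Y : K -> K) : Prop :=
  bop Y /\ forall a, A a -> Y \o f a = f (m \o a).

(* Normal functionals T |-> \sum_n <T xi_n, eta_n> on B(H); their restrictions *)
(* to a von Neumann algebra M form the predual of M.                           *)
Record nfunctional H := NFunctional {
  nf_l : nat -> H;
  nf_r : nat -> H;
  nf_l_summable : cvgn (series (fun n => `|nf_l n| ^+ 2));
  nf_r_summable : cvgn (series (fun n => `|nf_r n| ^+ 2)) }.

Definition nf_app H (w : nfunctional H) (T : H -> H) : (R[i] : numFieldType) :=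
  limn (series (fun n => dot H (T (nf_l w n)) (nf_r w n))).

Definition sw_cvg H (F : set_system (H -> H)) (x : H -> H) : Prop :=
  forall w : nfunctional H, nf_app w y @[y --> F] --> nf_app w x.

(* sigma-weak continuity on M *)
Definition normal_map H K (M : set (H -> H)) (f : (H -> H) -> (K -> K)) : Prop :=
  forall (F : set_system (H -> H)) (x : H -> H), ProperFilter F ->
    F M -> M x -> sw_cvg F x ->
    forall w : nfunctional K, nf_app w (f y) @[y --> F] --> nf_app w (f x).

Definition pos_op H (M : set (H -> H)) : set (H -> H) :=
  [set x | M x /\ forall h, 0 <= dot H (x h) h].

Definition op_le H (x y : H -> H) : Prop :=
  forall h, dot H (x h) h <= dot H (y h) h.

(* Weights are only evaluated on the positive cone. *)
Record nsf_weight H (M : set (H -> H)) (phi : (H -> H) -> \bar R) : Prop := {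
  wt_ge0 : forall x, pos_op M x -> (0 <= phi x)%E;
  wt_add : forall x y, pos_op M x -> pos_op M y ->
    phi (x + y) = (phi x + phi y)%E;
  wt_scale : forall (r : R) x, 0 <= r -> pos_op M x ->
    phi (r%:C *: x) = (r%:E * phi x)%E;
  wt_normal : forall (S : set (H -> H)) x,
    S `<=` pos_op M -> S !=set0 ->
    (forall y z, S y -> S z -> exists t, [/\ S t, op_le y t & op_le z t]) ->
    pos_op M x -> (forall y, S y -> op_le y x) ->
    (forall z, M z -> (forall y, S y -> op_le y z) -> op_le x z) ->
    phi x = ereal_sup (phi @` S);
  wt_faithful : forall x, pos_op M x -> phi x = 0%E -> x = 0;
  wt_semifinite : forall x, M x -> exists F : set_system (H -> H),
    [/\ ProperFilter F, F (lspan [set y | pos_op M y /\ (phi y < +oo)%E]) &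
        sw_cvg F x] }.

(* The left ideal of those x with phi(x^* x) < oo *)
Definition sq_integrable H (M : set (H -> H)) (phi : (H -> H) -> \bar R) :
    set (H -> H) :=
  [set x | M x /\ (phi (adj x \o x) < +oo)%E].

(* L is a GNS map of phi for the given action of M on H; the inner product     *)
(* formula <L x, L y> = phi(y^* x) follows by polarization.                    *)
Record gns_map H (M : set (H -> H)) (phi : (H -> H) -> \bar R)
    (L : (H -> H) -> H) : Prop := {
  gns_linear : forall (c : R[i]) x y,
    sq_integrable M phi x -> sq_integrable M phi y ->
    L (c *: x + y) = c *: L x + L y;
  gns_norm : forall x, sq_integrable M phi x ->
    (complex.Re (`|L x| ^+ 2))%:E = phi (adj x \o x);
  gns_dense : closure (L @` sq_integrable M phi) = setT;
  gns_action : forall x y, M x -> sq_integrable M phi y -> L (x \o y) = x (L y) }.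

(* A Hilbert space tensor product of H and K (unique up to a unitary). *)
Record htensor H K := HTensor {
  ht_car :> hilbert R;
  pure : {bilinear H -> K -> ht_car};
  pure_dot : forall h h' k k',
    dot ht_car (pure h k) (pure h' k') = dot H h h' * dot K k k';
  pure_total : closure (lspan [set v | exists h k, v = pure h k]) = setT }.

End Operators.

Section TensorProducts.
Variable R : realType.
Variable tens : forall H K : hilbert R, htensor H K.
Implicit Types H K : hilbert R.

Definition optens H H' K K' (x : H -> H') (y : K -> K') :
    tens H K -> tens H' K' :=
  xget (fun=> 0) [set T | bop T /\
    forall h k, T (pure (tens H K) h k) = pure (tens H' K') (x h) (y k)].

Definition elem_tens H K (A : set (H -> H)) (B : set (K -> K)) :
    set (tens H K -> tens H K) :=
  [set T | exists a b, [/\ A a, B b & T = optens a b]].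

Definition vn_tens H K (M : set (H -> H)) (N : set (K -> K)) :=
  commutant (commutant (elem_tens M N)).

Definition min_tens H K (A : set (H -> H)) (B : set (K -> K)) :=
  clspan (elem_tens A B).

(* (w \otimes id)(X) *)
Definition lslice H K (w : nfunctional H) (X : tens H K -> tens H K) : K -> K :=
  xget (fun=> 0) [set T | bop T /\ forall k k', dot K (T k) k' =
    limn (series (fun n => dot (tens H K) (X (pure (tens H K) (nf_l w n) k))
                                          (pure (tens H K) (nf_r w n) k')))].

(* (id \otimes w)(X) *)
Definition rslice H K (w : nfunctional K) (X : tens H K -> tens H K) : H -> H :=
  xget (fun=> 0) [set T | bop T /\ forall h h', dot H (T h) h' =
    limn (series (fun n => dot (tens H K) (X (pure (tens H K) h (nf_l w n)))
                                          (pure (tens H K) h' (nf_r w n))))].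

(* Y and Z agree under (H1 \otimes H2) \otimes K = H1 \otimes (H2 \otimes K). *)
Definition assoc_eq H1 H2 K
    (Y : tens (tens H1 H2) K -> tens (tens H1 H2) K)
    (Z : tens H1 (tens H2 K) -> tens H1 (tens H2 K)) : Prop :=
  forall h1 h1' h2 h2' k k',
    dot (tens (tens H1 H2) K)
      (Y (pure (tens (tens H1 H2) K) (pure (tens H1 H2) h1 h2) k))
      (pure (tens (tens H1 H2) K) (pure (tens H1 H2) h1' h2') k')
    = dot (tens H1 (tens H2 K))
      (Z (pure (tens H1 (tens H2 K)) h1 (pure (tens H2 K) h2 k)))
      (pure (tens H1 (tens H2 K)) h1' (pure (tens H2 K) h2' k')).

(* Y = (id \otimes f)(X) for a normal map f between von Neumann algebras.  As  *)
(* usual, id \otimes f is the map whose preadjoint is id \otimes f_*, that is, *)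
(* (w \otimes id) (id \otimes f)(X) = f((w \otimes id)(X)) for all normal w.   *)
Definition vn_id_tens H K K' (f : (K -> K) -> (K' -> K'))
    (X : tens H K -> tens H K) (Y : tens H K' -> tens H K') : Prop :=
  bop Y /\ forall w : nfunctional H, lslice w Y = f (lslice w X).

(* Y = (f \otimes id)(X), similarly *)
Definition vn_tens_id H H' K (f : (H -> H) -> (H' -> H'))
    (X : tens H K -> tens H K) (Y : tens H' K -> tens H' K) : Prop :=
  bop Y /\ forall w : nfunctional K, rslice w Y = f (rslice w X).

(* F = id_C \otimes f \in Mor(C \otimes A, C \otimes B) *)
Record mor_id_tens H K K' (C : set (H -> H)) (A : set (K -> K))
    (B : set (K' -> K')) (f : (K -> K) -> (K' -> K'))
    (F : (tens H K -> tens H K) -> (tens H K' -> tens H K')) : Prop := {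
  mid_mor : cstar_mor (min_tens C A) (min_tens C B) F;
  mid_elem : forall c a, C c -> A a -> F (optens c a) = optens c (f a) }.

(* F = f \otimes id_C \in Mor(A \otimes C, B \otimes C) *)
Record mor_tens_id H H' K (A : set (H -> H)) (B : set (H' -> H'))
    (C : set (K -> K)) (f : (H -> H) -> (H' -> H'))
    (F : (tens H K -> tens H K) -> (tens H' K -> tens H' K)) : Prop := {
  mti_mor : cstar_mor (min_tens A C) (min_tens B C) F;
  mti_elem : forall a c, A a -> C c -> F (optens a c) = optens (f a) c }.

(* The C*-algebra generated by the slices (id \otimes w)(W) *)
Definition slice_algebra H (W : tens H H -> tens H H) : set (H -> H) :=
  clspan [set T | exists w : nfunctional H, T = rslice w W].

(* Locally compact quantum groups, with L^oo(G) in the GNS representation of   *)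
(* the left invariant weight.  The existence (and uniqueness) of the unitary   *)
(* qg_W, and the fact that the slice algebra is a nondegenerate C*-subalgebra  *)
(* of L^oo(G), are theorems of Kustermans and Vaes; they are recorded here as  *)
(* fields only so that C_0(G) is available with its C*-algebra structure.      *)
Record lcqg := LCQG {
  qg_L2 : hilbert R;
  qg_Linf : set (qg_L2 -> qg_L2);
  qg_comult : (qg_L2 -> qg_L2) -> (tens qg_L2 qg_L2 -> tens qg_L2 qg_L2);
  qg_left : (qg_L2 -> qg_L2) -> \bar R;
  qg_right : (qg_L2 -> qg_L2) -> \bar R;
  qg_gns : (qg_L2 -> qg_L2) -> qg_L2;
  qg_W : tens qg_L2 qg_L2 -> tens qg_L2 qg_L2;
  qg_vna : von_neumann_algebra qg_Linf;
  qg_comult_hom : star_hom qg_Linf qg_comult;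
  qg_comult_unital : qg_comult id = id;
  qg_comult_range : forall x, qg_Linf x ->
    vn_tens qg_Linf qg_Linf (qg_comult x);
  qg_comult_normal : normal_map qg_Linf qg_comult;
  qg_coassoc : forall x, qg_Linf x -> exists Y Z,
    [/\ vn_tens_id qg_comult (qg_comult x) Y,
        vn_id_tens qg_comult (qg_comult x) Z & assoc_eq Y Z];
  qg_left_nsf : nsf_weight qg_Linf qg_left;
  qg_right_nsf : nsf_weight qg_Linf qg_right;
  qg_left_inv : forall (w : nfunctional qg_L2) x,
    (forall y, pos_op qg_Linf y -> 0 <= nf_app w y) ->
    pos_op qg_Linf x -> (qg_left x < +oo)%E ->
    qg_left (lslice w (qg_comult x))
      = ((complex.Re (nf_app w id))%:E * qg_left x)%E;
  qg_right_inv : forall (w : nfunctional qg_L2) x,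
    (forall y, pos_op qg_Linf y -> 0 <= nf_app w y) ->
    pos_op qg_Linf x -> (qg_right x < +oo)%E ->
    qg_right (rslice w (qg_comult x))
      = ((complex.Re (nf_app w id))%:E * qg_right x)%E;
  qg_gnsP : gns_map qg_Linf qg_left qg_gns;
  qg_W_bop : bop qg_W;
  qg_W_isometry : adj qg_W \o qg_W = id;
  qg_W_coisometry : qg_W \o adj qg_W = id;
  qg_WP : forall (w : nfunctional qg_L2) x, sq_integrable qg_Linf qg_left x ->
    lslice w (adj qg_W) (qg_gns x) = qg_gns (lslice w (qg_comult x));
  qg_C0_cstar : cstar_algebra (slice_algebra qg_W);
  qg_C0_nondegenerate : nondegenerate (slice_algebra qg_W);
  qg_C0_sub : slice_algebra qg_W `<=` qg_Linf }.

Definition qg_C0 (G : lcqg) : set (qg_L2 G -> qg_L2 G) :=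
  slice_algebra (qg_W (l := G)).

Section Coactions.
Variable G : lcqg.
Local Notation L2 := (qg_L2 G).
Local Notation C0 := (@qg_C0 G).

Record vn_coaction K (N : set (K -> K))
    (D : (K -> K) -> (tens L2 K -> tens L2 K)) : Prop := {
  coact_vna : von_neumann_algebra N;
  coact_hom : star_hom N D;
  coact_unital : D id = id;
  coact_range : forall x, N x -> vn_tens (@qg_Linf G) N (D x);
  coact_inj : set_inj N D;
  coact_normal : normal_map N D;
  coact_coassoc : forall x, N x -> exists Y Z,
    [/\ vn_tens_id (@qg_comult G) (D x) Y,
        vn_id_tens D (D x) Z & assoc_eq Y Z] }.

Definition ergodic K (N : set (K -> K))
    (D : (K -> K) -> (tens L2 K -> tens L2 K)) : Prop :=
  [set x | N x /\ D x = optens id x] = [set x | exists c : R[i], x = c *: id].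

(* A G-C*-algebra (A, d), with A acting nondegenerately on K *)
Record g_cstar_algebra K (A : set (K -> K))
    (d : (K -> K) -> (tens L2 K -> tens L2 K)) : Prop := {
  gc_cstar : cstar_algebra A;
  gc_nondegenerate : nondegenerate A;
  gc_mor : cstar_mor A (min_tens C0 A) d;
  gc_inj : set_inj A d;
  gc_coassoc : exists Phi Psi,
    [/\ mor_tens_id C0 (min_tens C0 C0) A (@qg_comult G) Phi,
        mor_id_tens C0 A (min_tens C0 A) d Psi &
        forall a, A a -> exists Y Z,
          [/\ mor_ext (min_tens C0 A) Phi (d a) Y,
              mor_ext (min_tens C0 A) Psi (d a) Z & assoc_eq Y Z]];
  gc_continuous :
    clspan [set T | exists a c, [/\ A a, C0 c & T = d a \o optens c id]]
      = min_tens C0 A }.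

Record g_morphism K K' (A : set (K -> K))
    (d : (K -> K) -> (tens L2 K -> tens L2 K)) (B : set (K' -> K'))
    (d' : (K' -> K') -> (tens L2 K' -> tens L2 K'))
    (f : (K -> K) -> (K' -> K')) : Prop := {
  gm_mor : cstar_mor A B f;
  gm_equivariant : exists2 Phi,
    mor_id_tens C0 A B f Phi &
    forall a, A a -> exists2 Y,
      mor_ext B d' (f a) Y & mor_ext (min_tens C0 A) Phi (d a) Y }.

Definition g_isomorphism K K' (A : set (K -> K))
    (d : (K -> K) -> (tens L2 K -> tens L2 K)) (B : set (K' -> K'))
    (d' : (K' -> K') -> (tens L2 K' -> tens L2 K'))
    (f : (K -> K) -> (K' -> K')) : Prop :=
  g_morphism A d B d' f /\ set_bij A B f.

(* The Hilbert A-module L^2(G) \otimes A, realized as a space of operators     *)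
(* K -> L^2(G) \otimes K: the inner product is <v, v'> = v^* v' and            *)
(* M(K(L^2(G)) \otimes A) acts by composition on the left.                     *)
Definition hilbert_module K (A : set (K -> K)) : set (K -> tens L2 K) :=
  clspan [set v | exists h a, A a /\ v = (fun k => pure (tens L2 K) h (a k))].

(* Nets are replaced by filters. *)
Definition strict_map K (N A : set (K -> K))
    (D : (K -> K) -> (tens L2 K -> tens L2 K)) : Prop :=
  forall (F : set_system (K -> K)) (x : K -> K) (r : R[i]), ProperFilter F ->
    F N -> N x ->
    F [set y : K -> K | forall k, `|y k| <= r * `|k|] ->
    (forall k, y k @[y --> F] --> x k) ->
    (forall k, adj y k @[y --> F] --> adj x k) ->
    forall v, hilbert_module A v -> forall e : R[i], 0 < e ->
      F [set y | (forall k, `|D y (v k) - D x (v k)| <= e * `|k|) /\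
                 (forall k, `|D (adj y) (v k) - D (adj x) (v k)| <= e * `|k|)].

(* (A, d) is the C*-algebraic version of (N, D). *)
Record cstar_version K (N : set (K -> K))
    (D : (K -> K) -> (tens L2 K -> tens L2 K)) (A : set (K -> K))
    (d : (K -> K) -> (tens L2 K -> tens L2 K)) : Prop := {
  cv_gcstar : g_cstar_algebra A d;
  cv_sub : A `<=` N;
  cv_dense : N `<=` closure (A : set {ptws K -> K});
  cv_restr : forall a, A a -> d a = D a;
  cv_mult : forall x, N x -> multipliers (min_tens (@compact_op R L2) A) (D x);
  cv_strict : strict_map N A D }.

Definition quantum_homogeneous_space K (N : set (K -> K))
    (D : (K -> K) -> (tens L2 K -> tens L2 K)) : Prop :=
  [/\ vn_coaction N D, ergodic N D & exists A d, cstar_version N D A d].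

Record vn_g_isomorphism K K' (N : set (K -> K))
    (D : (K -> K) -> (tens L2 K -> tens L2 K)) (N' : set (K' -> K'))
    (D' : (K' -> K') -> (tens L2 K' -> tens L2 K'))
    (f : (K -> K) -> (K' -> K')) : Prop := {
  vgi_hom : star_hom N f;
  vgi_unital : f id = id;
  vgi_bij : set_bij N N' f;
  vgi_normal : normal_map N f;
  vgi_equivariant : forall x, N x -> vn_id_tens f (D x) (D' (f x)) }.

End Coactions.
End TensorProducts.

(* Main.v *)
Require Import Defs.
From HB Require Import structures.
From mathcomp Require Import all_boot all_order all_algebra.
From mathcomp Require Import sesquilinear complex.
From mathcomp Require Import all_classical all_reals all_analysis.
From mathcomp Require Import ring lra.

(* Call S : K1 -> K2 an intertwiner if S a = pi(a) S for a in C_0(D1).  The key  *)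
(* point is that the ranges of the intertwiners are total in K2.  If k is        *)
(* orthogonal to all of them, the representation of C_0(D1) generated by k is    *)
(* disjoint from the given one on K1, so a Kaplansky type density argument gives *)
(* a bounded net of self-adjoint b in C_0(D1) with b -> 0 *-strongly on K1 and   *)
(* pi(b) k -> k.  By strictness Delta_{N1}(b) -> 0 on L^2(G) (x) C_0(D1), and    *)
(* equivariance carries this to Delta_{N2}(pi(b)) -> 0 weakly.  A weak limit     *)
(* point x of pi(b) thus has Delta_{N2}(x) = 0, so x = 0 by injectivity, while   *)
(* <x k, k> = |k|^2; hence k = 0.                                                *)
(*                                                                              *)
(* Since S'^* S commutes with C_0(D1), hence with N1, the formula                *)
(* rho(x) S = S x defines a *-homomorphism rho on N1 extending pi, and the same  *)
(* construction for pi^-1 inverts it.  For normality, a greedy choice of         *)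
(* intertwiners R_j with \sum_j R_j R_j^* k = k gives                            *)
(* <rho(x) k, k'> = \sum_j <x R_j^* k, R_j^* k'>.  Equivariance holds on         *)
(* C_0(D1) and passes to N1 along bounded strongly convergent nets.              *)

(** Everything rests on totality of the intertwiner ranges, [intertwiners_total], which is applied
    to pi and to its inverse. Behind it stands a Kaplansky theorem for finite families of
    representations ([kaplansky]): if the operators y_i commute with all intertwiners inside the
    family and x_i = 2 y_i (1 + y_i^2)^-1, then some self-adjoint b of norm at most 2 acts, in all
    the representations at once, close to x_i at prescribed vectors. With y = 0 on copies of K1 and
    y = Q on K2, where Q projects onto the vectors orthogonal to every intertwiner range, this gives
    [kaplansky_disjoint]. With y in N1 on copies of K1 it gives [bounded_density], along which
    equivariance passes from C_0(D1) to N1 ([coefficients_agree_all]).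

    Boundedness of rho(x) comes from [column_extension]: the prescription S xi |-> S (x xi) on the
    ranges is bounded because x commutes with all [adj T \o S]. Equivariance of pi enters as an
    identity between slices of Delta(b) and Delta(pi(b)), multiplied by elements of the algebras
    ([slc_equivariant]). Normality is [vn_extension_predual]. *)

Set Implicit Arguments.
Unset Strict Implicit.
Unset Printing Implicit Defensive.

Import Order.TTheory GRing.Theory Num.Theory.
Import numFieldNormedType.Exports.

Local Open Scope classical_set_scope.
Local Open Scope ring_scope.
Local Open Scope complex_scope.

(** * Hilbert spaces as real inner product spaces *)

Section RealHilbert.
Variable R : realType.
Implicit Types H K E : hilbert R.

(* Norms take values in R[i], which is only partially ordered; [nm] and [rdot]   *)
(* are real-valued, and [dotE] recovers [dot].                                   *)
Definition nm H (x : H) : R := complex.Re `|x|.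
Definition rdot H (x y : H) : R := complex.Re (dot H x y).

Lemma normE H (x : H) : `|x| = (nm x)%:C.
Proof.
rewrite /nm; have := normr_ge0 x; rewrite lecE => /andP[/eqP /= h _].
by apply/eqP; rewrite eq_complex /= h !eqxx.
Qed.

Lemma nm_ge0 H (x : H) : 0 <= nm x.
Proof. by have := normr_ge0 x; rewrite normE lecE /= => /andP[]. Qed.

Lemma nm2E H (x : H) : nm x ^+ 2 = rdot x x.
Proof. by rewrite /rdot -dot_norm normE -rmorphXn. Qed.

Lemma nm_eq0 H (x : H) : nm x = 0 -> x = 0.
Proof. by move=> h; apply/eqP; rewrite -normr_eq0 normE h. Qed.

Lemma nm0 H : nm (0 : H) = 0. Proof. by rewrite /nm normr0. Qed.

Lemma nmN H (x : H) : nm (- x) = nm x. Proof. by rewrite /nm normrN. Qed.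

Lemma nmD H (x y : H) : nm (x + y) <= nm x + nm y.
Proof. by have := ler_normD x y; rewrite !normE -rmorphD /= lecR. Qed.

Lemma nmB H (x y : H) : nm (x - y) <= nm x + nm y.
Proof. by rewrite -[nm y]nmN nmD. Qed.

Lemma nmBC H (x y : H) : nm (x - y) = nm (y - x).
Proof. by rewrite -opprB nmN. Qed.

Lemma nmZ H (c : R[i]) (x : H) : nm (c *: x) = nm x * complex.Re `|c|.
Proof. by rewrite /nm normrZ normE normc_def /= mul0r subr0 mulrC. Qed.

Lemma nmZr H (c : R) (x : H) : nm (c%:C *: x) = `|c| * nm x.
Proof. by rewrite nmZ mulrC normc_def /= expr0n addr0 sqrtr_sqr. Qed.

Lemma nmZi H (x : H) : nm ('i%C *: x) = nm x.
Proof. by rewrite nmZ normc_def /= expr0n add0r expr1n sqrtr1 mulr1. Qed.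

Lemma rdotDl H (x y z : H) : rdot (x + y) z = rdot x z + rdot y z.
Proof. by rewrite /rdot linearDl raddfD. Qed.

Lemma rdotDr H (x y z : H) : rdot z (x + y) = rdot z x + rdot z y.
Proof. by rewrite /rdot linearDr raddfD. Qed.

Lemma rdotNl H (x z : H) : rdot (- x) z = - rdot x z.
Proof. by rewrite /rdot linearNl raddfN. Qed.

Lemma rdotNr H (x z : H) : rdot z (- x) = - rdot z x.
Proof. by rewrite /rdot linearNr raddfN. Qed.

Lemma rdotBl H (x y z : H) : rdot (x - y) z = rdot x z - rdot y z.
Proof. by rewrite rdotDl rdotNl. Qed.

Lemma rdotBr H (x y z : H) : rdot z (x - y) = rdot z x - rdot z y.
Proof. by rewrite rdotDr rdotNr. Qed.

Lemma rdot0l H (z : H) : rdot 0 z = 0.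
Proof. by rewrite -[0](subrr z) rdotBl subrr. Qed.

Lemma rdot0r H (z : H) : rdot z 0 = 0.
Proof. by rewrite -[0](subrr z) rdotBr subrr. Qed.

Lemma rdotZl H (c : R) (x y : H) : rdot (c%:C *: x) y = c * rdot x y.
Proof. by rewrite /rdot linearZl_LR /=; case: (dot H x y) => a b /=; rewrite mul0r subr0. Qed.

Lemma dotC H (x y : H) : dot H x y = (dot H y x)^*.
Proof. by rewrite hermC expr0 mul1r. Qed.

Lemma rdotC H (x y : H) : rdot x y = rdot y x.
Proof. by rewrite /rdot dotC; case: (dot H y x). Qed.

Lemma rdotZr H (c : R) (x y : H) : rdot x (c%:C *: y) = c * rdot x y.
Proof. by rewrite rdotC rdotZl rdotC. Qed.

Lemma rdotil H (x y : H) : rdot ('i%C *: x) y = - complex.Im (dot H x y).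
Proof. by rewrite /rdot linearZl_LR /=; case: (dot H x y) => a b /=; rewrite mul0r mul1r sub0r. Qed.

Lemma rdotir H (x y : H) : rdot x ('i%C *: y) = complex.Im (dot H x y).
Proof. by rewrite rdotC rdotil dotC; case: (dot H x y) => a b /=; rewrite opprK. Qed.

Lemma rdotii H (x y : H) : rdot ('i%C *: x) y = - rdot x ('i%C *: y).
Proof. by rewrite rdotil rdotir. Qed.

Lemma dotE H (x y : H) : dot H x y = rdot x y +i* rdot x ('i%C *: y).
Proof. by rewrite rdotir /rdot; case: (dot H x y). Qed.

Lemma scaleE H (c : R[i]) (x : H) :
  c *: x = (complex.Re c)%:C *: x + (complex.Im c)%:C *: ('i%C *: x).
Proof. by rewrite scalerA -scalerDl [_ * 'i%C]mulrC -complexE. Qed.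

Lemma rdot_suml H (I : Type) (r : seq I) (P : pred I) (F : I -> H) y :
  rdot (\sum_(i <- r | P i) F i) y = \sum_(i <- r | P i) rdot (F i) y.
Proof.
elim/big_rec2: _; first by rewrite rdot0l.
by move=> i a b _ <-; rewrite rdotDl.
Qed.

Lemma rdot_sumr H (I : Type) (r : seq I) (P : pred I) (F : I -> H) y :
  rdot y (\sum_(i <- r | P i) F i) = \sum_(i <- r | P i) rdot y (F i).
Proof. by rewrite rdotC rdot_suml; apply: eq_bigr => i _; rewrite rdotC. Qed.

Lemma nm2D H (x y : H) :
  nm (x + y) ^+ 2 = nm x ^+ 2 + 2 * rdot x y + nm y ^+ 2.
Proof. by rewrite !nm2E rdotDl !rdotDr [rdot y x]rdotC; ring. Qed.

Lemma nm2B H (x y : H) :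
  nm (x - y) ^+ 2 = nm x ^+ 2 - 2 * rdot x y + nm y ^+ 2.
Proof. by rewrite nm2D rdotNr nmN; ring. Qed.

Lemma rdot_le H (x y : H) : rdot x y <= nm x * nm y.
Proof.
have := nmD x y; rewrite -(@ler_pXn2r _ 2%N) ?nnegrE ?addr_ge0 ?nm_ge0//.
by rewrite nm2D sqrrD; lra.
Qed.

Lemma rdot_abs H (x y : H) : `|rdot x y| <= nm x * nm y.
Proof.
rewrite ler_norml rdot_le andbT.
by have := rdot_le (- x) y; rewrite rdotNl nmN; lra.
Qed.

Lemma rdot_nondeg H (x : H) : (forall y, rdot x y = 0) -> x = 0.
Proof.
by move=> h; apply: nm_eq0; apply/eqP; rewrite -sqrf_eq0 nm2E h.
Qed.

Lemma rdot_inj H (x x' : H) : (forall y, rdot x y = rdot x' y) -> x = x'.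
Proof.
by move=> h; apply/subr0_eq/rdot_nondeg => y; rewrite rdotBl h subrr.
Qed.

Lemma posCP (e : R[i]) : 0 < e -> exists2 r : R, 0 < r & e = r%:C.
Proof.
case: e => a b; rewrite ltcE /= => /andP[/eqP -> h].
by exists a.
Qed.

Lemma cvg_nm H (T : Type) (F : set_system T) {FF : Filter F} (f : T -> H) (x : H) :
  (f t @[t --> F] --> x) <-> (forall e : R, 0 < e -> \forall t \near F, nm (f t - x) < e).
Proof.
split=> [/cvgrPdist_lt h e e0|h].
  have := h e%:C; rewrite ltcR => /(_ e0) => /= h'.
  by apply: filterS h' => t; rewrite normE ltcR nmBC.
apply/cvgrPdist_lt => e /posCP[r r0 ->].
by apply: filterS (h r r0) => t; rewrite normE ltcR nmBC.
Qed.

Lemma cvg_nm0 H (f : nat -> H) (x : H) :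
  (f @ \oo --> x) <-> (forall e : R, 0 < e -> exists N, forall n, (N <= n)%N -> nm (f n - x) < e).
Proof.
split=> [/cvg_nm h e e0|h].
  by have [N _ HN] := h e e0; exists N => n Nn; exact: HN.
by apply/cvg_nm => e e0; have [N HN] := h e e0; exists N.
Qed.

Lemma cauchy_nm H (f : nat -> H) :
  (forall e : R, 0 < e -> exists N, forall m n, (N <= m)%N -> (N <= n)%N -> nm (f m - f n) < e) ->
  exists x : H, f @ \oo --> x.
Proof.
move=> h; apply/cvg_ex; apply: cauchy_cvg.
apply: cauchy_exP => e /posCP[r r0 ->].
have [N HN] := h r r0; exists (f N); exists N => // n /= Nn.
by rewrite -ball_normE /= normE ltcR; apply: HN.
Qed.

Lemma closure_nm H (S : set H) (x : H) :
  closure S x <-> forall e : R, 0 < e -> exists2 y, S y & nm (x - y) < e.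
Proof.
split=> [h e e0|h].
  have /h [y [Sy]] : nbhs x (ball x (e%:C)) by apply: nbhsx_ballx; rewrite ltcR.
  by rewrite -ball_normE /= normE ltcR => xy; exists y.
move=> B /nbhs_ballP [e /= /posCP[r r0 ->]] hB.
have [y Sy xy] := h r r0; exists y; split=> //; apply: hB.
by rewrite -ball_normE /= normE ltcR.
Qed.

End RealHilbert.

(** * Orthogonal projection in finite direct sums *)

Section Projection.
Variable R : realType.

Lemma sub_midpoint (H : hilbert R) (v w : H) :
  v - (1 / 2)%:C *: (v - w) = (1 / 2)%:C *: (v + w).
Proof.
rewrite scalerBr opprB scalerDr addrC -addrA [RHS]addrC.
congr (_ + _); apply/eqP; rewrite addrC subr_eq -scalerDl -rmorphD /=.
by rewrite (_ : 1 / 2 + 1 / 2 = 1) ?scale1r //; lra.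
Qed.

(** [eta] is the component of [t] orthogonal to the closure of [X] in the direct sum of the [H i],
    whose vectors are kept as dependent functions. A minimizing sequence for the distance is Cauchy
    by the parallelogram law, and minimality gives orthogonality. Only real linear combinations are
    required, so that [X] may be the orbit of a vector under self-adjoint elements. *)
Lemma hilbert_projection (I : finType) (H : I -> hilbert R)
    (X : set (forall i, H i)) (t : forall i, H i) :
  X (fun=> 0) ->
  (forall (r : R) x y, X x -> X y -> X (fun i => x i + r%:C *: y i)) ->
  exists eta : forall i, H i,
    (forall e : R, 0 < e ->
      exists2 x, X x & forall i, nm (t i - x i - eta i) < e) /\
    (forall x, X x -> \sum_i rdot (eta i) (x i) = 0).
Proof.
move=> X0 XL.
pose Q (x : forall i, H i) : R := \sum_i nm (t i - x i) ^+ 2.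
have Q0 x : 0 <= Q x by apply: sumr_ge0 => i _; exact: sqr_ge0.
have hQ : has_inf (Q @` X).
  by split; [exists (Q (fun=> 0)); exists (fun=> 0) | exists 0 => _ [x _ <-]].
set d := inf (Q @` X).
have dQ x : X x -> d <= Q x by move=> Xx; apply: ge_inf hQ.2 _ _; exists x.
have [iv [iv0 inv_lt]] : exists iv : nat -> R, (forall n, 0 < iv n) /\
    forall e : R, 0 < e -> exists N : nat, forall n, (N <= n)%N -> iv n < e.
  exists (fun n => n.+1%:R^-1); split=> [n|e e0].
    by rewrite invr_gt0 ltr0n.
  have [N _ HN] := near_infty_natSinv_lt (PosNum e0).
  by exists N => n /HN.
have /choice [u Hu] : forall n : nat, exists x, X x /\ Q x < d + iv n.
  by move=> n; have [_ [x Xx <-] h] := inf_adherent (iv0 n) hQ; exists x.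
have uX n := (Hu n).1; have uQ n := (Hu n).2.
(* Parallelogram law; the vector [x + (1/2)(y - x)] is the midpoint, written in the form allowed by
   [XL]. *)
have para x y i : nm (x i - y i) ^+ 2 <=
     2 * (nm (t i - x i) ^+ 2 + nm (t i - y i) ^+ 2)
     - 4 * nm (t i - (x i + (1/2)%:C *: (y i + (-1)%:C *: x i))) ^+ 2.
  set v := t i - x i; set w := t i - y i.
  have -> : x i - y i = w - v by rewrite /v /w opprB [RHS]addrC subrKA.
  have -> : t i - (x i + (1 / 2)%:C *: (y i + (-1)%:C *: x i)) =
     (1/2)%:C *: (v + w).
    have -> : y i + (-1)%:C *: x i = v - w.
      by rewrite /v /w opprB [RHS]addrC subrKA rmorphN rmorph1 scaleN1r.
    by rewrite opprD addrA -/v sub_midpoint.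
  rewrite nmZr exprMn [`|_|]ger0_norm; last by lra.
  by have := nm2D v w; have := nm2B w v; rewrite [rdot w v]rdotC; lra.
have cau m n i : nm (u m i - u n i) ^+ 2 <= 2 * (iv m + iv n).
  pose z i := u m i + (1/2)%:C *: (u n i + (-1)%:C *: u m i).
  have zX : X z by apply: (XL) => //; exact: XL.
  have := dQ _ zX; have := uQ m; have := uQ n => h1 h2 h3.
  have : \sum_i nm (u m i - u n i) ^+ 2 <= 2 * (Q (u m) + Q (u n)) - 4 * Q z.
    rewrite /Q -big_split /= !mulr_sumr -sumrB; apply: ler_sum => j _; exact: para.
  have : nm (u m i - u n i) ^+ 2 <= \sum_i nm (u m i - u n i) ^+ 2.
    rewrite (bigD1 i) //= lerDl; apply: sumr_ge0 => j _; exact: sqr_ge0.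
  lra.
have lim i : exists l : H i, (fun n => u n i) @ \oo --> l.
  apply: cauchy_nm => e e0.
  have [N HN] := inv_lt (e ^+ 2 / 4) ltac:(by rewrite divr_gt0 ?exprn_gt0).
  exists N => m n Nm Nn.
  rewrite -(@ltr_pXn2r _ 2%N) ?nnegrE ?nm_ge0 ?ltW//.
  have := cau m n i; have := HN _ Nm; have := HN _ Nn; lra.
pose l i := projT1 (cid (lim i)).
have lP i : (fun n => u n i) @ \oo --> l i by rewrite /l; case: cid.
have lN (e : R) : 0 < e -> exists N, forall n, (N <= n)%N -> forall i, nm (u n i - l i) < e.
  move=> e0; have [] : \forall n \near \oo, forall i, nm (u n i - l i) < e.
    apply: filter_forall => i; have [N HN] := (cvg_nm0 _ _).1 (lP i) e e0.
    by exists N => // n /HN.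
  by move=> N _ HN; exists N => n /HN.
exists (fun i => t i - l i); split.
  move=> e e0; have [N HN] := lN e e0; exists (u N) => // i.
  by rewrite opprB addrC subrKA nmBC; apply: HN.
move=> x Xx; set a := \sum_i _.
pose b := \sum_i nm (x i) ^+ 2; pose c := \sum_i nm (x i).
have b0 : 0 <= b by apply: sumr_ge0 => i _; exact: sqr_ge0.
have c0 : 0 <= c by apply: sumr_ge0 => i _; exact: nm_ge0.
(* Minimality compared along [u n + r x]: the increment of [Q] is at least [- iv n], and the inner
   products with [t - u n] tend to [a]. *)
have key r : 2 * r * a <= r ^+ 2 * b.
  apply/ler_addgt0Pr => e e0.
  have e1 : 0 < e / 2 by lra.
  have f0 : 0 < 2 * (`|r| * c) + 1 by have := normr_ge0 r; nra.
  have [N HN] := lN _ (divr_gt0 e1 f0).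
  have [M HM] := inv_lt _ e1.
  pose n := maxn M N.
  have := HM n (leq_maxl _ _); have := HN n (leq_maxr _ _) => h1 h2.
  have := dQ _ (XL r _ _ (uX n) Xx).
  have -> : Q (fun i => u n i + r%:C *: x i) =
      Q (u n) - 2 * r * \sum_i rdot (t i - u n i) (x i) + r ^+ 2 * b.
    rewrite /Q /b !mulr_sumr -sumrB -big_split /=; apply: eq_bigr => i _.
    by rewrite opprD addrA [in LHS]nm2B rdotZr nmZr exprMn real_normK ?num_real//; ring.
  have : `|\sum_i rdot (t i - u n i) (x i) - a| <= (e / 2) / (2 * (`|r| * c) + 1) * c.
    rewrite /a -sumrB /c mulr_sumr; apply: le_trans (ler_norm_sum _ _ _) _.
    apply: ler_sum => i _; rewrite -rdotBl; apply: le_trans (rdot_abs _ _) _.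
    apply: ler_wpM2r; first exact: nm_ge0.
    by rewrite opprB addrC subrKA nmBC; exact: ltW.
  set S := \sum_i _; set dl := e / 2 / _ => hS hd.
  have dl0 : 0 <= dl by rewrite divr_ge0 ?ltW.
  have dlE : dl * (2 * (`|r| * c) + 1) = e / 2 by rewrite mulfVK // gt_eqF.
  have r0 := normr_ge0 r.
  have h3 : 2 * r * (a - S) <= 2 * (`|r| * (dl * c)).
    apply: le_trans (ler_norm _) _; rewrite !normrM ger0_norm // -mulrA.
    by rewrite ler_pM2l // ler_wpM2l // distrC.
  have : 2 * (`|r| * (dl * c)) <= e / 2 by rewrite -dlE; nra.
  by have := uQ n; lra.
(* At this value q of r, the inequality becomes [2 q^2 (b + 1) <= q^2 b], which forces q = 0. *)
have := key (a / (b + 1)); have b1 : 0 < b + 1 by lra.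
set q := a / (b + 1); have -> : a = q * (b + 1) by rewrite mulfVK // gt_eqF.
move=> hq; have q0 : q ^+ 2 = 0.
  by apply/eqP; rewrite eq_le sqr_ge0 andbT; have := sqr_ge0 q; nra.
by move/eqP: q0; rewrite sqrf_eq0 => /eqP ->; rewrite mul0r.
Qed.
End Projection.

(** * Bounded operators and adjoints *)

Section Operators.
Variable R : realType.
Implicit Types H K E : hilbert R.

Definition opb H K (M : R) (T : H -> K) := forall x, nm (T x) <= M * nm x.

Lemma linop0 H K (T : H -> K) : linear T -> T 0 = 0.
Proof. by move=> h; have := h (-1) 0 0; rewrite scaler0 addr0 scaleN1r => ->; rewrite addrC subrr. Qed.

Lemma linopD H K (T : H -> K) : linear T -> forall x y, T (x + y) = T x + T y.
Proof. by move=> h x y; have := h 1 x y; rewrite !scale1r. Qed.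

Lemma linopZ H K (T : H -> K) : linear T -> forall c x, T (c *: x) = c *: T x.
Proof. by move=> h c x; have := h c x 0; rewrite (linop0 h) !addr0. Qed.

Lemma linopN H K (T : H -> K) : linear T -> forall x, T (- x) = - T x.
Proof. by move=> h x; rewrite -scaleN1r (linopZ h) scaleN1r. Qed.

Lemma linopB H K (T : H -> K) : linear T -> forall x y, T (x - y) = T x - T y.
Proof. by move=> h x y; rewrite (linopD h) (linopN h). Qed.

Lemma linop_sum H K (T : H -> K) : linear T ->
  forall (I : Type) (r : seq I) (P : pred I) (F : I -> H),
  T (\sum_(i <- r | P i) F i) = \sum_(i <- r | P i) T (F i).
Proof.
move=> h I r P F; elim/big_rec2: _; first exact: linop0.
by move=> i a b _ <-; rewrite (linopD h).
Qed.

Lemma bopP H K (T : H -> K) :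
  bop T <-> linear T /\ exists2 M, 0 <= M & opb M T.
Proof.
split=> [[lT cT]|[lT [M M0 hM]]]; split=> //.
  have /cvg_nm /(_ 1 ltr01) := cT 0; rewrite (linop0 lT)  => /nbhs_ballP [_ /= /posCP [d d0 ->] hd].
  have hd' x : nm x < d -> nm (T x) < 1.
    move=> xd; have := hd x; rewrite -ball_normE /= sub0r normrN normE ltcR subr0.
    exact.
  exists (2 / d); first by rewrite divr_ge0 // ltW.
  move=> x; have := nm_ge0 x; rewrite le_eqVlt => /orP[/eqP/esym/nm_eq0 ->|x0].
    by rewrite (linop0 lT)  !nm0 mulr0.
  have c0 : 0 < d / 2 / nm x by rewrite !divr_gt0.
  have := hd' ((d / 2 / nm x)%:C *: x).
  rewrite (linopZ lT)  !nmZr gtr0_norm // mulfVK ?gt_eqF // => /(_ ltac:(lra)) h.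
  have -> : 2 / d * nm x = (d / 2 / nm x)^-1 by rewrite invf_div invf_div [RHS]mulrC.
  by rewrite -[leRHS]div1r ler_pdivlMr // mulrC ltW.
move=> x; apply/cvg_nm => e e0; have f0 : 0 < e / (M + 1) by rewrite divr_gt0 //; lra.
apply/nbhs_ballP; exists (e / (M + 1))%:C; first by rewrite /= ltcR.
move=> y; rewrite -ball_normE /= normE ltcR nmBC => xy; rewrite -(linopB lT).
apply: le_lt_trans (hM _) _.
have := mulfVK (lt0r_neq0 (ltac:(lra) : 0 < M + 1)) e.
have := nm_ge0 (y - x); nra.
Qed.

Lemma bop_lin H K (T : H -> K) : bop T -> linear T. Proof. by case. Qed.

Lemma bop_bound H K (T : H -> K) : bop T -> exists2 M, 0 < M & opb M T.
Proof.
move=> /bopP[_ [M M0 hM]]; exists (M + 1); first lra.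
by move=> x; apply: le_trans (hM x) _; have := nm_ge0 x; nra.
Qed.

Lemma mkbop H K (T : H -> K) M : linear T -> opb M T -> bop T.
Proof.
move=> lT hM; apply/bopP; split=> //; exists `|M| => // x.
by apply: le_trans (hM x) _; apply: ler_wpM2r (nm_ge0 x) _ _ (ler_norm _).
Qed.

Lemma mklin H K (T : H -> K) :
  (forall x y, T (x + y) = T x + T y) -> (forall (r : R) x, T (r%:C *: x) = r%:C *: T x) ->
  (forall x, T ('i%C *: x) = 'i%C *: T x) -> linear T.
Proof.
move=> hD hZ hi c x y; rewrite hD [in LHS]scaleE [in RHS]scaleE hD.
by rewrite !hZ hi.
Qed.

Lemma bop_comp H K E (S : K -> E) (T : H -> K) : bop S -> bop T -> bop (S \o T).
Proof.
move=> bS bT; have [M M0 hM] := bop_bound bS; have [N N0 hN] := bop_bound bT.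
apply: (@mkbop _ _ _ (M * N)).
  by move=> c x y /=; rewrite (bop_lin bT) (bop_lin bS).
move=> x /=; apply: le_trans (hM _) _.
by rewrite -mulrA ler_pM2l //; exact: hN.
Qed.

Lemma opb_comp H K E (S : K -> E) (T : H -> K) M N :
  0 <= M -> opb M S -> opb N T -> opb (M * N) (S \o T).
Proof.
move=> M0 hM hN x /=; apply: le_trans (hM _) _.
by rewrite -mulrA ler_wpM2l //; exact: hN.
Qed.

Lemma opbD H K (S T : H -> K) M N : opb M S -> opb N T -> opb (M + N) (S + T).
Proof.
move=> hM hN x; rewrite fctE mulrDl; apply: le_trans (nmD _ _) _.
exact: lerD.
Qed.

Lemma opbN H K (S : H -> K) M : opb M S -> opb M (- S).
Proof. by move=> hM x; rewrite fctE nmN. Qed.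

Lemma opbB H K (S T : H -> K) M N : opb M S -> opb N T -> opb (M + N) (S - T).
Proof. by move=> hM hN; apply: opbD => //; apply: opbN. Qed.

Lemma opbBC H K (S T : H -> K) M : opb M (S - T) -> opb M (T - S).
Proof. by move=> h x; have := h x; rewrite !fctE nmBC. Qed.

Lemma opbZ H K (S : H -> K) M (c : R) : opb M S -> opb (`|c| * M) (c%:C *: S).
Proof. by move=> hM x; rewrite fctE nmZr -mulrA ler_wpM2l. Qed.

Lemma opb_le H K (S : H -> K) M N : M <= N -> opb M S -> opb N S.
Proof. by move=> MN hM x; apply: le_trans (hM x) _; apply: ler_wpM2r (nm_ge0 x) _ _ MN. Qed.

Lemma opb_id H : opb 1 (@id H). Proof. by move=> x; rewrite mul1r. Qed.

Lemma opb0 H K M : 0 <= M -> opb M (0 : H -> K).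
Proof. by move=> M0 x; rewrite nm0 mulr_ge0 ?nm_ge0. Qed.

Lemma bopD H K (S T : H -> K) : bop S -> bop T -> bop (S + T).
Proof.
move=> bS bT; have [M M0 hM] := bop_bound bS; have [N N0 hN] := bop_bound bT.
apply: (mkbop _ (opbD hM hN)) => c x y.
by rewrite !fctE (bop_lin bT) (bop_lin bS) scalerDr addrACA.
Qed.

Lemma bopZ H K (c : R[i]) (T : H -> K) : bop T -> bop (c *: T).
Proof.
move=> bT; have [M M0 hM] := bop_bound bT.
apply: (@mkbop _ _ _ (M * complex.Re `|c|)).
  by move=> d x y; rewrite !fctE (bop_lin bT) scalerDr !scalerA mulrC.
move=> x; rewrite fctE nmZ mulrAC ler_wpM2r //.
by rewrite normc_def /= sqrtr_ge0.
Qed.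

Lemma bopN H K (T : H -> K) : bop T -> bop (- T).
Proof. by move=> bT; rewrite -scaleN1r; exact: bopZ. Qed.

Lemma bopB H K (S T : H -> K) : bop S -> bop T -> bop (S - T).
Proof. by move=> bS bT; apply: bopD => //; exact: bopN. Qed.

Lemma bop_id H : bop (@id H).
Proof. by apply: (mkbop _ (@opb_id H)). Qed.

Lemma bop0 H K : bop (0 : H -> K).
Proof. by apply: (mkbop _ (@opb0 H K 0 (lexx _))) => c x y; rewrite scaler0 addr0. Qed.

Lemma bop_sum H K (I : Type) (r : seq I) (P : pred I) (F : I -> H -> K) :
  (forall i, P i -> bop (F i)) -> bop (\sum_(i <- r | P i) F i).
Proof. by move=> h; elim/big_rec: _ => [|i T Pi bT]; [exact: bop0|apply: bopD => //; exact: h]. Qed.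

(** The representing vector is a multiple of the component orthogonal to ker f of some [t] with
    [f t <> 0]. Real functionals on the underlying real space are enough, because [dotE] recovers
    the complex inner product. *)
Lemma riesz H (f : H -> R) M :
  (forall x y, f (x + y) = f x + f y) -> (forall (r : R) x, f (r%:C *: x) = r * f x) ->
  (forall x, `|f x| <= M * nm x) -> exists y, forall x, f x = rdot x y.
Proof.
move=> fD fZ fM.
have fB x y : f (x - y) = f x - f y.
  by rewrite fD -[- y]scaleN1r -(rmorph1 (real_complex R)) -rmorphN fZ mulN1r.
have f0 : f 0 = 0 by rewrite -[0](subrr 0) fB subrr.
have [h0|/existsNP [t ft]] := pselect (forall x, f x = 0).
  by exists 0 => x; rewrite rdot0r.
have [] := @hilbert_projection R 'I_1 (fun=> H) [set x | f (x ord0) = 0] (fun=> t).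
- exact: f0.
- by move=> r x y /= hx hy; rewrite fD fZ hx hy mulr0 addr0.
move=> eta [h1 h2]; set e := eta ord0.
(* [t - e] is a limit of kernel elements and f is continuous. *)
have fe : f e = f t.
  apply/eqP; rewrite -subr_eq0 -fB -normr_le0; apply/ler_addgt0Pr => d d0; rewrite add0r.
  have M0 : 0 < `|M| + 1 by have := normr_ge0 M; lra.
  have [x /= fx /(_ ord0) hx] := h1 _ (divr_gt0 d0 M0).
  have -> : f (e - t) = f (e - (t - x ord0)) by rewrite [LHS]fB [RHS]fB fB fx subr0.
  apply: le_trans (fM _) _; rewrite nmBC.
  have := mulfVK (lt0r_neq0 M0) d; move: hx; set q := d / _ => hx <-.
  by have := nm_ge0 (t - x ord0 - e); have := ler_norm M; rewrite -/e in hx *; nra.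
have e0 : nm e != 0.
  apply/eqP => /nm_eq0 ee; apply: ft.
  by rewrite -fe ee f0.
have ft0 : f t != 0 by apply/eqP.
exists ((f t / nm e ^+ 2)%:C *: e) => x; rewrite rdotZr.
have := h2 (fun=> x - (f x / f t)%:C *: e); rewrite big_ord1 => /(_ _) h.
have : rdot e (x - (f x / f t)%:C *: e) = 0.
  by apply: h; rewrite /= fB fZ fe mulfVK ?subrr.
rewrite rdotBr rdotZr -nm2E rdotC => /eqP; rewrite subr_eq0 => /eqP ->.
by field; rewrite ft0 e0.
Qed.

Lemma rdot_dot H K (T : H -> K) (S : K -> H) : linear T -> linear S ->
  (forall x y, rdot (T x) y = rdot x (S y)) ->
  forall x y, dot K (T x) y = dot H x (S y).
Proof. by move=> lT lS h x y; rewrite !dotE !h (linopZ lS). Qed.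

Lemma adj_exists H K (T : H -> K) : bop T ->
  exists S : K -> H, bop S /\ forall x y, rdot (T x) y = rdot x (S y).
Proof.
move=> bT; have lT := bop_lin bT; have [M M0 hM] := bop_bound bT.
have /choice [S hS] : forall y, exists z, forall x, rdot (T x) y = rdot x z.
  move=> y; apply: (@riesz _ _ (M * nm y)).
  - by move=> a b; rewrite (linopD lT)  rdotDl.
  - by move=> r a; rewrite (linopZ lT)  rdotZl.
  - move=> x; apply: le_trans (rdot_abs _ _) _; rewrite mulrAC.
    exact: ler_wpM2r (nm_ge0 y) _ _ (hM x).
exists S; split=> //; apply: (@mkbop _ _ _ M).
  apply: mklin => [x y|r x|x]; apply: rdot_inj => z; rewrite ?rdotDl ![rdot _ z]rdotC.
  - by rewrite -!hS rdotDr.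
  - by rewrite rdotZr -!hS rdotZr.
  - by rewrite -hS -[RHS]opprK -rdotii -hS (linopZ lT)  rdotii opprK.
move=> y; have := nm_ge0 (S y); rewrite le_eqVlt => /orP[/eqP <-|y0].
  by rewrite mulr_ge0 ?nm_ge0 // ltW.
rewrite -(ler_pM2r y0) -expr2 nm2E -hS.
apply: le_trans (rdot_le _ _) _; have := hM (S y); have := nm_ge0 y; nra.
Qed.

Lemma adj_spec H K (T : H -> K) : bop T ->
  bop (adj T) /\ forall x y, dot K (T x) y = dot H x (adj T y).
Proof.
move=> bT; rewrite /adj; apply: (@xgetPex _ _ [set S | bop S /\ _]).
have [S [bS hS]] := adj_exists bT; exists S; split=> //.
by apply: rdot_dot => //; exact: bop_lin.
Qed.

Lemma bop_adj H K (T : H -> K) : bop T -> bop (adj T).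
Proof. by move=> /adj_spec[]. Qed.

Lemma adjE H K (T : H -> K) x y : bop T -> rdot (T x) y = rdot x (adj T y).
Proof. by move=> /adj_spec[_ h]; rewrite /rdot h. Qed.

Lemma adjEr H K (T : H -> K) x y : bop T -> rdot (adj T x) y = rdot x (T y).
Proof. by move=> bT; rewrite rdotC -adjE // rdotC. Qed.

Lemma adj_uniq H K (T : H -> K) (S : K -> H) : bop T ->
  (forall x y, rdot (T x) y = rdot x (S y)) -> adj T = S.
Proof.
move=> bT h; apply/funext => y; apply: rdot_inj => x.
by rewrite ![rdot _ x]rdotC -adjE // h.
Qed.

Lemma adjK H K (T : H -> K) : bop T -> adj (adj T) = T.
Proof. by move=> bT; apply: adj_uniq => [|x y]; [exact: bop_adj|rewrite adjEr]. Qed.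

Lemma adj_comp H K E (S : K -> E) (T : H -> K) : bop S -> bop T ->
  adj (S \o T) = adj T \o adj S.
Proof.
move=> bS bT; apply: adj_uniq; first exact: bop_comp.
by move=> x y /=; rewrite adjE // adjE.
Qed.

Lemma adjD H K (S T : H -> K) : bop S -> bop T -> adj (S + T) = adj S + adj T.
Proof.
move=> bS bT; apply: adj_uniq; first exact: bopD.
by move=> x y; rewrite !fctE rdotDl rdotDr !adjE.
Qed.

Lemma adjN H K (S : H -> K) : bop S -> adj (- S) = - adj S.
Proof.
move=> bS; apply: adj_uniq; first exact: bopN.
by move=> x y; rewrite !fctE rdotNl rdotNr !adjE.
Qed.

Lemma adjB H K (S T : H -> K) : bop S -> bop T -> adj (S - T) = adj S - adj T.
Proof. by move=> bS bT; rewrite adjD ?adjN //; exact: bopN. Qed.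

Lemma adjZr H K (c : R) (S : H -> K) : bop S -> adj (c%:C *: S) = c%:C *: adj S.
Proof.
move=> bS; apply: adj_uniq; first exact: bopZ.
by move=> x y; rewrite !fctE rdotZl rdotZr !adjE.
Qed.

Lemma adjZi H K (S : H -> K) : bop S -> adj ('i%C *: S) = - ('i%C *: adj S).
Proof.
move=> bS; apply: adj_uniq; first exact: bopZ.
by move=> x y; rewrite !fctE rdotNr rdotii adjE // (linopZ (bop_lin (bop_adj bS))).
Qed.

Lemma adj0 H K : adj (0 : H -> K) = 0.
Proof. by apply: adj_uniq; [exact: bop0 | move=> x y; rewrite rdot0l rdot0r]. Qed.

Lemma adj_id H : adj (@id H) = id.
Proof. by apply: adj_uniq; first exact: bop_id. Qed.

Lemma opb_adj H K (T : H -> K) M : bop T -> 0 <= M -> opb M T -> opb M (adj T).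
Proof.
move=> bT M0 hM y; have := nm_ge0 (adj T y); rewrite le_eqVlt => /orP[/eqP <-|y0].
  by rewrite mulr_ge0 ?nm_ge0.
rewrite -(ler_pM2r y0) -expr2 nm2E -adjE //.
apply: le_trans (rdot_le _ _) _; have := hM (adj T y); have := nm_ge0 y; nra.
Qed.

End Operators.

(** * Norm limits and fixed points in algebras of operators *)

Section Algebras.
Variable R : realType.
Implicit Types H K E : hilbert R.

Lemma nm_small H (x : H) (C : R) : (forall e, 0 < e -> nm x <= e * C) -> x = 0.
Proof.
move=> h; apply: nm_eq0; apply/eqP; rewrite eq_le nm_ge0 andbT.
apply/ler_addgt0Pr => e e0; rewrite add0r.
have C0 : 0 < `|C| + 1 by have := normr_ge0 C; lra.
apply: le_trans (h _ (divr_gt0 e0 C0)) _.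
have := mulfVK (lt0r_neq0 C0) e; set q := e / _ => eq.
have q0 : 0 < q by rewrite divr_gt0.
by rewrite -[leRHS]eq ler_pM2l //; have := ler_norm C; lra.
Qed.

Lemma opb_eq H K (S T : H -> K) : (forall e, 0 < e -> opb e (S - T)) -> S = T.
Proof.
move=> h; apply/funext => x; apply/subr0_eq/(@nm_small _ _ (nm x)) => e e0.
by have := h e e0 x; rewrite fctE.
Qed.

Lemma bop_limit H K (u : nat -> H -> K) (e : nat -> R) :
  (forall n, bop (u n)) -> (forall n m, (n <= m)%N -> opb (e n) (u m - u n)) ->
  (forall d, 0 < d -> exists N, forall n, (N <= n)%N -> e n < d) ->
  exists T, bop T /\ forall n, opb (e n) (T - u n).
Proof.
move=> bu hu he.
have /choice [T hT] : forall x, exists y : K, (fun n => u n x) @ \oo --> y.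
  move=> x; apply: cauchy_nm => d d0.
  have x0 : 0 < nm x + 1 by have := nm_ge0 x; lra.
  have [N HN] := he _ (divr_gt0 d0 x0).
  exists N => m n Nm Nn.
  have := mulfVK (lt0r_neq0 x0) d; set q := d / _ => dE.
  have q0 : 0 < q by rewrite divr_gt0.
  have aux k l : (N <= k)%N -> (k <= l)%N -> nm (u l x - u k x) < d.
    move=> Nk kl; have := hu k l kl x; rewrite fctE => h; apply: le_lt_trans h _.
    by rewrite -dE; have := HN k Nk; have := nm_ge0 x; rewrite -/q; nra.
  have [mn|/ltnW nm] := leqP m n; last exact: aux.
  by rewrite nmBC; exact: aux.
have TB n : opb (e n) (T - u n).
  move=> x; rewrite fctE; apply/ler_addgt0Pr => d d0.
  have [N HN] := (cvg_nm0 _ _).1 (hT x) d d0.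
  have := HN (maxn N n) (leq_maxl _ _); have := hu n (maxn N n) (leq_maxr _ _) x.
  rewrite fctE; set w := u (maxn N n) x => h1; rewrite nmBC => h2.
  have -> : T x - u n x = (T x - w) + (w - u n x) by rewrite subrKA.
  by apply: le_trans (nmD _ _) _; lra.
exists T; split=> //.
have lT : linear T.
  move=> c x y; apply: subr0_eq.
  apply: (@nm_small _ _ (nm (c *: x + y) + nm x * complex.Re `|c| + nm y)) => d d0.
  have [N HN] := he _ d0; have := HN N (leqnn _) => /ltW hN.
  have := opb_le hN (TB N) => h.
  have := h (c *: x + y); have := h x; have := h y; rewrite !fctE (bop_lin (bu N)).
  set a := T y - _; set b := T x - _; set a' := T (_ + _) - _ => h1 h2 h3.
  have -> : T (c *: x + y) - (c *: T x + T y) = a' - (c *: b + a).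
    by rewrite /a' /b /a scalerBr addrACA -opprD opprB subrKA.
  apply: le_trans (nmB _ _) _.
  apply: le_trans (lerD h3 (nmD _ _)) _; rewrite nmZ.
  have : 0 <= complex.Re `|c| by rewrite normc_def /= sqrtr_ge0.
  nra.
have [M M0 hM] := bop_bound (bu 0%N).
apply: (@mkbop _ _ _ _ (e 0%N + M)) => // x.
by have := opbD (TB 0%N) hM x; rewrite !fctE subrK.
Qed.

Lemma geom_small (q c : R) : 0 <= q < 1 ->
  forall d, 0 < d -> exists N, forall n, (N <= n)%N -> q ^+ n * c < d.
Proof.
move=> /andP[q0 q1] d d0.
have C0 : 0 < `|c| + 1 by have := normr_ge0 c; lra.
have /cvgrPdist_lt /(_ _ (divr_gt0 d0 C0)) [N _ HN] : (fun n => q ^+ n) @ \oo --> (0 : R).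
  by apply: cvg_expr; rewrite ger0_norm.
exists N => n /HN /=; rewrite sub0r normrN ger0_norm ?exprn_ge0 //.
have := mulfVK (lt0r_neq0 C0) d; set p := d / _ => dE h.
apply: le_lt_trans (_ : q ^+ n * (`|c| + 1) < d); last by rewrite -[ltRHS]dE ltr_pM2r.
by rewrite ler_wpM2l ?exprn_ge0 //; have := ler_norm c; lra.
Qed.

(** Banach's fixed point theorem, started at 0. It replaces the continuous functional calculus:
    square roots, resolvents and the inverse of 2t/(1+t^2) are all fixed points, and norm-closedness
    of [P] keeps them in the algebra. *)
Lemma op_fixpoint H (P : set (H -> H)) (F : (H -> H) -> (H -> H)) (q : R) :
  0 <= q < 1 -> P `<=` @bop R H H -> P 0 -> (forall x, P x -> P (F x)) ->
  (forall x y d, P x -> P y -> 0 <= d -> opb d (x - y) -> opb (q * d) (F x - F y)) ->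
  (forall T, bop T -> (forall e, 0 < e -> exists2 S, P S & opb e (T - S)) -> P T) ->
  exists2 b, P b & F b = b.
Proof.
move=> q01 Pb P0 PF Fq Pc; have /andP[q0 q1] := q01.
pose u n := iter n F 0.
have Pu n : P (u n) by elim: n => //= n; exact: PF.
have [d d0 hd] := bop_bound (Pb _ (PF _ P0)).
have step n : opb (q ^+ n * d) (u n.+1 - u n).
  elim: n => [|n IH]; first by rewrite expr0 mul1r /= subr0.
  by rewrite exprS -mulrA; apply: (Fq _ _ _ (Pu n.+1) (Pu n) _ IH); rewrite mulr_ge0 ?exprn_ge0 // ltW.
(* The geometric sum of all step bounds [q ^+ n * d], hence [c q^n] bounds the distance from [u n]
   to every later iterate. *)
pose c := d / (1 - q); have cE : d = c * (1 - q) by rewrite mulfVK // subr_eq0 gt_eqF.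
have c0 : 0 < c by rewrite divr_gt0 // subr_gt0.
have dist n m : (n <= m)%N -> opb (q ^+ n * c) (u m - u n).
  move=> /subnK <-; move: (m - n)%N => k; elim: k n => [|k IH] n.
    by rewrite add0n subrr; apply: opb0; rewrite mulr_ge0 ?exprn_ge0 // ltW.
  rewrite addSnnS; have := opbD (IH n.+1) (step n); rewrite subrKA.
  by apply: opb_le; rewrite cE exprS; have := exprn_ge0 n q0; nra.
have [b [bb hb]] := bop_limit (fun n => Pb _ (Pu n)) dist (geom_small c q01).
have Pbb : P b.
  apply: Pc => // e e0; have [N HN] := geom_small c q01 e0.
  by exists (u N) => //; apply: opb_le (hb N); apply/ltW/HN.
exists b => //; apply: opb_eq => e e0.
have [N HN] := geom_small c q01 (ltac:(lra) : 0 < e / 2).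
have qc0 k : 0 <= q ^+ k * c by rewrite mulr_ge0 ?exprn_ge0 // ltW.
have h1 := hb N.+1; have h2 := Fq _ _ _ Pbb (Pu N) (qc0 N) (hb N).
have := opbD h2 (opbBC h1); rewrite subrKA; apply: opb_le.
have := HN N (leqnn _); have := HN N.+1 (leqnSn _); rewrite exprS.
by have := exprn_ge0 N q0; nra.
Qed.

End Algebras.

(** * Total sets and bounded extensions *)

Section Spans.
Variable R : realType.
Implicit Types H K E : hilbert R.

Lemma lspan_ind (V : lmodType R[i]) (S P : set V) :
  P 0 -> (forall c s v, S s -> P v -> P (c *: s + v)) -> lspan S `<=` P.
Proof.
move=> P0 PS _ [n [c [s [Ss ->]]]]; elim/big_rec: _ => // i v _; exact: PS.
Qed.

Lemma lspan_sub (V : lmodType R[i]) (S : set V) : S `<=` lspan S.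
Proof.
move=> v Sv; exists 1%N, (fun=> 1), (fun=> v); split=> //.
by rewrite big_ord1 scale1r.
Qed.

Lemma lspan0 (V : lmodType R[i]) (S : set V) : lspan S 0.
Proof. by exists 0%N, (fun=> 0), (fun=> 0); split=> [[]|]; rewrite ?big_ord0. Qed.

Lemma lspanP (V : lmodType R[i]) (S : set V) c u v :
  lspan S u -> lspan S v -> lspan S (c *: u + v).
Proof.
move=> [n [a [s [Ss ->]]]] [m [b [t [St ->]]]].
exists (n + m)%N, (fun i => match fintype.split i with inl j => c * a j | inr j => b j end),
  (fun i => match fintype.split i with inl j => s j | inr j => t j end); split.
  by move=> i; case: fintype.split.
rewrite big_split_ord /= scaler_sumr; congr (_ + _); apply: eq_bigr => i _.
  by case: split_ordP => j /= => [/lshift_inj <-|/eqP]; rewrite ?scalerA // eq_lrshift.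
by case: split_ordP => j /= => [/eqP|/rshift_inj <- //]; rewrite eq_rlshift.
Qed.

Lemma lspanZ (V : lmodType R[i]) (S : set V) c u : lspan S u -> lspan S (c *: u).
Proof. by move=> h; rewrite -[c *: u]addr0; apply: lspanP => //; exact: lspan0. Qed.

Lemma lspanD (V : lmodType R[i]) (S : set V) u v : lspan S u -> lspan S v -> lspan S (u + v).
Proof. by move=> h h'; rewrite -[u]scale1r; exact: lspanP. Qed.

Definition total_set H (S : set H) := closure (lspan S) = setT.

Lemma totalP H (S : set H) : total_set S ->
  forall x e, 0 < e -> exists2 y, lspan S y & nm (x - y) < e.
Proof.
move=> tS x e e0; have [h _] := closure_nm (lspan S) x.
by apply: h e0; have := tS; rewrite /total_set => ->.
Qed.

Lemma total_orth H (S : set H) y : total_set S ->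
  (forall s, S s -> dot H s y = 0) -> y = 0.
Proof.
move=> tS h; apply: (@nm_small _ _ _ 1) => e e0; rewrite mulr1.
have [z Sz hz] := totalP tS y e0.
have : dot H z y = 0.
  move: z Sz {hz}; apply: lspan_ind; first by rewrite linear0l.
  by move=> c s v Ss hv; rewrite linearDl /= linearZl_LR /= h // hv mulr0 addr0.
move=> zy; have := nm2B y z; rewrite [rdot y z]rdotC /rdot zy /=.
have := nm_ge0 y; have := nm_ge0 (y - z); have := sqr_ge0 (nm z); nra.
Qed.

Lemma orth_total H (S : set H) :
  (forall y, (forall s, S s -> dot H s y = 0) -> y = 0) -> total_set S.
Proof.
move=> h; apply/seteqP; split=> // t _; apply/closure_nm => e e0.
have [] := @hilbert_projection R 'I_1 (fun=> H) [set x | lspan S (x ord0)] (fun=> t).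
- exact: lspan0.
- by move=> r x y /= hx hy; rewrite addrC; exact: lspanP.
move=> eta [h1 h2].
have e00 : eta ord0 = 0.
  apply: h => s Ss; rewrite dotE; apply/eqP; rewrite eq_complex /=.
  have o u : lspan S u -> rdot u (eta ord0) = 0.
    by move=> Su; have := h2 (fun=> u) Su; rewrite big_ord1 rdotC.
  have Es := lspan_sub Ss.
  rewrite (o _ Es) -[rdot s ('i%C *: _)]opprK -rdotii (o _ (lspanZ _ Es)).
  by rewrite oppr0 !eqxx.
have [x Sx /(_ ord0)] := h1 e e0; rewrite e00 subr0 => hx.
by exists (x ord0).
Qed.

Lemma total_eq H K (S : set H) (X Y : H -> K) : total_set S -> bop X -> bop Y ->
  (forall s, S s -> X s = Y s) -> X = Y.
Proof.
move=> tS bX bY h; have bD := bopB bX bY.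
apply/subr0_eq/funext => x; apply: rdot_nondeg => y.
rewrite adjE //; suff -> : adj (X - Y) y = 0 by rewrite rdot0r.
apply: (total_orth tS) => s Ss; rewrite -(adj_spec bD).2.
by rewrite fctE h // subrr linear0l.
Qed.

(* [G] is the graph of a densely defined bounded operator. *)
Lemma bounded_extension E K (G : E -> K -> Prop) (C : R) : 0 <= C ->
  (forall c u v u' v', G u v -> G u' v' -> G (c *: u + u') (c *: v + v')) ->
  (forall u v, G u v -> nm v <= C * nm u) ->
  closure [set u | exists v, G u v] = setT ->
  exists X, [/\ bop X, opb C X & forall u v, G u v -> X u = v].
Proof.
move=> C0 GL GB Gd.
(* The closure of the graph. The bound makes it single-valued, and completeness of [K] together with
   density of the domain makes it everywhere defined. *)
pose cl u y := forall e, 0 < e -> exists u' v', [/\ G u' v', nm (u - u') < e & nm (y - v') < e].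
have clB u y : cl u y -> nm y <= C * nm u.
  move=> h; apply/ler_addgt0Pr => e e0.
  have [u' [v' [g h1 h2]]] := h (e / (C + 1)) (ltac:(apply: divr_gt0 => //; lra)).
  have C1 : C + 1 != 0 by apply: lt0r_neq0; lra.
  have := mulfVK C1 e; set q := e / _ in h1 h2 * => qE.
  have := GB _ _ g; have := nmD (y - v') v'; have := nmD (u - (u - u')) (u' - u).
  rewrite subrK opprB addrC subrKA.
  have := nmD u (u' - u); rewrite addrC subrK nmBC; nra.
have clL c u v u' v' : cl u v -> cl u' v' -> cl (c *: u + u') (c *: v + v').
  move=> h h' e e0; pose m := complex.Re `|c|.
  have m0 : 0 <= m by rewrite /m normc_def /= sqrtr_ge0.
  have m1 : m + 1 != 0 by apply: lt0r_neq0; lra.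
  have q0 : 0 < e / (m + 1) by apply: divr_gt0 => //; lra.
  have [a [b [g h1 h2]]] := h _ q0; have [a' [b' [g' h1' h2']]] := h' _ q0.
  exists (c *: a + a'), (c *: b + b'); split; first exact: GL.
    rewrite opprD addrACA -scalerBr; apply: le_lt_trans (nmD _ _) _; rewrite nmZ -/m.
    by have := mulfVK m1 e; set q := e / _ in h1 h2 h1' h2' * => <-; nra.
  rewrite opprD addrACA -scalerBr; apply: le_lt_trans (nmD _ _) _; rewrite nmZ -/m.
  by have := mulfVK m1 e; set q := e / _ in h1 h2 h1' h2' * => <-; nra.
have clu u y y' : cl u y -> cl u y' -> y = y'.
  move=> h h'; apply/eqP; rewrite eq_sym -subr_eq0; apply/eqP/nm_eq0/eqP.
  rewrite eq_le nm_ge0 andbT.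
  by have := clB _ _ (clL (-1) _ _ _ _ h h'); rewrite !scaleN1r addNr nm0 mulr0 addrC.
have Gcl u v : G u v -> cl u v.
  by move=> g e e0; exists u, v; rewrite !subrr !nm0.
have /choice [X HX] : forall u, exists y, cl u y.
  move=> u.
  have /choice [p Hp] : forall n : nat, exists p : E * K, G p.1 p.2 /\ nm (u - p.1) < (1/2) ^+ n.
    move=> n; have /closure_nm /(_ ((1/2) ^+ n)) : closure [set u | exists v, G u v] u by rewrite Gd.
    by rewrite exprn_gt0; last lra; move=> /(_ isT) [a [b g] h]; exists (a, b).
  have sm := @geom_small R (1/2) 1 ltac:(apply/andP; split; lra).
  have pd m n : nm ((p m).2 - (p n).2) <= C * (nm (u - (p m).1) + nm (u - (p n).1)).
    have := GB _ _ (GL (-1) _ _ _ _ (Hp n).1 (Hp m).1); rewrite !scaleN1r ![- _ + _]addrC => h.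
    apply: le_trans h _; apply: ler_wpM2l => //.
    by rewrite [nm (u - (p m).1)]nmBC -(subrKA u) ; exact: nmD.
  have [y hy] : exists y : K, (fun n => (p n).2) @ \oo --> y.
    apply: cauchy_nm => e e0.
    have q0 : 0 < e / (2 * C + 1) by apply: divr_gt0 => //; lra.
    have [N HN] := sm _ q0; exists N => m n Nm Nn; apply: le_lt_trans (pd _ _) _.
    have := HN m Nm; have := HN n Nn; rewrite !mulr1 => h1 h2.
    have := (Hp m).2; have := (Hp n).2.
    have := mulfVK (lt0r_neq0 (ltac:(lra) : 0 < 2 * C + 1)) e; set q := e / _ in q0 h1 h2 * => <-.
    nra.
  exists y => e e0.
  have [N HN] := sm _ e0; have [M HM] := (cvg_nm0 _ _).1 hy e e0.
  exists (p (maxn M N)).1, (p (maxn M N)).2; split.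
  - exact: (Hp _).1.
  - by apply: lt_trans (Hp _).2 _; have := HN _ (leq_maxr M N); rewrite mulr1.
  - by rewrite nmBC; apply: HM; exact: leq_maxl.
have XB : opb C X by move=> u; exact: clB.
exists X; split=> //.
  apply: (mkbop _ XB) => c u v; apply: (clu (c *: u + v)) => //; exact: clL.
by move=> u v g; apply: (clu u) => //; exact: Gcl.
Qed.

End Spans.

(** * C*-algebras of operators *)

Section Cstar.
Variable R : realType.
Implicit Types H K E : hilbert R.

Lemma csaD H (A : set (H -> H)) x y : cstar_algebra A -> A x -> A y -> A (x + y).
Proof. by move=> cA Ax Ay; apply: (csa_span cA); apply: lspanD; exact: lspan_sub. Qed.

Lemma csaZ H (A : set (H -> H)) c x : cstar_algebra A -> A x -> A (c *: x).
Proof. by move=> cA Ax; apply: (csa_span cA); apply: lspanZ; exact: lspan_sub. Qed.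

Lemma csa0 H (A : set (H -> H)) : cstar_algebra A -> A 0.
Proof. by move=> cA; apply: (csa_span cA); exact: lspan0. Qed.

Lemma csaN H (A : set (H -> H)) x : cstar_algebra A -> A x -> A (- x).
Proof. by move=> cA Ax; rewrite -scaleN1r; exact: csaZ. Qed.

Lemma csaB H (A : set (H -> H)) x y : cstar_algebra A -> A x -> A y -> A (x - y).
Proof. by move=> cA Ax Ay; apply: csaD => //; exact: csaN. Qed.

Lemma op_closureP H K (A : set (H -> K)) T :
  op_closure A T <-> bop T /\ forall e, 0 < e -> exists2 S, A S & opb e (T - S).
Proof.
have E (e : R) (x : K) (y : H) : (`|x| <= e%:C * `|y|) = (nm x <= e * nm y).
  by rewrite !normE -rmorphM /= lecR.
split=> -[bT h]; split=> // e.
  move=> e0; have [|S AS hS] := h e%:C; first by rewrite ltcR.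
  by exists S => // x; have := hS x; rewrite E fctE.
move=> /posCP[r r0 ->]; have [S AS hS] := h r r0.
by exists S => // x; have := hS x; rewrite E fctE.
Qed.

Lemma csa_lim H (A : set (H -> H)) T : cstar_algebra A -> bop T ->
  (forall e, 0 < e -> exists2 S, A S & opb e (T - S)) -> A T.
Proof. by move=> cA bT h; apply: (csa_closed cA); apply/op_closureP. Qed.

Lemma opb_comp_sub H (x y : H -> H) M N d : 0 <= M -> 0 <= d -> bop x -> opb M x -> opb N y ->
  opb d (x - y) -> opb (M * d + d * N) ((x \o x) - (y \o y)).
Proof.
move=> M0 d0 bx hx hy h.
have -> : (x \o x) - (y \o y) = (x \o (x - y)) + ((x - y) \o y).
  by apply/funext => v; rewrite !fctE /= (linopB (bop_lin bx)) subrKA.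
by apply: opbD; apply: opb_comp.
Qed.

Lemma sa_lim H (T : H -> H) : bop T ->
  (forall e : R, 0 < e -> exists S : H -> H, [/\ bop S, adj S = S & opb e (T - S)]) -> adj T = T.
Proof.
move=> bT h; apply: opb_eq => e e0.
have [S [bS aS hS]] := h (e / 2) ltac:(lra).
have h2 : opb (e / 2) (adj T - S).
  by rewrite -{1}aS -adjB //; apply: opb_adj => //; [exact: bopB|lra].
have := opbD h2 (opbBC hS); rewrite subrKA; apply: opb_le; lra.
Qed.

Lemma opb_lim H K (T : H -> K) M :
  (forall e, 0 < e -> exists2 S, opb M S & opb e (T - S)) -> opb M T.
Proof.
move=> h x; apply/ler_addgt0Pr => e e0.
have x1 : 0 < nm x + 1 by have := nm_ge0 x; lra.
have [S hS /(_ x)] := h _ (divr_gt0 e0 x1).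
have := mulfVK (lt0r_neq0 x1) e; set q := e / _ => qE; rewrite fctE => h1.
have q0 : 0 < q by rewrite divr_gt0.
have := nmD (T x - S x) (S x); rewrite subrK; have := hS x.
nra.
Qed.

(** [b] is 1 - sqrt(1 - a^* a), described without a unit in [A] by (1 - b)^2 = 1 - a^* a. It is the
    fixed point of b |-> (a^* a + b^2)/2, which maps the ball of radius q to itself and contracts
    there by the factor q. *)
Lemma csa_sqrt H (A : set (H -> H)) a q : cstar_algebra A -> A a -> 0 <= q < 1 -> opb q a ->
  exists b, [/\ A b, adj b = b & (adj a \o a) + (b \o b) = b + b].
Proof.
move=> cA Aa q01 ha; have /andP[q0 q1] := q01; have bA := csa_bop cA.
pose c := adj a \o a.
have ba := bA _ Aa; have bc : bop c by apply: bop_comp => //; exact: bop_adj.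
have Ac : A c by apply: csa_mul => //; exact: csa_adj.
have ac : adj c = c by rewrite adj_comp ?adjK //; exact: bop_adj.
have hc : opb (q * q) c by apply: opb_comp => //; exact: opb_adj.
pose F b := (1/2)%:C *: (c + (b \o b)).
have [] := @op_fixpoint R H [set b | [/\ A b, adj b = b & opb q b]] F q q01.
- by move=> b [Ab _ _]; exact: bA.
- by split; [exact: csa0|exact: adj0|exact: opb0].
- move=> b [Ab sb hb]; have bb := bA _ Ab; have bbb := bop_comp bb bb; split.
  + by apply: csaZ => //; apply: csaD => //; exact: csa_mul.
  + by rewrite /F (adjZr _ (bopD bc bbb)) (adjD bc bbb) (adj_comp bb bb) ac sb.
  + apply: opb_le (opbZ _ (opbD hc (opb_comp q0 hb hb))).
    by rewrite ger0_norm; nra.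
- move=> x y d [Ax _ hx] [Ay _ hy] d0 h.
  have -> : F x - F y = (1/2)%:C *: ((x \o x) - (y \o y)).
    by rewrite /F -scalerBr opprD addrACA subrr add0r.
  apply: opb_le (opbZ _ (opb_comp_sub q0 d0 (bA _ Ax) hx hy h)).
  by rewrite ger0_norm; lra.
- move=> T bT hT; split.
  + by apply: (csa_lim cA) => // e e0; have [S [AS _ _] h] := hT e e0; exists S.
  + by apply: sa_lim => // e e0; have [S [AS sS _] h] := hT e e0; exists S; split=> //; exact: bA.
  + by apply: opb_lim => e e0; have [S [AS sS hS] h] := hT e e0; exists S.
move=> b [Ab sb hb] Fb; exists b; split=> //.
rewrite -[in RHS]Fb /F -scalerDl -rmorphD /= (_ : 1/2 + 1/2 = 1) ?scale1r //; lra.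
Qed.

Lemma defect H K (a : H -> K) (b : H -> H) v : bop a -> bop b -> adj b = b ->
  (adj a \o a) + (b \o b) = b + b -> nm (a v) ^+ 2 + nm (v - b v) ^+ 2 = nm v ^+ 2.
Proof.
move=> ba bb sb h; have := congr1 (fun T : H -> H => rdot (T v) v) h.
rewrite !fctE /= !rdotDl adjEr //.
have -> : rdot (b (b v)) v = rdot (b v) (b v) by rewrite adjE // sb.
by rewrite -!nm2E nm2B [rdot v _]rdotC; lra.
Qed.

Lemma star_homZ H K (A : set (H -> H)) (f : (H -> H) -> K -> K) c x :
  cstar_algebra A -> star_hom A f -> A x -> f (c *: x) = c *: f x.
Proof.
move=> cA hf Ax; have A0 := csa0 cA.
have f0 : f 0 = 0.
  by have := shom_linear hf (-1) A0 A0; rewrite scaler0 addr0 scaleN1r addNr.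
by have := shom_linear hf c Ax A0; rewrite f0 !addr0.
Qed.

Lemma star_hom0 H K (A : set (H -> H)) (f : (H -> H) -> K -> K) :
  cstar_algebra A -> star_hom A f -> f 0 = 0.
Proof.
move=> cA hf; have A0 := csa0 cA.
by have := shom_linear hf (-1) A0 A0; rewrite scaler0 addr0 scaleN1r addNr.
Qed.

Lemma star_homD H K (A : set (H -> H)) (f : (H -> H) -> K -> K) x y :
  cstar_algebra A -> star_hom A f -> A x -> A y -> f (x + y) = f x + f y.
Proof. by move=> cA hf Ax Ay; have := shom_linear hf 1 Ax Ay; rewrite !scale1r. Qed.

Lemma star_homB H K (A : set (H -> H)) (f : (H -> H) -> K -> K) x y :
  cstar_algebra A -> star_hom A f -> A x -> A y -> f (x - y) = f x - f y.
Proof.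
move=> cA hf Ax Ay; rewrite (star_homD cA hf) //; last exact: csaN.
by rewrite -scaleN1r (star_homZ _ cA hf) // scaleN1r.
Qed.

(* [adj a \o a = 1 - (1 - b)^2] is preserved by [f], so that                    *)
(* [adj (f a) \o f a <= 1].                                                     *)
Lemma star_hom_contractive H K (A : set (H -> H)) (f : (H -> H) -> K -> K) a M :
  cstar_algebra A -> star_hom A f -> A a -> 0 <= M -> opb M a -> opb M (f a).
Proof.
move=> cA hf Aa M0 ha v; apply/ler_addgt0Pr => e e0.
have v1 : 0 < nm v + 1 by have := nm_ge0 v; lra.
have q0 := divr_gt0 e0 v1; have := mulfVK (lt0r_neq0 v1) e; set q := e / _ in q0 * => qE.
have Mq : 0 < M + q by lra.
(* [csa_sqrt] needs norm strictly below 1, so one divides by slightly more than M; the slack q costs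
   at most e at the vector v. *)
pose a' := ((M + q)^-1)%:C *: a.
have Aa' : A a' by exact: csaZ.
have fb x : A x -> bop (f x) by exact: shom_bop hf _.
have ha' : opb (M / (M + q)) a'.
  by have := opbZ (M + q)^-1 ha; rewrite gtr0_norm ?invr_gt0 // mulrC.
have [|b [Ab sb hb]] := csa_sqrt cA Aa' _ ha'.
  by rewrite divr_ge0 ?ltr_pdivrMr ?mul1r //; [rewrite ltrDl | exact: ltW].
have baa : A (adj a' \o a') by apply: csa_mul => //; exact: csa_adj.
have bbb : A (b \o b) by apply: csa_mul.
have := congr1 f hb; rewrite (star_homD cA hf baa bbb) (star_homD cA hf Ab Ab).
rewrite (shom_mul hf Ab Ab) (shom_mul hf (csa_adj cA Aa') Aa') (shom_adj hf Aa').
have sfb : adj (f b) = f b by rewrite -(shom_adj hf) // sb.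
move=> /(defect v (fb _ Aa') (fb _ Ab) sfb) h.
have : nm (f a' v) <= nm v.
  rewrite -(@ler_pXn2r _ 2%N) ?nnegrE ?nm_ge0 //.
  by have := sqr_ge0 (nm (v - f b v)); lra.
rewrite /a' (star_homZ _ cA hf) // nmZr gtr0_norm ?invr_gt0 //.
by rewrite mulrC ler_pdivrMr // -qE; have := nm_ge0 v; nra.
Qed.

(* With [V y = \sum_i S i (y (xi i))], the commutation gives                    *)
(* [|V x|^2 = <V 1, V (x^* x)>], so [|V 1|^2 - |V x|^2 = |V (1 - b)|^2].         *)
Lemma column_bound H E (M : set (H -> H)) (x : H -> H) C (n : nat)
    (S : 'I_n -> H -> E) (xi : 'I_n -> H) :
  cstar_algebra M -> M x -> 0 <= C -> opb C x -> (forall i, bop (S i)) ->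
  (forall i j y, M y -> adj (S j) \o S i \o y = y \o (adj (S j) \o S i)) ->
  nm (\sum_i S i (x (xi i))) <= C * nm (\sum_i S i (xi i)).
Proof.
move=> cM Mx C0 hx bS hc.
pose V (y : H -> H) := \sum_i S i (y (xi i)).
suff main y q : M y -> 0 <= q < 1 -> opb q y -> nm (V y) <= nm (V id).
  rewrite -/(V x) -/(V id); apply/ler_addgt0Pr => e e0.
  have v1 : 0 < nm (V id) + 1 by have := nm_ge0 (V id); lra.
  have q0 := divr_gt0 e0 v1; have := mulfVK (lt0r_neq0 v1) e; set q := e / _ in q0 * => qE.
  have Cq : 0 < C + q by lra.
  have hx' : opb (C / (C + q)) (((C + q)^-1)%:C *: x).
    by have := opbZ (C + q)^-1 hx; rewrite gtr0_norm ?invr_gt0 // mulrC.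
  have := main _ _ (csaZ _ cM Mx) _ hx'.
  rewrite divr_ge0 ?ltr_pdivrMr ?mul1r ?ltrDl ?q0 //; last exact: ltW.
  move=> /(_ isT).
  have -> : V (((C + q)^-1)%:C *: x) = ((C + q)^-1)%:C *: V x.
    by rewrite /V scaler_sumr; apply: eq_bigr => i _; rewrite fctE (linopZ (bop_lin (bS i))).
  rewrite nmZr gtr0_norm ?invr_gt0 // mulrC ler_pdivrMr // -qE.
  by have := nm_ge0 (V id); nra.
move=> My q01 hy; have [b [Mb sb hb]] := csa_sqrt cM My q01 hy.
have bM := csa_bop cM.
have key z : M z -> nm (V z) ^+ 2 = rdot (V id) (V (adj z \o z)).
  move=> Mz; have bz := bM _ Mz; rewrite nm2E /V rdot_suml [in RHS]rdot_suml; apply: eq_bigr => i _.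
  rewrite !rdot_sumr; apply: eq_bigr => j _.
  have := congr1 (fun T => T (xi i)) (hc i j z Mz) => /= e.
  by rewrite -(adjEr _ _ (bS j)) e (adjE _ _ bz) (adjEr _ _ (bS j)).
have VD z w : V (z + w) = V z + V w.
  by rewrite /V -big_split /=; apply: eq_bigr => i _; rewrite fctE (linopD (bop_lin (bS i))).
have h1 := key _ My; have h2 := key _ Mb; rewrite sb in h2.
have h3 := congr1 (fun T => rdot (V id) (V T)) hb; rewrite /= !VD !rdotDr -h1 -h2 in h3.
rewrite -(@ler_pXn2r _ 2%N) ?nnegrE ?nm_ge0 //.
have := sqr_ge0 (nm (V id - V b)); rewrite nm2B; lra.
Qed.

(** On finite sums [X] has to send \sum_i S_i xi_i to \sum_i S_i (x xi_i); [column_bound] makes this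
    well defined and bounded, and it extends by density. Both the operators x (x) y on tensor
    products and the extension of pi to N1 arise in this way. *)
Lemma column_extension H E (M : set (H -> H)) (SS : set (H -> E)) (x : H -> H) :
  cstar_algebra M -> M x -> SS `<=` @bop R H E ->
  total_set [set v | exists S h, SS S /\ v = S h] ->
  (forall S T y, SS S -> SS T -> M y -> adj T \o S \o y = y \o (adj T \o S)) ->
  exists X, [/\ bop X, forall S, SS S -> X \o S = S \o x &
    forall C, 0 <= C -> opb C x -> opb C X].
Proof.
move=> cM Mx bSS tS hc.
pose G (u v : E) := exists (n : nat) (S : 'I_n -> H -> E) (xi : 'I_n -> H),
  [/\ forall i, SS (S i), u = \sum_i S i (xi i) & v = \sum_i S i (x (xi i))].
have bx := csa_bop cM Mx; have lx := bop_lin bx.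
have GB C u v : 0 <= C -> opb C x -> G u v -> nm v <= C * nm u.
  move=> C0 hx [n [S [xi [hS -> ->]]]]; apply: (@column_bound _ _ M x C n S xi cM Mx C0 hx).
    by move=> i; exact: bSS.
  by move=> i j y; apply: hc.
have GL c u v u' v' : G u v -> G u' v' -> G (c *: u + u') (c *: v + v').
  move=> [n [S [xi [hS -> ->]]]] [m [S' [xi' [hS' -> ->]]]].
  pose Z i := match fintype.split i with inl j => S j | inr j => S' j end.
  pose z i := match fintype.split i with inl j => c *: xi j | inr j => xi' j end.
  have Zl j : Z (lshift m j) = S j.
    by rewrite /Z; case: split_ordP => k => [/lshift_inj <-|/eqP] //; rewrite eq_lrshift.
  have Zr j : Z (rshift n j) = S' j.
    by rewrite /Z; case: split_ordP => k => [/eqP|/rshift_inj <-] //; rewrite eq_rlshift.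
  have zl j : z (lshift m j) = c *: xi j.
    by rewrite /z; case: split_ordP => k => [/lshift_inj <-|/eqP] //; rewrite eq_lrshift.
  have zr j : z (rshift n j) = xi' j.
    by rewrite /z; case: split_ordP => k => [/eqP|/rshift_inj <-] //; rewrite eq_rlshift.
  exists (n + m)%N, Z, z; split; first by move=> i; rewrite /Z; case: fintype.split.
    rewrite big_split_ord /= scaler_sumr; congr (_ + _); apply: eq_bigr => i _.
      by rewrite Zl zl (linopZ (bop_lin (bSS _ (hS i)))).
    by rewrite Zr zr.
  rewrite big_split_ord /= scaler_sumr; congr (_ + _); apply: eq_bigr => i _.
    by rewrite Zl zl (linopZ lx) (linopZ (bop_lin (bSS _ (hS i)))).
  by rewrite Zr zr.
have G1 S h : SS S -> G (S h) (S (x h)).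
  by move=> SSS; exists 1%N, (fun=> S), (fun=> h); rewrite !big_ord1.
have [M0 hM0 hx0] := bop_bound bx.
have Gd : closure [set u | exists v, G u v] = setT.
  apply/seteqP; split=> // t _; apply/closure_nm => e e0.
  have [y Sy ty] := totalP tS t e0; exists y => //.
  move: y Sy {ty}; apply: lspan_ind => [|c s v [S [h [SSS ->]]] [w g]].
    by exists 0, 0%N, (fun=> 0), (fun=> 0); split; rewrite ?big_ord0 //; case.
  by exists (c *: S (x h) + w); apply: GL => //; exact: G1.
have [X [bX _ hX]] := bounded_extension (ltW hM0) GL (fun u v => GB _ u v (ltW hM0) hx0) Gd.
have XS S h : SS S -> X (S h) = S (x h) by move=> SSS; apply: hX; exact: G1.
exists X; split=> //; first by move=> S SSS; apply/funext => h /=; exact: XS.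
(* [X] was built with one particular bound of x. Any other bound C gives a second extension, which
   agrees with [X] on the total set. *)
move=> C C0 hx.
have [X' [bX' hX'C hX']] := bounded_extension C0 GL (fun u v => GB _ u v C0 hx) Gd.
suff -> : X = X' by [].
apply: (total_eq tS) => // _ [S [h [SSS ->]]]; rewrite XS //; apply/esym/hX'; exact: G1.
Qed.

End Cstar.

(** * The transform 2t/(1+t^2) and its inverse *)

Section Resolvent.
Variable R : realType.
Implicit Types H K E : hilbert R.

(** Pairing (1 + h^2) u = al + h be with u gives |u|^2 + |h u|^2 = <al, u> + <be, h u>, with real
    parts understood; then complete squares. The bound is independent of the norm of [h]. *)
Lemma resolvent_bound H (h : H -> H) u al be : bop h -> adj h = h ->
  u + h (h u) = al + h be -> nm u ^+ 2 <= nm al ^+ 2 + nm be ^+ 2.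
Proof.
move=> bh sh /(congr1 (fun z => rdot z u)); rewrite !rdotDl.
have E x y : rdot (h x) y = rdot x (h y) by rewrite adjE // sh.
rewrite (E (h u)) (E be) -!nm2E => e.
have := sqr_ge0 (nm (al - u)); have := sqr_ge0 (nm (be - h u)); rewrite !nm2B.
have := sqr_ge0 (nm (h u)); lra.
Qed.

Lemma resolvent_step (V : lmodType R[i]) (t : R[i]) (p q P Q k : V) :
  p - t *: (p + P - k) - (q - t *: (q + Q - k)) =
  (p - q - t *: (p - q)) - t *: (P - Q).
Proof.
have S (a b c d : V) : a - b - (c - d) = (a - c) - (b - d).
  by rewrite !opprD !opprK addrACA.
rewrite S -scalerBr (S (p + P)) subrr subr0 opprD addrACA.
by rewrite scalerDr opprD addrA.
Qed.

(** [b] is a (1 + a^2)^-1, the fixed point of X |-> X - t ((1 + a^2) X - a) with t = 1/(1 + N^2) and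
    N a bound of [a]. Since 0 <= 1 - t (1 + a^2) <= 1 - t, this is a contraction. The bound
    [opb 1 b] is [resolvent_bound] with al = 0. *)
Lemma csa_resolvent H (A : set (H -> H)) a : cstar_algebra A -> A a -> adj a = a ->
  exists b, [/\ A b, adj b = b, opb 1 b & b + (a \o (a \o b)) = a].
Proof.
move=> cA Aa sa; have bA := csa_bop cA; have ba := bA _ Aa; have la := bop_lin ba.
have [N N0 hN] := bop_bound ba.
pose t := (1 + N ^+ 2)^-1.
have N1 : 0 < 1 + N ^+ 2 by have := sqr_ge0 N; lra.
have t0 : 0 < t by rewrite invr_gt0.
have tN : t * (1 + N ^+ 2) = 1 by rewrite mulVf // gt_eqF.
have t1 : t < 1 by have := exprn_gt0 2 N0; nra.
pose F (X : H -> H) := X - t%:C *: (X + (a \o (a \o X)) - a).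
have E x y : rdot (a x) y = rdot x (a y) by rewrite adjE // sa.
have [] := @op_fixpoint R H A F (1 - t) _ bA (csa0 cA).
- by apply/andP; split; lra.
- move=> X AX; apply: csaB => //; apply: csaZ => //; apply: csaB => //; apply: csaD => //.
  by apply: csa_mul => //; exact: csa_mul.
- move=> X Y d AX AY d0 hd v; set u := (X - Y) v.
  have -> : (F X - F Y) v = (1 - t)%:C *: u - t%:C *: a (a u).
    rewrite /u /F !fctE /= !(linopB la) rmorphB rmorph1 scalerBl scale1r.
    exact: resolvent_step.
  apply: le_trans (_ : (1 - t) * nm u <= _); last first.
    by rewrite -mulrA ler_wpM2l //; [lra | exact: hd].
  have t1' : 0 <= 1 - t by lra.
  rewrite -(@ler_pXn2r _ 2%N) ?nnegrE ?mulr_ge0 ?nm_ge0 // nm2B rdotZl rdotZr !nmZr.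
  rewrite -(E u (a u)) -nm2E.
  rewrite !exprMn !real_normK ?num_real //.
  have : nm (a (a u)) ^+ 2 <= N ^+ 2 * nm (a u) ^+ 2.
    by rewrite -exprMn ler_pXn2r ?nnegrE ?mulr_ge0 ?nm_ge0 // ltW.
  have := sqr_ge0 (nm (a u)); set P := nm (a u) ^+ 2; set Q := nm (a (a u)) ^+ 2.
  have : t * N ^+ 2 = 1 - t by lra.
  move=> tN2 P0 QP; have : t * Q <= (1 - t) * P by rewrite -tN2 -mulrA ler_pM2l.
  move=> tQ; have : t * (t * Q) <= t * ((1 - t) * P) by rewrite ler_pM2l.
  have : 0 <= t * ((1 - t) * P) by apply: mulr_ge0; [exact: ltW|exact: mulr_ge0].
  rewrite expr2; lra.
- by move=> T bT hT; exact: (csa_lim cA).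
move=> b Ab Fb.
have bb := bA _ Ab; have lb := bop_lin bb.
have eb : b + (a \o (a \o b)) = a.
  apply/eqP; rewrite -subr_eq0; apply/eqP.
  move/eqP: Fb; rewrite /F -subr_eq0 addrAC subrr add0r oppr_eq0 => /eqP h.
  have := congr1 (fun T => (t^-1)%:C *: T) h.
  by rewrite scaler0 scalerA -rmorphM /= mulVf ?gt_eqF // scale1r.
(* Injectivity of 1 + a^2. From it follow commutation of b with a, and then self-adjointness of
   b. *)
have J u : u + a (a u) = 0 -> u = 0.
  move=> h; have := @resolvent_bound _ a u 0 0 ba sa; rewrite h (linop0 la) addr0 nm0 => /(_ erefl) h1.
  by apply: nm_eq0; apply/eqP; rewrite -sqrf_eq0 eq_le sqr_ge0 andbT; lra.
have Jinj u v : u + a (a u) = v + a (a v) -> u = v.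
  move=> h; apply/subr0_eq/J; rewrite !(linopB la) addrACA h -opprD subrr.
  done.
have ev v : b v + a (a (b v)) = a v by have := congr1 (fun T => T v) eb.
have ab v : a (b v) = b (a v).
  by apply: Jinj; rewrite -(linopD la) ev ev.
have bs := bop_adj bb; have lbs := bop_lin bs.
have asb v : a (adj b v) = adj b (a v).
  have := adj_comp ba bb; have := adj_comp bb ba.
  have -> : a \o b = b \o a by apply/funext => w /=; rewrite ab.
  by move=> -> h; have := congr1 (fun T => T v) h; rewrite sa.
exists b; split=> //.
  apply/funext => v; apply: Jinj; rewrite ev asb asb -(linopD lbs).
  have bab := bop_comp ba bb; have baab := bop_comp ba bab.
  have := congr1 (fun T => adj T v) eb.
  by rewrite (adjD bb baab) (adj_comp ba bab) (adj_comp ba bb) sa !fctE /= (linopD lbs).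
move=> v; rewrite mul1r -(@ler_pXn2r _ 2%N) ?nnegrE ?nm_ge0 //.
have := @resolvent_bound _ a (b v) 0 v ba sa; rewrite ev add0r => /(_ erefl).
by rewrite nm0 expr0n add0r.
Qed.

(** Solves x = 2 y (1 + y^2)^-1 for y, which writes x in the form that [kaplansky] approximates. The
    map y |-> (x + x y^2)/2 contracts by q on the self-adjoint contractions commuting with x;
    carrying the commutation along keeps the iterates self-adjoint. *)
Lemma csa_inverse_transform H (M : set (H -> H)) x q : cstar_algebra M -> M x -> adj x = x ->
  0 <= q < 1 -> opb q x ->
  exists y, [/\ M y, adj y = y & x + (y \o (y \o x)) = y + y].
Proof.
move=> cM Mx sx q01 hx; have /andP[q0 q1] := q01; have bM := csa_bop cM.
have bx := bM _ Mx; have lx := bop_lin bx.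
pose F (y : H -> H) := (1/2)%:C *: (x + (x \o (y \o y))).
have [] := @op_fixpoint R H [set y | [/\ M y, adj y = y, y \o x = x \o y & opb 1 y]] F q q01.
- by move=> y [My _ _ _]; exact: bM.
- split; [exact: csa0|exact: adj0| |exact: opb0].
  by apply/funext => v /=; rewrite (linop0 lx).
- move=> y [My sy xy hy]; have by_ := bM _ My; have bbb := bop_comp by_ by_.
  have bxy := bop_comp bx bbb.
  have c v : y (x v) = x (y v) by have := congr1 (fun T => T v) xy.
  split.
  + by apply: csaZ => //; apply: csaD => //; apply: csa_mul => //; exact: csa_mul.
  + rewrite /F (adjZr _ (bopD bx bxy)) (adjD bx bxy) (adj_comp bx bbb) (adj_comp by_ by_) sx sy.
    by congr (_ *: (_ + _)); apply/funext => v /=; rewrite !c.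
  + by apply/funext => v; rewrite /F /= !fctE /= (linopZ lx) (linopD lx) !c.
  + apply: opb_le (opbZ _ (opbD hx (opb_comp q0 hx (opb_comp ler01 hy hy)))).
    by rewrite ger0_norm; lra.
- move=> y z d [My _ _ hy] [Mz _ _ hz] d0 h.
  have -> : F y - F z = (1/2)%:C *: (x \o ((y \o y) - (z \o z))).
    rewrite /F -scalerBr opprD addrACA subrr add0r; congr (_ *: _).
    by apply/funext => v /=; rewrite !fctE /= (linopB lx).
  have := opb_comp q0 hx (opb_comp_sub ler01 d0 (bM _ My) hy hz h).
  by move/(opbZ (1/2)); apply: opb_le; rewrite ger0_norm; lra.
- move=> T bT hT; split.
  + by apply: (csa_lim cM) => // e e0; have [S [MS _ _ _] h] := hT e e0; exists S.
  + by apply: sa_lim => // e e0; have [S [MS sS _ _] h] := hT e e0; exists S; split=> //; exact: bM.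
  + have [N N0 hN] := bop_bound bx.
    apply: opb_eq => e e0; have f0 : 0 < e / (2 * N) by rewrite divr_gt0 // mulr_gt0.
    have [S [MS _ Sx _] h] := hT _ f0.
    have -> : (T \o x) - (x \o T) = ((T - S) \o x) - (x \o (T - S)).
      apply/funext => v /=; rewrite !fctE /= (linopB lx).
      have -> : x (S v) = S (x v) by have := congr1 (fun T => T v) Sx.
      by rewrite opprB addrA subrK.
    apply: opb_le (opbB (opb_comp (ltW f0) h hN) (opb_comp (ltW N0) hN h)).
    have := mulfVK (lt0r_neq0 (mulr_gt0 (ltr0Sn R 1) N0)) e.
    by set f := e / _ => <-; lra.
  + by apply: opb_lim => e e0; have [S [MS sS _ hS] h] := hT e e0; exists S.
move=> y [My sy xy hy] Fy; exists y; split=> //.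
rewrite -[in RHS]Fy /F -scalerDl -rmorphD /= (_ : 1/2 + 1/2 = 1) ?scale1r; last lra.
have c v : y (x v) = x (y v) by have := congr1 (fun T => T v) xy.
by congr (_ + _); apply/funext => v /=; rewrite !c.
Qed.

End Resolvent.

(** * Density theorems for families of representations *)

Section Density.
Variables (R : realType) (H0 : hilbert R) (A : set (H0 -> H0)).
Hypothesis cA : cstar_algebra A.

Record star_rep (H : hilbert R) (th : (H0 -> H0) -> H -> H) : Prop := {
  srep_hom : star_hom A th;
  srep_nondegenerate : total_set [set v | exists a h, A a /\ v = th a h] }.

Definition intertwiner (H K : hilbert R) (th : (H0 -> H0) -> H -> H)
    (ka : (H0 -> H0) -> K -> K) : set (H -> K) :=
  [set S | bop S /\ forall a, A a -> S \o th a = ka a \o S].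

Section Family.
Variables (J : finType) (H : J -> hilbert R) (th : forall i, (H0 -> H0) -> H i -> H i).
Hypothesis rep : forall i, star_rep (@th i).

Let bth i a : A a -> bop (@th i a). Proof. exact: shom_bop (srep_hom (rep i)) _. Qed.
Let lth i a : A a -> linear (@th i a). Proof. by move=> Aa; apply/bop_lin/bth. Qed.

(* [eta] is the component of [t] orthogonal to the orbit of [ze] *)
Definition orbit_defect (ze t eta : forall i, H i) : Prop :=
  (forall a, A a -> \sum_i rdot (th a (ze i)) (eta i) = 0) /\
  (forall e : R, 0 < e -> exists2 a, A a & forall i, nm (t i - eta i - th a (ze i)) < e).

Lemma orbit_defect_exists ze t : exists eta, orbit_defect ze t eta.
Proof.
have [] := @hilbert_projection R J H [set x | exists2 a, A a & x = (fun i => th a (ze i))] t.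
- exists 0; first exact: csa0.
  by apply: functional_extensionality_dep => i; rewrite (star_hom0 cA (srep_hom (rep i))).
- move=> r x y [a Aa ->] [b Ab ->]; exists (a + r%:C *: b).
    by apply: csaD => //; exact: csaZ.
  apply: functional_extensionality_dep => i.
  rewrite (star_homD cA (srep_hom (rep i)) Aa (csaZ _ cA Ab)).
  by rewrite (star_homZ _ cA (srep_hom (rep i)) Ab).
move=> eta [h1 h2]; exists eta; split.
  by move=> a Aa; rewrite -[RHS](h2 (fun i => th a (ze i))); [apply: eq_bigr => i _; rewrite rdotC|exists a].
move=> e e0; have [_ [a Aa ->] h] := h1 e e0; exists a => // i.
by rewrite addrAC; exact: h.
Qed.

Lemma orbit_defectP ze c t eta t' eta' : orbit_defect ze t eta -> orbit_defect ze t' eta' ->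
  orbit_defect ze (fun i => c *: t i + t' i) (fun i => c *: eta i + eta' i).
Proof.
move=> [h1 h2] [h1' h2']; split.
  move=> a Aa.
  have E : \sum_i rdot (th a (ze i)) (c *: eta i) = 0.
    under eq_bigr do rewrite [c *: _]scaleE rdotDr !rdotZr.
    rewrite big_split /= -!mulr_sumr h1 // mulr0 add0r.
    have hi := h1 _ (csaZ 'i%C cA Aa).
    have -> : \sum_i rdot (th a (ze i)) ('i%C *: eta i) =
        - \sum_i rdot (th ('i%C *: a) (ze i)) (eta i).
      rewrite -sumrN; apply: eq_bigr => i _.
      by rewrite (star_homZ _ cA (srep_hom (rep i)) Aa) rdotii opprK.
    by rewrite hi oppr0 mulr0.
  by under eq_bigr do rewrite rdotDr; rewrite big_split /= E h1' // addr0.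
move=> e e0; pose m := complex.Re `|c|.
have m0 : 0 <= m by rewrite /m normc_def /= sqrtr_ge0.
have m1 : 0 < m + 1 by lra.
have q0 : 0 < e / (m + 1) by apply: divr_gt0.
have [a Aa ha] := h2 _ q0; have [b Ab hb] := h2' _ q0.
exists (c *: a + b); first by apply: csaD => //; exact: csaZ.
move=> i; rewrite (shom_linear (srep_hom (rep i)) _ Aa Ab).
have -> : c *: t i + t' i - (c *: eta i + eta' i) - (c *: th a + th b) (ze i) =
    c *: (t i - eta i - th a (ze i)) + (t' i - eta' i - th b (ze i)).
  rewrite !fctE !scalerBr [- (c *: eta i + _)]opprD [X in X - _ = _]addrACA opprD.
  by rewrite [LHS]addrACA.
apply: le_lt_trans (nmD _ _) _; rewrite nmZ -/m.
have := ha i; have := hb i; have := mulfVK (lt0r_neq0 m1) e; set q := e / _ in q0 * => <-.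
by have := nm_ge0 (t i - eta i - th a (ze i)); nra.
Qed.

Lemma orbit_defect_sum ze (L : Type) (r : seq L) (t eta : L -> forall i, H i) :
  (forall l, orbit_defect ze (t l) (eta l)) ->
  orbit_defect ze (fun i => \sum_(l <- r) t l i) (fun i => \sum_(l <- r) eta l i).
Proof.
move=> h; elim: r => [|l r IH].
  split; first by move=> a Aa; rewrite big1 // => i _; rewrite big_nil rdot0r.
  move=> e e0; exists 0; first exact: csa0.
  by move=> i; rewrite !big_nil (star_hom0 cA (srep_hom (rep i))) !subrr nm0.
have := orbit_defectP 1 (h l) IH.
by congr orbit_defect; apply: functional_extensionality_dep => i; rewrite big_cons scale1r.
Qed.

(** [t - eta] is a limit of orbit vectors, to which [eta] is orthogonal. Uniqueness of the defect
    and contractivity of its matrix entries follow from this identity. *)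
Lemma orbit_defect_bound ze t eta : orbit_defect ze t eta ->
  \sum_i nm (eta i) ^+ 2 = \sum_i rdot (t i) (eta i).
Proof.
move=> [h1 h2]; apply/eqP; rewrite -subr_eq0 -sumrB -normr_le0.
apply/ler_addgt0Pr => e e0; rewrite add0r.
set c := \sum_i nm (eta i).
have c0 : 0 <= c by apply: sumr_ge0 => i _; exact: nm_ge0.
have c1 : 0 < c + 1 by lra.
have [a Aa ha] := h2 _ (divr_gt0 e0 c1).
have -> : \sum_i (nm (eta i) ^+ 2 - rdot (t i) (eta i)) =
    - \sum_i rdot (t i - eta i - th a (ze i)) (eta i).
  rewrite -[X in - X]addr0 -[X in - (_ + X)](h1 a Aa) -big_split -sumrN /=; apply: eq_bigr => i _.
  by rewrite !rdotBl nm2E; lra.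
rewrite normrN; apply: le_trans (ler_norm_sum _ _ _) _.
have := mulfVK (lt0r_neq0 c1) e; set q := e / _ => qE.
have q0 : 0 < q by rewrite divr_gt0.
apply: (@le_trans _ _ (q * c)); last by nra.
rewrite /c mulr_sumr; apply: ler_sum => i _; apply: le_trans (rdot_abs _ _) _.
by rewrite ler_wpM2r ?nm_ge0 // ltW.
Qed.

Lemma orbit_defect_uniq ze t eta eta' :
  orbit_defect ze t eta -> orbit_defect ze t eta' -> eta = eta'.
Proof.
move=> h h'; have := orbit_defect_bound (orbit_defectP (-1) h' h).
rewrite [RHS]big1 => [/eqP|i _]; last by rewrite scaleN1r addNr rdot0l.
rewrite psumr_eq0 => [/allP h0|i _]; last exact: sqr_ge0.
apply: functional_extensionality_dep => i; apply/subr0_eq/nm_eq0/eqP.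
by rewrite -sqrf_eq0; have := h0 i (mem_index_enum i); rewrite scaleN1r addrC.
Qed.

(** Since [A] is closed under adjoints, both the closed orbit and its orthogonal complement are
    invariant; hence the defect map commutes with the action. *)
Lemma orbit_defect_act ze t eta a : A a -> orbit_defect ze t eta ->
  orbit_defect ze (fun i => th a (t i)) (fun i => th a (eta i)).
Proof.
move=> Aa [h1 h2]; split.
  move=> b Ab; rewrite -[RHS](h1 (adj a \o b)); last by apply: csa_mul => //; exact: csa_adj.
  apply: eq_bigr => i _.
  rewrite (shom_mul (srep_hom (rep i)) (csa_adj cA Aa) Ab) /= (shom_adj (srep_hom (rep i)) Aa).
  by rewrite adjEr //; exact: bth.
move=> e e0; have [N N0 hN] := bop_bound (csa_bop cA Aa).
have hth i : opb N (th (i := i) a) by exact: (star_hom_contractive cA (srep_hom (rep i)) Aa (ltW N0) hN).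
have [b Ab hb] := h2 _ (divr_gt0 e0 N0).
exists (a \o b); first exact: csa_mul.
move=> i; rewrite (shom_mul (srep_hom (rep i)) Aa Ab) /= -!(linopB (@lth i _ Aa)).
apply: le_lt_trans (hth i _) _.
by have := hb i; rewrite ltr_pdivlMr // mulrC.
Qed.

(** Nondegeneracy stands in for an approximate unit: a ze lies in the orbit, so every a in [A] kills
    the defect of [ze], which is therefore orthogonal to the total set of all adj(a) v. *)
Lemma orbit_defect_self ze : orbit_defect ze ze (fun=> 0).
Proof.
have [eta h] := orbit_defect_exists ze ze.
suff -> : (fun=> 0) = eta by [].
apply: functional_extensionality_dep => i; apply/esym/(total_orth (srep_nondegenerate (rep i))).
move=> _ [a [v [Aa ->]]]; have Aa' := csa_adj cA Aa.
have h0 : orbit_defect ze (fun i => th (adj a) (ze i)) (fun=> 0).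
  split; first by move=> b Ab; rewrite big1 // => k _; rewrite rdot0r.
  by move=> e e0; exists (adj a) => // k; rewrite subr0 subrr nm0.
have := orbit_defect_uniq (orbit_defect_act Aa' h) h0.
move/(congr1 (fun f => f i)) => e.
rewrite (adj_spec (@bth i _ Aa)).2 -(shom_adj (srep_hom (rep i)) Aa) e.
by rewrite linear0r.
Qed.

Variable y : forall i, H i -> H i.
Hypothesis by_ : forall i, bop (@y i).
Hypothesis yS : forall i j S, intertwiner (@th i) (@th j) S -> S \o @y i = @y j \o S.

(** The density half of the bicommutant theorem on a direct sum. The projection onto the complement
    of the orbit of [ze] has matrix entries [u |-> S i u j], which are intertwiners and so commute
    with y. As it annihilates [ze], it annihilates y ze, which thus lies in the closed orbit. *)
Lemma family_density (ze : forall i, H i) (e : R) : 0 < e ->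
  exists2 a, A a & forall i, nm (th a (ze i) - y (ze i)) < e.
Proof.
move=> e0; pose single i (u : H i) : forall j, H j := dfwith (fun j => 0) i u.
pose S i (u : H i) := projT1 (cid (orbit_defect_exists ze (single i u))).
have SP i u : orbit_defect ze (single i u) (S i u) by rewrite /S; case: cid.
have single_in i (u : H i) : single i u i = u by exact: dfwithin.
have single_out i j (u : H i) : i != j -> single i u j = 0 by move=> ij; exact: dfwithout.
have singleE c i (u v : H i) : single i (c *: u + v) = fun j => c *: single i u j + single i v j.
  apply: functional_extensionality_dep => j; have [<-|ij] := eqVneq i j.
    by rewrite !single_in.
  by rewrite !single_out // scaler0 addr0.
have singleS (t : forall i, H i) : t = fun j => \sum_i single i (t i) j.
  apply: functional_extensionality_dep => j; rewrite (bigD1 j) //= single_in big1 ?addr0 //.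
  by move=> i ij; rewrite single_out.
have lS i j : linear (fun u => S i u j).
  move=> c u v; have := orbit_defectP c (SP i u) (SP i v).
  by rewrite -singleE => /(orbit_defect_uniq (SP _ _)) ->.
have bS i j : opb 1 (fun u => S i u j).
  move=> u; rewrite mul1r; have := orbit_defect_bound (SP i u).
  rewrite [RHS](bigD1 i) //= single_in [X in _ + X]big1 ?addr0; last first.
    by move=> k ki; rewrite single_out ?rdot0l // eq_sym.
  move=> h.
  have le k : nm (S i u k) ^+ 2 <= nm u * nm (S i u i).
    apply: le_trans (rdot_le _ _); rewrite -h (bigD1 k) //= lerDl.
    by apply: sumr_ge0 => l _; exact: sqr_ge0.
  have := le i; have := le j; have := nm_ge0 u; have := nm_ge0 (S i u i); have := nm_ge0 (S i u j).
  set p := nm u; set q := nm (S i u i); set r := nm (S i u j) => r0 q0 p0 h1 h2.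
  have qp : q <= p by nra.
  nra.
have iS i j : intertwiner (@th i) (@th j) (fun u => S i u j).
  split; first exact: mkbop (lS i j) (bS i j).
  move=> a Aa; apply/funext => u /=.
  have := orbit_defect_act Aa (SP i u).
  have -> : (fun k => th a (single i u k)) = single i (th a u).
    apply: functional_extensionality_dep => j'; have [<-|ij] := eqVneq i j'.
      by rewrite !single_in.
    by rewrite !single_out // (linop0 (@lth j' _ Aa)).
  by move=> /(orbit_defect_uniq (SP _ _)) ->.
(* The defect of a vector is the sum of the defects of its components: the projection is given by
   its matrix. *)
have all t : orbit_defect ze t (fun j => \sum_i S i (t i) j).
  have := @orbit_defect_sum ze J (index_enum J) (fun i => single i (t i)) (fun i => S i (t i)) (fun i => SP i (t i)).
  by rewrite -singleS.
have z0 j : \sum_i S i (ze i) j = 0.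
  by have /(congr1 (fun f => f j)) := orbit_defect_uniq (all ze) (orbit_defect_self ze).
have [_ /(_ e e0) [a Aa ha]] := all (fun i => y (ze i)).
exists a => // i; have := ha i; rewrite nmBC.
have -> : \sum_j S j (y (ze j)) i = 0.
  apply: (@etrans _ _ (y (\sum_j S j (ze j) i))); last by rewrite z0 (linop0 (bop_lin (by_ i))).
  rewrite (linop_sum (bop_lin (by_ i))); apply: eq_bigr => j _.
  by have := congr1 (fun T => T (ze j)) (yS (iS j i)).
by rewrite subr0.
Qed.

End Family.
End Density.

(** * Approximation by self-adjoint elements *)

Section SelfAdjointDensity.
Variables (R : realType) (H0 : hilbert R) (A : set (H0 -> H0)).
Hypothesis cA : cstar_algebra A.
Variables (J : finType) (H : J -> hilbert R) (th : forall i, (H0 -> H0) -> H i -> H i).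
Hypothesis rep : forall i, star_rep A (@th i).
Variable y : forall i, H i -> H i.
Hypothesis by_ : forall i, bop (@y i).
Hypothesis sy : forall i, adj (@y i) = @y i.
Hypothesis yS : forall i j S, intertwiner A (@th i) (@th j) S -> S \o @y i = @y j \o S.

Let bth i a : A a -> bop (@th i a). Proof. exact: shom_bop (srep_hom (rep i)) _. Qed.

(** Taking real parts is only weakly continuous, so the approximants of [family_density] cannot
    simply be symmetrized. Instead y ze is projected onto the closed real subspace of the a ze with
    a self-adjoint, and the remainder [eta] is shown to vanish; orthogonality to [eta] is a weak
    condition. *)
Lemma family_density_sa (ze : forall i, H i) (e : R) : 0 < e ->
  exists a, [/\ A a, adj a = a & forall i, nm (th a (ze i) - y (ze i)) < e].
Proof.
move=> e0.
have [] := @hilbert_projection R J H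
  [set x | exists a, [/\ A a, adj a = a & x = (fun i => th a (ze i))]] (fun i => y (ze i)).
- exists 0; split; [exact: csa0|exact: adj0|].
  by apply: functional_extensionality_dep => i; rewrite (star_hom0 cA (srep_hom (rep i))).
- move=> r x z [a [Aa sa ->]] [b [Ab sb ->]]; exists (a + r%:C *: b); split.
  + by apply: csaD => //; exact: csaZ.
  + have ba := csa_bop cA Aa; have bb := csa_bop cA Ab.
    by rewrite (adjD ba (bopZ _ bb)) (adjZr _ bb) sa sb.
  + apply: functional_extensionality_dep => i.
    rewrite (star_homD cA (srep_hom (rep i)) Aa (csaZ _ cA Ab)).
    by rewrite (star_homZ _ cA (srep_hom (rep i)) Ab).
move=> eta [h1 h2].
set c := \sum_i (nm (ze i) + nm (eta i)).
have c0 : 0 <= c by apply: sumr_ge0 => i _; rewrite addr_ge0 ?nm_ge0.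
have small (d : R) : 0 < d -> exists2 f : R, 0 < f & f * c <= d.
  move=> d0; have c1 : 0 < c + 1 by lra.
  exists (d / (c + 1)); first by rewrite divr_gt0.
  by rewrite mulrAC ler_pdivrMr //; nra.
have y0 : \sum_i rdot (y (ze i)) (eta i) = 0.
  apply/eqP; rewrite -normr_le0; apply/ler_addgt0Pr => d d0; rewrite add0r.
  have [f f0 fc] := small d d0.
  pose ze' (p : J * bool) : H p.1 := if p.2 then eta p.1 else ze p.1.
  have [] := @family_density R H0 A cA _ (fun p : J * bool => H p.1)
     (fun p => @th p.1) (fun p => rep p.1) (fun p => @y p.1) (fun p => by_ p.1) _ ze' f f0.
    by move=> p q S /yS.
  move=> a Aa ha.
  have ba := csa_bop cA Aa; have Aa' := csa_adj cA Aa; have ba' := bop_adj ba.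
  have sa : adj (a + adj a) = a + adj a by rewrite (adjD ba ba') adjK // addrC.
  have Asa : A (a + adj a) by exact: csaD.
  have := h2 (fun i => th (a + adj a) (ze i)) (ex_intro _ _ (And3 Asa sa erefl)).
  have -> : \sum_i rdot (eta i) (th (a + adj a) (ze i)) =
     \sum_i (rdot (th a (ze i) - y (ze i)) (eta i) + rdot (ze i) (th a (eta i) - y (eta i)))
     + (1 + 1) * \sum_i rdot (y (ze i)) (eta i).
    rewrite mulr_sumr -big_split /=; apply: eq_bigr => i _.
    rewrite (star_homD cA (srep_hom (rep i)) Aa Aa') fctE (shom_adj (srep_hom (rep i)) Aa).
    rewrite rdotBl rdotBr (rdotDr (th a (ze i))) -(adjE _ _ (@bth i _ Aa)) [rdot (eta i) (th a (ze i))]rdotC.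
    rewrite [rdot (ze i) (th a _)]rdotC (adjE (ze i) (eta i) (by_ i)) sy; lra.
  set T := \sum_i (_ + _); set Y := \sum_i _ => TY.
  have hT : `|T| <= f * c.
    apply: le_trans (ler_norm_sum _ _ _) _; rewrite /c mulr_sumr; apply: ler_sum => i _.
    have := ha (i, true); have := ha (i, false); rewrite /ze' /= => hz he.
    apply: le_trans (ler_normD _ _) _.
    apply: le_trans (lerD (rdot_abs _ _) (rdot_abs _ _)) _.
    have := nm_ge0 (ze i); have := nm_ge0 (eta i).
    have := nm_ge0 (th a (ze i) - y (ze i)); have := nm_ge0 (th a (eta i) - y (eta i)); nra.
  have -> : Y = - (T / 2) by lra.
  rewrite normrN normrM [X in _ * X]ger0_norm ?invr_ge0 //.
  by have := normr_ge0 T; lra.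
(* [eta] is a limit of y ze - x with x in the real subspace, and it is orthogonal both to y ze and
   to x. *)
have eta0 i : eta i = 0.
  have : \sum_i nm (eta i) ^+ 2 <= 0.
    apply/ler_addgt0Pr => d d0; rewrite add0r.
    have [f f0 fc] := small d d0; have [x Xx hx] := h1 _ f0.
    have := h2 _ Xx => hxe.
    have -> : \sum_i nm (eta i) ^+ 2 = - \sum_i rdot (y (ze i) - x i - eta i) (eta i).
      rewrite -[LHS]subr0 -[X in _ - X]y0 -[X in _ - X]subr0 -[X in _ - (_ - X)]hxe.
      rewrite -!sumrB -sumrN; apply: eq_bigr => j _.
      by rewrite !rdotBl nm2E [rdot (x j) _]rdotC; lra.
    apply: le_trans (ler_norm _) _; rewrite normrN; apply: le_trans fc.
    apply: le_trans (ler_norm_sum _ _ _) _; rewrite /c mulr_sumr; apply: ler_sum => j _.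
    apply: le_trans (rdot_abs _ _) _; have := hx j.
    have := nm_ge0 (ze j); have := nm_ge0 (eta j); have := nm_ge0 (y (ze j) - x j - eta j); nra.
  move=> h; apply/nm_eq0/eqP; rewrite -sqrf_eq0 eq_le sqr_ge0 andbT.
  apply: le_trans h; rewrite (bigD1 i) //= lerDl; apply: sumr_ge0 => j _; exact: sqr_ge0.
have [x [a [Aa sa ->]] hx] := h1 e e0; exists a; split=> // i.
by have := hx i; rewrite eta0 subr0 nmBC.
Qed.

End SelfAdjointDensity.

(** * Kaplansky density *)

Section Kaplansky.
Variables (R : realType) (H0 : hilbert R) (A : set (H0 -> H0)).
Hypothesis cA : cstar_algebra A.
Variables (J : finType) (H : J -> hilbert R) (th : forall i, (H0 -> H0) -> H i -> H i).
Hypothesis rep : forall i, star_rep A (@th i).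
Variable y : forall i, H i -> H i.
Hypothesis by_ : forall i, bop (@y i).
Hypothesis sy : forall i, adj (@y i) = @y i.
Hypothesis yS : forall i j S, intertwiner A (@th i) (@th j) S -> S \o @y i = @y j \o S.

Let bth i a : A a -> bop (@th i a). Proof. exact: shom_bop (srep_hom (rep i)) _. Qed.

(* [b = 2 a (1 + a^2)^-1] for self-adjoint [a] close to [y]; the resolvent       *)
(* bound makes this continuous without control of the norm of [a].               *)
Lemma kaplansky (x : forall i, H i -> H i) (ze : forall i, H i) (e : R) : 0 < e ->
  (forall i, x i + (@y i \o (@y i \o x i)) = @y i + @y i) ->
  exists b, [/\ A b, adj b = b, opb 2 b & forall i, nm (th b (ze i) - x i (ze i)) < e].
Proof.
move=> e0 hx.
(* [a] must be close to y at three vectors, ze, x ze and y x ze: these occur when 2a(1+a^2)^-1 ze is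
   compared with x ze. *)
pose vec (p : J * 'I_3) : H p.1 :=
  if val p.2 is 0%N then ze p.1 else if val p.2 is 1%N then x p.1 (ze p.1) else y (x p.1 (ze p.1)).
have d0 : 0 < e / 4 by lra.
have ix i v : x i v + y (y (x i v)) = y v + y v.
  by have := congr1 (fun T => T v) (hx i).
have yP (p q : J * 'I_3) S : intertwiner A (@th p.1) (@th q.1) S -> S \o @y p.1 = @y q.1 \o S.
  exact: yS.
have [a [Aa sa ha]] := @family_density_sa R H0 A cA _ (fun p : J * 'I_3 => H p.1)
     (fun p => @th p.1) (fun p => rep p.1) (fun p => @y p.1) (fun p => by_ p.1)
     (fun p => sy p.1) yP vec _ d0.
have [b [Ab sb hb eb]] := csa_resolvent cA Aa sa.
exists (b + b); split; first exact: csaD.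
- by rewrite adjD ?sb //; exact: csa_bop cA _ Ab.
- exact: opbD.
move=> i; have ra := srep_hom (rep i); have ta := @bth i _ Aa; have tb := @bth i _ Ab.
have la := bop_lin ta.
have sta : adj (th (i := i) a) = th a by rewrite -(shom_adj ra Aa) sa.
have ebt v : th b v + th a (th a (th b v)) = th (i := i) a v.
  have Aab : A (a \o b) by exact: csa_mul.
  have := congr1 (fun T => th (i := i) T v) eb.
  by rewrite (star_homD cA ra Ab (csa_mul cA Aa Aab)) (shom_mul ra Aa Aab) (shom_mul ra Aa Ab).
rewrite (star_homD cA ra Ab Ab) fctE.
have h0 := ha (i, ord0); have h1 := ha (i, Ordinal (isT : 1 < 3)%N).
have h2 := ha (i, Ordinal (isT : 2 < 3)%N); rewrite /vec /= in h0 h1 h2.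
set z := ze i in h0 h1 h2 *; set u := _ - x i z.
(* Uses x = 2y - y^2 x. With errors below e/4 one has |al| < 3e/4 and |be| < e/4, and (3/4)^2 +
   (1/4)^2 < 1. *)
pose al := (th a z - y z) + (th a z - y z) - (th a (y (x i z)) - y (y (x i z))).
pose be := y (x i z) - th a (x i z).
have E : u + th a (th a u) = al + th a be.
  rewrite /u /be !(linopB la) !(linopD la).
  have -> : th b z + th b z - x i z + (th a (th a (th b z)) + th a (th a (th b z)) - th a (th a (x i z)))
      = th a z + th a z + (- x i z - th a (th a (x i z))).
    by rewrite [LHS]addrACA [X in X + _ = _]addrACA ebt.
  rewrite /al [- (th a (y (x i z)) - _)]opprB -[RHS]addrA subrKA [th a z - _ + _]addrACA -[- y z - y z]opprD -ix [- (x i z + _)]opprD.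
  by rewrite -[RHS]addrA subrKA.
have hU := resolvent_bound ta sta E.
have hP : nm al <= nm (th a z - y z) + nm (th a z - y z) + nm (th a (y (x i z)) - y (y (x i z))).
  by apply: le_trans (nmB _ _) _; rewrite lerD2r nmD.
have hQ : nm be < e / 4 by rewrite /be nmBC.
have {}hP : nm al < 3 * (e / 4) by lra.
move: (nm_ge0 al) (nm_ge0 u) (nm_ge0 be) => P0 U0 Q0.
by rewrite ltNge; apply/negP => eU; nra.
Qed.

End Kaplansky.

(** * Tensor products and slices *)

Section Tensor.
Variable R : realType.
Implicit Types H K E : hilbert R.

Lemma op_closure_sub H K (A : set (H -> K)) : A `<=` @bop R H K -> A `<=` op_closure A.
Proof.
move=> bA T AT; apply/op_closureP; split; first exact: bA.
by move=> e e0; exists T => //; rewrite subrr; exact/opb0/ltW.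
Qed.

Lemma lspan_bop H K (S : set (H -> K)) : S `<=` @bop R H K -> lspan S `<=` @bop R H K.
Proof.
move=> bS; apply: lspan_ind; first exact: bop0.
by move=> c s v Ss bv; apply: bopD => //; apply: bopZ; exact: bS.
Qed.

Lemma clspan_cstar H (S : set (H -> H)) : S `<=` @bop R H H ->
  (forall x y, S x -> S y -> S (x \o y)) -> (forall x, S x -> S (adj x)) ->
  cstar_algebra (clspan S).
Proof.
move=> bS mS aS; have bL := lspan_bop bS.
have mL x y : lspan S x -> lspan S y -> lspan S (x \o y).
  move=> Lx; move: y; apply: lspan_ind.
    have -> : x \o (0 : H -> H) = 0 by apply/funext => v /=; rewrite (linop0 (bop_lin (bL _ Lx))).
    exact: lspan0.
  move=> c s v Ss Lv.
  have -> : x \o (c *: s + v) = c *: (x \o s) + (x \o v).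
    by apply/funext => w; rewrite /= !fctE (bop_lin (bL _ Lx)).
  apply: lspanP => //; move: x Lx {Lv}; apply: lspan_ind; first exact: lspan0.
  by move=> d t u St Lu; apply: lspanP => //; apply: lspan_sub; exact: mS.
have aL x : lspan S x -> lspan S (adj x).
  move=> Lx; suff [] : lspan S (adj x) /\ bop x by [].
  move: x Lx; apply: lspan_ind; first by rewrite adj0; split; [exact: lspan0|exact: bop0].
  move=> c s v Ss [Lv bv]; have bs := bS _ Ss; split; last by apply: bopD => //; exact: bopZ.
  have -> : c *: s + v = (complex.Re c)%:C *: s + (complex.Im c)%:C *: ('i%C *: s) + v.
    by congr (_ + _); rewrite scalerA -scalerDl [_ * 'i%C]mulrC -complexE.
  have bi := bopZ 'i%C bs.
  rewrite (adjD (bopD (bopZ _ bs) (bopZ _ bi)) bv) (adjD (bopZ _ bs) (bopZ _ bi)).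
  rewrite (adjZr _ bs) (adjZr _ bi) (adjZi bs).
  apply: lspanD => //; apply: lspanP; first exact/lspan_sub/aS.
  apply: lspanZ; rewrite -scaleN1r; apply: lspanZ; apply: lspanZ; exact/lspan_sub/aS.
split.
- by move=> T /op_closureP[].
- apply: lspan_ind; first by apply: op_closure_sub => //; exact: lspan0.
  move=> c T T' /op_closureP[bT hT] /op_closureP[bT' hT']; apply/op_closureP.
  split; first by apply: bopD => //; exact: bopZ.
  move=> e e0; pose m := complex.Re `|c|.
  have m0 : 0 <= m by rewrite /m normc_def /= sqrtr_ge0.
  have m1 : 0 < m + 1 by lra.
  have q0 : 0 < e / (m + 1) by apply: divr_gt0.
  have [x Lx hx] := hT _ q0; have [y Ly hy] := hT' _ q0.
  exists (c *: x + y); first exact: lspanP.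
  move=> v; have := hx v; have := hy v; rewrite !fctE => h1 h2.
  rewrite opprD addrACA -scalerBr; apply: le_trans (nmD _ _) _; rewrite nmZ -/m.
  have := mulfVK (lt0r_neq0 m1) e; move: h1 h2; set q := e / _ => h1 h2 <-.
  by have := nm_ge0 v; nra.
- move=> T T' /op_closureP[bT hT] /op_closureP[bT' hT']; apply/op_closureP.
  split; first exact: bop_comp.
  move=> e e0; have [M M0 hM] := bop_bound bT; have [N N0 hN] := bop_bound bT'.
  have f0 : 0 < e / (M + N + e + 1) by apply: divr_gt0 => //; lra.
  have [x Lx hx] := hT _ f0; have [y Ly hy] := hT' _ f0.
  exists (x \o y); first exact: mL.
  have -> : (T \o T') - (x \o y) = (T \o (T' - y)) + ((T - x) \o y).
    by apply/funext => v; rewrite !fctE /= (linopB (bop_lin bT)) subrKA.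
  have hy' : opb (N + e / (M + N + e + 1)) y.
    by rewrite -[y](subrK T') [y - T' + T']addrC; apply: opbD => //; exact: opbBC.
  apply: opb_le (opbD (opb_comp (ltW M0) hM hy) (opb_comp (ltW f0) hx hy')).
  have D0 : 0 < M + N + e + 1 by lra.
  have := mulfVK (lt0r_neq0 D0) e; move: f0; set f := e / _ => f0 fE.
  have f1 : f <= 1 by nra.
  by nra.
- move=> T /op_closureP[bT hT]; apply/op_closureP; split; first exact: bop_adj.
  move=> e e0; have [x Lx hx] := hT e e0; exists (adj x); first exact: aL.
  have bx := bL _ Lx; rewrite -(adjB bT bx); apply: opb_adj => //; [exact: bopB|exact: ltW].
- move=> T /op_closureP[bT hT]; apply/op_closureP; split=> // e e0.
  have e2 : 0 < e / 2 by lra.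
  have [x /op_closureP[_ hx] h1] := hT _ e2; have [y Ly h2] := hx _ e2.
  by exists y => //; have := opbD h1 h2; rewrite subrKA; apply: opb_le; lra.
Qed.

Lemma cstar_bop H : cstar_algebra (@bop R H H).
Proof.
split=> //.
- exact: lspan_bop.
- by move=> x y; exact: bop_comp.
- by move=> x; exact: bop_adj.
- by move=> x [].
Qed.

Lemma vna_cstar H (M : set (H -> H)) : von_neumann_algebra M -> cstar_algebra M.
Proof.
move=> vM; have bM := vna_bop vM; have E := vna_bicommutant vM.
have MP T : (bop T /\ forall S, commutant M S -> T \o S = S \o T) -> M T by rewrite -[M T]/(M T) -{2}E.
have MC T S : M T -> commutant M S -> T \o S = S \o T by rewrite -{1}E => -[_ h]; exact: h.
have cb S : commutant M S -> bop S by case.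
split=> //.
- apply: lspan_ind; first by apply: MP; split=> [|S /cb bS]; [exact: bop0|apply/funext => v /=; rewrite (linop0 (bop_lin bS))].
  move=> c s v Ms Mv; apply: MP; split; first by apply: bopD; [apply/bopZ/bM|exact: bM].
  move=> S cS; have h1 := MC _ _ Ms cS; have h2 := MC _ _ Mv cS; apply/funext => w.
  rewrite /= !fctE (bop_lin (cb _ cS)).
  by have /= -> := congr1 (fun T => T w) h1; have /= -> := congr1 (fun T => T w) h2.
- move=> x y Mx My; apply: MP; split; first by apply: bop_comp; exact: bM.
  move=> S cS; have h1 := MC _ _ Mx cS; have h2 := MC _ _ My cS.
  by rewrite -compA h2 compA h1.
- exact: vna_adj.
- move=> T /op_closureP[bT hT]; apply: MP; split=> // S cS.
  have bS := cb _ cS; have [N N0 hN] := bop_bound bS.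
  apply: opb_eq => e e0; have f0 : 0 < e / (2 * N) by rewrite divr_gt0 // mulr_gt0.
  have [x Mx h] := hT _ f0; have h1 := MC _ _ Mx cS.
  have -> : (T \o S) - (S \o T) = ((T - x) \o S) - (S \o (T - x)).
    apply/funext => v; rewrite !fctE /= (linopB (bop_lin bS)).
    by have /= -> := congr1 (fun T => T v) h1; rewrite opprB addrA subrK.
  apply: opb_le (opbB (opb_comp (ltW f0) h hN) (opb_comp (ltW N0) hN h)).
  have := mulfVK (lt0r_neq0 (mulr_gt0 (ltr0Sn R 1) N0)) e.
  by set f := e / _ => <-; lra.
Qed.

Variable tens : forall H K : hilbert R, htensor H K.

Local Notation ot := (@optens R tens _ _ _ _).

Definition lop H K (k : K) : H -> tens H K := fun h => pure (tens H K) h k.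
Definition rop H K (h : H) : K -> tens H K := fun k => pure (tens H K) h k.

Lemma nm_pure H K h k : nm (pure (tens H K) h k) = nm h * nm k.
Proof.
apply/eqP; rewrite -(@eqrXn2 _ 2%N) ?mulr_ge0 ?nm_ge0 //; apply/eqP.
by rewrite exprMn !nm2E {1}/rdot pure_dot -!dot_norm !normE -!rmorphXn -rmorphM /= !nm2E.
Qed.

Lemma bop_lop H K k : bop (@lop H K k).
Proof.
apply: (@mkbop _ _ _ _ (nm k)) => [c x y|x]; first exact: linearPl.
by rewrite /lop nm_pure mulrC.
Qed.

Lemma bop_rop H K h : bop (@rop H K h).
Proof.
apply: (@mkbop _ _ _ _ (nm h)) => [c x y|x]; first exact: linearPr.
by rewrite /rop nm_pure.
Qed.

Lemma dot_inj H (x x' : H) : (forall y, dot H y x = dot H y x') -> x = x'.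
Proof. by move=> h; apply: rdot_inj => y; rewrite rdotC [RHS]rdotC /rdot h. Qed.

Lemma dotBr H (x y z : H) : dot H x (y - z) = dot H x y - dot H x z.
Proof. exact: linearBr. Qed.

Lemma adj_lop H K k k' h : adj (@lop H K k') (pure (tens H K) h k) = dot K k k' *: h.
Proof.
apply: dot_inj => y; rewrite -(adj_spec (bop_lop H k')).2 /lop pure_dot linearZr_LR /=.
by rewrite [dot K k' k]dotC mulrC.
Qed.

Lemma adj_rop H K h h' k : adj (@rop H K h') (pure (tens H K) h k) = dot H h h' *: k.
Proof.
apply: dot_inj => y; rewrite -(adj_spec (bop_rop K h')).2 /rop pure_dot linearZr_LR /=.
by rewrite [dot H h' h]dotC.
Qed.

Lemma pure_eq H K E (X Y : tens H K -> E) : bop X -> bop Y ->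
  (forall h k, X (pure (tens H K) h k) = Y (pure (tens H K) h k)) -> X = Y.
Proof.
move=> bX bY h; apply: (total_eq (pure_total (tens H K))) => //.
by move=> _ [a [b ->]].
Qed.

(** x (x) 1 and 1 (x) y are separate instances of [column_extension], with the maps h |-> h (x) k
    and k |-> h (x) k as the family: for these [adj T \o S] is a scalar, so the commutation holds
    for every bounded operator. *)
Lemma optens_exists H K (x : H -> H) (y : K -> K) : bop x -> bop y ->
  exists T : tens H K -> tens H K, bop T /\
    forall h k, T (pure (tens H K) h k) = pure (tens H K) (x h) (y k).
Proof.
move=> bx by_.
have [|||X [bX hX _]] := @column_extension R H (tens H K) (@bop R H H)
    [set S | exists k, S = @lop H K k] x (cstar_bop H) bx.
- by move=> _ [k ->]; exact: bop_lop.
- have := pure_total (tens H K); rewrite /total_set; congr (closure (lspan _) = _).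
  apply/seteqP; split=> [_ [h [k ->]]|_ [_ [h [[k ->] ->]]]].
    by exists (@lop H K k), h; split=> //; exists k.
  by exists h, k.
- move=> _ _ z [k ->] [k' ->] bz; apply/funext => v /=.
  by rewrite {1 3}/lop !adj_lop (linopZ (bop_lin bz)).
have [|||Y [bY hY _]] := @column_extension R K (tens H K) (@bop R K K)
    [set S | exists h, S = @rop H K h] y (cstar_bop K) by_.
- by move=> _ [h ->]; exact: bop_rop.
- have := pure_total (tens H K); rewrite /total_set; congr (closure (lspan _) = _).
  apply/seteqP; split=> [_ [h [k ->]]|_ [_ [k [[h ->] ->]]]].
    by exists (@rop H K h), k; split=> //; exists h.
  by exists h, k.
- move=> _ _ z [h ->] [h' ->] bz; apply/funext => v /=.
  by rewrite {1 3}/rop !adj_rop (linopZ (bop_lin bz)).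
exists (X \o Y); split; first exact: bop_comp.
move=> h k /=.
have /= e1 := congr1 (fun T => T k) (hY _ (ex_intro _ h erefl)).
have /= e2 := congr1 (fun T => T h) (hX _ (ex_intro _ (y k) erefl)).
by rewrite /rop in e1; rewrite e1; exact: e2.
Qed.

Lemma optens_spec H K (x : H -> H) (y : K -> K) : bop x -> bop y ->
  bop (ot x y) /\
  forall h k, ot x y (pure (tens H K) h k) = pure (tens H K) (x h) (y k).
Proof.
move=> bx by_; rewrite /optens; apply: (@xgetPex _ _ [set T | bop T /\ _]).
exact: optens_exists.
Qed.

Lemma bop_optens H K (x : H -> H) (y : K -> K) : bop x -> bop y -> bop (ot x y).
Proof. by move=> bx by_; case: (optens_spec bx by_). Qed.

Lemma optensE H K (x : H -> H) (y : K -> K) h k : bop x -> bop y ->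
  ot x y (pure (tens H K) h k) = pure (tens H K) (x h) (y k).
Proof. by move=> bx by_; case: (optens_spec bx by_). Qed.

Lemma optens_comp H K (x x' : H -> H) (y y' : K -> K) : bop x -> bop y -> bop x' -> bop y' ->
  ot x y \o ot x' y' = ot (x \o x') (y \o y').
Proof.
move=> bx by_ bx' by'; have bxx := bop_comp bx bx'; have byy := bop_comp by_ by'.
apply: pure_eq; [exact: bop_comp (bop_optens bx by_) (bop_optens bx' by')|exact: bop_optens|].
by move=> h k /=; rewrite (optensE _ _ bx' by') (optensE _ _ bx by_) (optensE _ _ bxx byy).
Qed.

Lemma adj_optens H K (x : H -> H) (y : K -> K) : bop x -> bop y ->
  adj (ot x y) = ot (adj x) (adj y).
Proof.
move=> bx by_; have bt := bop_optens bx by_.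
apply: pure_eq; [exact: bop_adj|exact: bop_optens (bop_adj bx) (bop_adj by_)|].
move=> h k; rewrite (optensE _ _ (bop_adj bx) (bop_adj by_)).
apply/subr0_eq/(total_orth (pure_total (tens H K))) => _ [h' [k' ->]].
rewrite dotBr -(adj_spec bt).2 (optensE _ _ bx by_) !pure_dot.
by rewrite (adj_spec bx).2 (adj_spec by_).2 subrr.
Qed.

End Tensor.

(** * Slices by vector functionals, and equivariance *)

Section Slices.
Variable R : realType.
Variable tens : forall H K : hilbert R, htensor H K.
Implicit Types H K E : hilbert R.
Local Notation ot := (@optens R tens _ _ _ _).

Lemma dot_adjl H K (T : H -> K) x y : bop T -> dot H (adj T x) y = dot K x (T y).
Proof. by move=> bT; rewrite dotC -(adj_spec bT).2 -dotC. Qed.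

Lemma closure_orth H (S : set H) v y : closure (lspan S) v ->
  (forall s, S s -> dot H s y = 0) -> dot H v y = 0.
Proof.
move=> cS h.
have h0 z : lspan S z -> dot H z y = 0.
  move: z; apply: lspan_ind; first by rewrite linear0l.
  by move=> c s w Ss hw; rewrite linearDl /= linearZl_LR /= h // hw mulr0 addr0.
suff r0 w : nm w = nm y -> (forall z, lspan S z -> rdot z w = 0) -> rdot v w = 0.
  rewrite dotE; apply/eqP; rewrite eq_complex /=; apply/andP; split; apply/eqP.
    by apply: r0 => // z /h0 hz; rewrite /rdot hz.
  by apply: r0; [exact: nmZi|move=> z /h0 hz; rewrite rdotir hz].
move=> _ hw; apply/eqP; rewrite -normr_le0; apply/ler_addgt0Pr => e e0; rewrite add0r.
have w1 : 0 < nm w + 1 by have := nm_ge0 w; lra.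
have [clo _] := closure_nm (lspan S) v; have [z Sz hz] := clo cS _ (divr_gt0 e0 w1).
have -> : rdot v w = rdot (v - z) w by rewrite rdotBl (hw _ Sz) subr0.
apply: le_trans (rdot_abs _ _) _.
have := mulfVK (lt0r_neq0 w1) e; move: hz; set q := e / _ => hz <-.
by have := nm_ge0 w; have := nm_ge0 (v - z); nra.
Qed.

Lemma clspan_vec H K (S : set (H -> K)) T v : clspan S T ->
  closure (lspan [set w | exists2 s, S s & w = s v]) (T v).
Proof.
move=> /op_closureP[_ h]; apply/closure_nm => e e0.
have v1 : 0 < nm v + 1 by have := nm_ge0 v; lra.
have q0 := divr_gt0 e0 v1; have [s Ls hs] := h _ q0.
exists (s v).
  move: s Ls {hs}; apply: lspan_ind; first exact: lspan0.
  by move=> c s w Ss Lw; apply: lspanP => //; apply: lspan_sub; exists s.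
have := hs v; have := mulfVK (lt0r_neq0 v1) e; move: q0; set q := e / _ => q0 <-; rewrite fctE.
by have := nm_ge0 v; nra.
Qed.

Lemma total_pure H K (S1 : set H) (S2 : set K) : total_set S1 -> total_set S2 ->
  total_set [set v | exists s1 s2, [/\ S1 s1, S2 s2 & v = pure (tens H K) s1 s2]].
Proof.
move=> t1 t2; apply: orth_total => y h.
apply: (total_orth (pure_total (tens H K))) => _ [h' [k ->]].
have e1 s1 k' : S1 s1 -> dot (tens H K) (pure (tens H K) s1 k') y = 0.
  move=> Ss; have /= := (adj_spec (bop_rop tens K s1)).2 k' y; rewrite {1}/rop => ->.
  suff -> : adj (@rop R tens H K s1) y = 0 by rewrite linear0r.
  apply: (total_orth t2) => s2 Ss2.
  by rewrite -(adj_spec (bop_rop tens K s1)).2; apply: h; exists s1, s2.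
have /= := (adj_spec (bop_lop tens H k)).2 h' y; rewrite {1}/lop => ->.
suff -> : adj (@lop R tens H K k) y = 0 by rewrite linear0r.
apply: (total_orth t1) => s1 Ss1.
by rewrite -(adj_spec (bop_lop tens H k)).2; exact: e1.
Qed.

(** The slice of X by the vector functional T |-> <T h, h0>. Written as a composition it is visibly
    bounded and linear in X; [lslice_spec] recovers the general slices as norm limits of sums of
    these. *)
Definition slc H K (h h0 : H) (X : tens H K -> tens H K) : K -> K :=
  adj (@rop R tens H K h0) \o (X \o @rop R tens H K h).

Lemma slc_dot H K (h h0 : H) (X : tens H K -> tens H K) k k' :
  dot K (slc h h0 X k) k' = dot (tens H K) (X (pure (tens H K) h k)) (pure (tens H K) h0 k').
Proof. by rewrite /slc /= dot_adjl //; exact: bop_rop. Qed.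

Lemma bop_slc H K (h h0 : H) (X : tens H K -> tens H K) : bop X -> bop (slc h h0 X).
Proof.
move=> bX; apply: bop_comp; first exact/bop_adj/bop_rop.
by apply: bop_comp => //; exact: bop_rop.
Qed.

Lemma opb_rop H K (h : H) : opb (nm h) (@rop R tens H K h).
Proof. by move=> k; rewrite /rop nm_pure. Qed.

Lemma opb_slc H K (h h0 : H) (X : tens H K -> tens H K) C : 0 <= C -> opb C X ->
  opb (nm h0 * (C * nm h)) (slc h h0 X).
Proof.
move=> C0 hX; apply: opb_comp; [exact: nm_ge0| |].
  by apply: opb_adj; [exact: bop_rop|exact: nm_ge0|exact: opb_rop].
by apply: opb_comp => //; exact: opb_rop.
Qed.

Lemma slcP H K (h h0 : H) c (X Y : tens H K -> tens H K) :
  slc h h0 (c *: X + Y) = c *: slc h h0 X + slc h h0 Y.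
Proof.
apply/funext => k; rewrite /slc /= !fctE.
by rewrite (bop_lin (bop_adj (bop_rop tens K h0))).
Qed.

Lemma slc0 H K (h h0 : H) : slc h h0 (0 : tens H K -> tens H K) = 0.
Proof. by apply/funext => k; rewrite /slc /= (linop0 (bop_lin (bop_adj (bop_rop tens K h0)))). Qed.

Lemma slcB H K (h h0 : H) (X Y : tens H K -> tens H K) :
  slc h h0 (X - Y) = slc h h0 X - slc h h0 Y.
Proof. by rewrite addrC -scaleN1r slcP scaleN1r addrC. Qed.

Lemma slc_optens H K (h h0 : H) (c : H -> H) (a : K -> K) : bop c -> bop a ->
  slc h h0 (ot c a) = dot H (c h) h0 *: a.
Proof.
by move=> bc ba; apply/funext => k; rewrite /slc /= /rop optensE // adj_rop.
Qed.

(** Factoring the vector as c h and multiplying by a moves a multiplier X to X (c (x) a), which lies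
    in the tensor product algebra itself. *)
Lemma slc_comp H K (h h0 : H) (c : H -> H) (a : K -> K) X : bop c -> bop a ->
  slc (c h) h0 X \o a = slc h h0 (X \o ot c a).
Proof. by move=> bc ba; apply/funext => k; rewrite /slc /= /rop optensE. Qed.

Lemma min_tens_cstar H K (C : set (H -> H)) (A : set (K -> K)) :
  cstar_algebra C -> cstar_algebra A -> cstar_algebra (min_tens (tens := tens) C A).
Proof.
move=> cC cA; have bC := csa_bop cC; have bA := csa_bop cA; apply: clspan_cstar.
- by move=> _ [c [a [/bC bc /bA ba ->]]]; exact: bop_optens.
- move=> _ _ [c [a [Cc Aa ->]]] [c' [a' [Cc' Aa' ->]]].
  exists (c \o c'), (a \o a'); split; [exact: csa_mul|exact: csa_mul|].
  by rewrite (optens_comp tens (bC _ Cc) (bA _ Aa) (bC _ Cc') (bA _ Aa')).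
- move=> _ [c [a [Cc Aa ->]]]; exists (adj c), (adj a); split; [exact: csa_adj|exact: csa_adj|].
  by rewrite adj_optens //; [exact: bC|exact: bA].
Qed.

Lemma min_tens_elem H K (C : set (H -> H)) (A : set (K -> K)) c a :
  cstar_algebra C -> cstar_algebra A -> C c -> A a -> min_tens (tens := tens) C A (ot c a).
Proof.
move=> cC cA Cc Aa; apply: op_closure_sub; last by apply: lspan_sub; exists c, a.
apply: lspan_bop => _ [c' [a' [Cc' Aa' ->]]].
by apply: bop_optens; [exact: csa_bop cC _ Cc'|exact: csa_bop cA _ Aa'].
Qed.

(** On elementary tensors this is [mid_elem]; it passes to norm limits because f and F are
    contractive. *)
Lemma slc_mor_id_tens H K K' (C : set (H -> H)) (A : set (K -> K)) (B : set (K' -> K'))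
    f F h h0 t :
  cstar_algebra C -> cstar_algebra A -> star_hom A f -> mor_id_tens (tens := tens) C A B f F ->
  min_tens C A t -> A (slc h h0 t) /\ f (slc h h0 t) = slc h h0 (F t).
Proof.
move=> cC cA hf hF Mt; have cM := min_tens_cstar cC cA.
have sF := cmor_hom (mid_mor hF); have bM := csa_bop cM.
have lsp u : lspan (elem_tens C A) u ->
    [/\ min_tens C A u, A (slc h h0 u) & f (slc h h0 u) = slc h h0 (F u)].
  move: u; apply: lspan_ind.
    by rewrite slc0 (star_hom0 cM sF) (star_hom0 cA hf) slc0; split=> //; exact: csa0.
  move=> z _ v [c [a [Cc Aa ->]]] [Mv Av fv].
  have Mca := min_tens_elem cC cA Cc Aa.
  have ba := csa_bop cA Aa; have bc := csa_bop cC Cc.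
  rewrite slcP (slc_optens _ _ bc ba); split.
  - by apply: csaD => //; exact: csaZ.
  - by apply: csaD => //; apply: csaZ => //; exact: csaZ.
  - rewrite (shom_linear hf _ (csaZ _ cA Aa) Av) (star_homZ _ cA hf Aa) fv.
    rewrite (shom_linear sF _ Mca Mv) (mid_elem hF Cc Aa) slcP slc_optens //.
    exact: shom_bop hf _ Aa.
have [bt ht] := (op_closureP _ _).1 Mt.
have N0 : 0 < nm h0 * nm h + 1 by have := nm_ge0 h0; have := nm_ge0 h; nra.
have app e : 0 < e -> exists u, [/\ lspan (elem_tens C A) u,
    opb e (slc h h0 (t - u)) & opb e (slc h h0 (F (t - u)))].
  move=> e0; have q0 := divr_gt0 e0 N0; have [u Lu hu] := ht _ q0.
  have [Mu _ _] := lsp _ Lu; have Mtu := csaB cM Mt Mu.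
  have le : nm h0 * (e / (nm h0 * nm h + 1) * nm h) <= e.
    have := mulfVK (lt0r_neq0 N0) e; move: q0; set q := e / _ => q0 qE; rewrite -[leRHS]qE; nra.
  exists u; split=> //; apply: opb_le le _; apply: opb_slc => //; try exact: ltW.
  exact: (star_hom_contractive cM sF Mtu (ltW q0)).
have As : A (slc h h0 t).
  apply: (csa_lim cA); first exact: bop_slc.
  move=> e e0; have [u [Lu h1 _]] := app e e0; have [_ Au _] := lsp _ Lu.
  by exists (slc h h0 u) => //; rewrite -slcB.
split=> //; apply: opb_eq => e e0.
have [u [Lu h1 h2]] := app (e / 2) ltac:(lra); have [Mu Au fu] := lsp _ Lu.
have -> : f (slc h h0 t) - slc h h0 (F t) = f (slc h h0 (t - u)) - slc h h0 (F (t - u)).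
  rewrite slcB (star_homB cA hf As Au) (star_homB cM sF Mt Mu) slcB fu.
  by rewrite opprB addrA subrK.
have := opbB (star_hom_contractive cA hf (_ : A (slc h h0 (t - u))) _ h1) h2.
move=> H1; apply: opb_le (H1 _ _); [lra|by rewrite slcB; exact: csaB|lra].
Qed.

Section Star.
Variable G : lcqg tens.
Local Notation L2 := (qg_L2 G).
Local Notation C0 := (@qg_C0 R tens G).

Lemma C0_cstar : cstar_algebra C0. Proof. exact: qg_C0_cstar. Qed.

(** A G-morphism is equivariant in terms of extensions to multiplier algebras. Multiplying by c (x)
    a brings the identity back into C_0(G) (x) A1, where slicing commutes with f. *)
Lemma slc_equivariant K1 K2 (A1 : set (K1 -> K1)) d1 (A2 : set (K2 -> K2)) d2 f :
  g_cstar_algebra (G := G) A1 d1 -> g_cstar_algebra (G := G) A2 d2 ->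
  g_morphism (G := G) A1 d1 A2 d2 f -> (forall a, A1 a -> A2 (f a)) ->
  forall b a c h h0, A1 b -> A1 a -> C0 c ->
  A1 (slc (c h) h0 (d1 b) \o a) /\
  f (slc (c h) h0 (d1 b) \o a) = slc (c h) h0 (d2 (f b)) \o f a.
Proof.
move=> g1 g2 gf fA b a c h h0 Ab Aa Cc.
have cA1 := gc_cstar g1; have cA2 := gc_cstar g2; have cC := C0_cstar.
have sf := cmor_hom (gm_mor gf); have s2 := cmor_hom (gc_mor g2).
have [F mF /(_ b Ab) [Y [bY hY] [_ hY']]] := gm_equivariant gf.
have Afb := fA _ Ab; have bd := shom_bop s2 Afb.
(* The extension of d2 to multipliers, taken at f b, is d2 (f b) itself: the two agree on the
   vectors d2(a') t v, which are total by nondegeneracy of d2. *)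
have YE : Y = d2 (f b).
  pose S := opmul (d2 @` A2) (min_tens (tens := tens) C0 A2).
  have cM := min_tens_cstar cC cA2.
  have tS : total_set [set w | exists s v, S s /\ w = s v].
    apply: orth_total => y hy.
    have tp := total_pure (qg_C0_nondegenerate G) (gc_nondegenerate g2).
    apply: (total_orth tp) => _ [_ [_ [[c' [h' [Cc' ->]]] [a' [k' [Aa' ->]]] ->]]].
    have bc' := csa_bop cC Cc'; have ba' := csa_bop cA2 Aa'.
    rewrite -optensE //.
    have := min_tens_elem cC cA2 Cc' Aa'; rewrite -(cmor_nondegenerate (gc_mor g2)).
    move=> /(@clspan_vec _ _ _ _ (pure (tens L2 K2) h' k')) cl.
    apply: (closure_orth cl) => _ [s Ss ->].
    by apply: hy; exists s, (pure (tens L2 K2) h' k').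
  apply: (total_eq tS) => // _ [_ [v [[_ [t [[a' Aa' <-] Mt ->]]] ->]]] /=.
  have /= -> := congr1 (fun T => T (t v)) (hY _ Aa').
  by rewrite (shom_mul s2 Afb Aa').
have ba := csa_bop cA1 Aa; have bc := csa_bop cC Cc.
have Mca := min_tens_elem cC cA1 Cc Aa.
have Mt : min_tens C0 A1 (d1 b \o ot c a).
  by have [_ /(_ _ Mca) []] := cmor_mult (gc_mor g1) Ab.
rewrite (slc_comp _ _ _ bc ba).
have [h1 h2] := slc_mor_id_tens h h0 cC cA1 sf mF Mt; split=> //.
rewrite h2 -(hY' _ Mca) (mid_elem mF Cc Aa) YE slc_comp //.
exact: shom_bop sf _ Aa.
Qed.

End Star.
End Slices.

(** * Normal functionals *)

Section NormalFunctionals.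
Variable R : realType.
Implicit Types H K E : hilbert R.

Lemma Re_le (z : R[i]) : (`|complex.Re z|)%:C <= `|z|.
Proof.
rewrite normc_def lecR -sqrtr_sqr; apply: ler_wsqrtr.
by rewrite lerDl sqr_ge0.
Qed.

Lemma Im_le (z : R[i]) : (`|complex.Im z|)%:C <= `|z|.
Proof.
rewrite normc_def lecR -sqrtr_sqr; apply: ler_wsqrtr.
by rewrite lerDr sqr_ge0.
Qed.

Lemma norm_le_ReIm (z : R[i]) : `|z| <= (`|complex.Re z| + `|complex.Im z|)%:C.
Proof.
rewrite normc_def lecR.
have h : 0 <= `|complex.Re z| + `|complex.Im z| by rewrite addr_ge0.
rewrite -[leRHS]ger0_norm // -sqrtr_sqr; apply: ler_wsqrtr.
rewrite sqrrD !real_normK ?num_real //.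
have := normr_ge0 (complex.Re z); have := normr_ge0 (complex.Im z).
rewrite -mulr_natl => a b; have := mulr_ge0 b a; lra.
Qed.

Lemma cvg_ReIm (T : Type) (F : set_system T) {FF : Filter F} (f : T -> (R[i] : numFieldType)) (z : R[i]) :
  (f t @[t --> F] --> (z : (R[i] : numFieldType))) <->
  (complex.Re (f t) @[t --> F] --> complex.Re z) /\ (complex.Im (f t) @[t --> F] --> complex.Im z).
Proof.
split=> [/cvgrPdist_lt h|[/cvgrPdist_lt h1 /cvgrPdist_lt h2]].
  split; apply/cvgrPdist_lt => e e0; have := h e%:C; rewrite ltcR => /(_ e0); apply: filterS => t ht.
    by rewrite -raddfB -ltcR; apply: le_lt_trans (Re_le _) ht.
  by rewrite -raddfB -ltcR; apply: le_lt_trans (Im_le _) ht.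
apply/cvgrPdist_lt => e /posCP[r r0 ->]; have r2 : 0 < r / 2 by lra.
have := h1 _ r2; have := h2 _ r2; apply: filterS2 => t ht1 ht2.
apply: le_lt_trans (norm_le_ReIm _) _; rewrite ltcR !raddfB /=; lra.
Qed.

Lemma Re_series (u : nat -> R[i]) n : complex.Re (series u n) = series (fun k => complex.Re (u k)) n.
Proof. by rewrite /series /= raddf_sum. Qed.

Lemma Im_series (u : nat -> R[i]) n : complex.Im (series u n) = series (fun k => complex.Im (u k)) n.
Proof. by rewrite /series /= raddf_sum. Qed.

(** A summable majorant, by the arithmetic-geometric mean inequality, of the n-th term of w at any
    operator of norm at most 1. Truncation errors are thus at most C times [tail], uniformly over
    the operators of norm at most C. *)
Definition wt H (w : nfunctional H) (n : nat) : R := (nm (nf_l w n) ^+ 2 + nm (nf_r w n) ^+ 2) / 2.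

Lemma cvg_sq H (u : nat -> H) : cvgn (series (fun n => `|u n| ^+ 2)) <-> cvgn (series (fun n => nm (u n) ^+ 2)).
Proof.
have E n : `|u n| ^+ 2 = (nm (u n) ^+ 2)%:C by rewrite normE -rmorphXn.
have ER : (fun n => complex.Re (series (fun n => `|u n| ^+ 2) n)) = series (fun n => nm (u n) ^+ 2).
  by apply/funext => n; rewrite Re_series; congr (series _ n); apply/funext => k; rewrite E.
have EI : (fun n => complex.Im (series (fun n => `|u n| ^+ 2) n)) = fun=> 0.
  apply/funext => n; rewrite Im_series /series /= big1 // => k _; by rewrite E.
split=> [/cvg_ex[l /cvg_ReIm[]]|/cvg_ex[l hl]].
  by rewrite ER => h _; apply/cvg_ex; eexists; exact: h.
apply/cvg_ex; exists l%:C; apply/cvg_ReIm; rewrite ER EI; split=> //.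
exact: cvg_cst.
Qed.

Lemma wt_ge0 H (w : nfunctional H) n : 0 <= wt w n.
Proof. by rewrite divr_ge0 // addr_ge0 // sqr_ge0. Qed.

Lemma wt_cvg H (w : nfunctional H) : cvgn (series (wt w)).
Proof.
have -> : series (wt w) = (1/2) *: (series (fun n => nm (nf_l w n) ^+ 2) + series (fun n => nm (nf_r w n) ^+ 2)).
  apply/funext => n; rewrite !fctE /series /= -big_split /= scaler_sumr; apply: eq_bigr => k _.
  by rewrite /wt /GRing.scale /=; lra.
apply: is_cvgZr; apply: is_cvgD.
  by apply/cvg_sq; exact: nf_l_summable.
by apply/cvg_sq; exact: nf_r_summable.
Qed.

Definition tail H (w : nfunctional H) (n : nat) : R := limn (series (wt w)) - series (wt w) n.

Lemma series_tail H (w : nfunctional H) n m : (n <= m)%N ->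
  series (wt w) m - series (wt w) n <= tail w n.
Proof.
move=> nm; rewrite /tail lerD2r; apply: nondecreasing_cvgn_le; last exact: wt_cvg.
by apply: nondecreasing_series => k _ _; exact: wt_ge0.
Qed.

Lemma tail_small H (w : nfunctional H) e : 0 < e -> exists N, forall n, (N <= n)%N -> tail w n < e.
Proof.
move=> e0; have /cvgrPdist_lt /(_ e e0) [N _ HN] := @wt_cvg _ w.
by exists N => n /HN /=; apply: le_lt_trans; exact: ler_norm.
Qed.

Lemma tail_ge0 H (w : nfunctional H) n : 0 <= tail w n.
Proof. by have := series_tail w (leqnn n); rewrite subrr. Qed.

Lemma nf_term H K (w : nfunctional H) (T : H -> K) (V : H -> K) C n :
  0 <= C -> nm (T (nf_l w n)) * nm (V (nf_r w n)) <= C * (nm (nf_l w n) * nm (nf_r w n)) ->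
  `|rdot (T (nf_l w n)) (V (nf_r w n))| <= C * wt w n.
Proof.
move=> C0 h; apply: le_trans (rdot_abs _ _) _; apply: le_trans h _.
apply: ler_wpM2l => //; rewrite /wt.
have := sqr_ge0 (nm (nf_l w n) - nm (nf_r w n)); rewrite sqrrB; lra.
Qed.

Lemma dominated_series H (w : nfunctional H) (t : nat -> R) C : 0 <= C ->
  (forall n, `|t n| <= C * wt w n) ->
  cvgn (series t) /\ forall n, `|limn (series t) - series t n| <= C * tail w n.
Proof.
move=> C0 ht.
have diff n m : (n <= m)%N -> `|series t m - series t n| <= C * tail w n.
  move=> nm; apply: le_trans (_ : C * (series (wt w) m - series (wt w) n) <= _); last first.
    by apply: ler_wpM2l => //; exact: series_tail.
  rewrite !sub_series_geq //; apply: le_trans (ler_norm_sum _ _ _) _.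
  by rewrite mulr_sumr; apply: ler_sum => k _; exact: ht.
have cv : cvgn (series t).
  apply: cauchy_cvg; apply: cauchy_exP => e e0.
  have [N HN] := tail_small w (divr_gt0 e0 (ltac:(lra) : 0 < C + 1)).
  exists (series t N); exists N => // n /= Nn; rewrite /ball /= distrC.
  apply: le_lt_trans (diff _ _ Nn) _; have := HN N (leqnn _).
  have C1 : C + 1 != 0 by apply: lt0r_neq0; lra.
  by have := mulfVK C1 e; have := tail_ge0 w N; set q := e / _ => t0 <-; nra.
split=> // n; apply/ler_addgt0Pr => e e0.
have /cvgrPdist_lt /(_ e e0) [N _ HN] := cv.
have := HN (maxn N n) (leq_maxl _ _) => /= h1; have := diff _ _ (leq_maxr N n).
move=> h2; set L := limn _ in h1 *; set s := series t _ in h1 h2.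
have -> : L - series t n = (L - s) + (s - series t n) by rewrite subrKA.
by apply: le_trans (ler_normD _ _) _; lra.
Qed.

Lemma sq_summable_eq H K (u : nat -> H) (v : nat -> K) : (forall n, nm (u n) = nm (v n)) ->
  cvgn (series (fun n => `|u n| ^+ 2)) -> cvgn (series (fun n => `|v n| ^+ 2)).
Proof. by move=> e /cvg_sq h; apply/cvg_sq; under eq_fun do rewrite -e; exact: h. Qed.

(** Multiplying the right vectors by i turns the imaginary part of w into a real part, so that real
    series suffice ([nf_appE]). *)
Definition nf_i H (w : nfunctional H) : nfunctional H :=
  NFunctional (nf_l_summable (n := w)) (sq_summable_eq (fun n => esym (nmZi (nf_r w n))) (nf_r_summable (n := w))).

Definition rnf H (w : nfunctional H) (T : H -> H) : R :=
  limn (series (fun n => rdot (T (nf_l w n)) (nf_r w n))).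

Lemma rnf_spec H (w : nfunctional H) (T : H -> H) C : 0 <= C -> opb C T ->
  cvgn (series (fun n => rdot (T (nf_l w n)) (nf_r w n))) /\
  forall n, `|rnf w T - series (fun n => rdot (T (nf_l w n)) (nf_r w n)) n| <= C * tail w n.
Proof.
move=> C0 hT; apply: dominated_series => // n.
apply: (nf_term (V := id)) => //.
by rewrite mulrA ler_wpM2r ?nm_ge0 //; exact: hT.
Qed.

Lemma nf_appE H (w : nfunctional H) (T : H -> H) : bop T ->
  nf_app w T = rnf w T +i* rnf (nf_i w) T.
Proof.
move=> bT; have [C C0 hC] := bop_bound bT.
have [c1 _] := rnf_spec w (ltW C0) hC; have [c2 _] := rnf_spec (nf_i w) (ltW C0) hC.
apply: (@cvg_lim (R[i] : numFieldType)) => //; apply/cvg_ReIm; split=> /=.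
  under eq_fun do rewrite Re_series; exact: c1.
under eq_fun do rewrite Im_series.
by under eq_fun do under eq_fun do rewrite -rdotir; exact: c2.
Qed.

Lemma nf_app_cvg H (w : nfunctional H) (F : set_system (H -> H)) (x : H -> H) {FF : Filter F} :
  F (@bop R H H) -> bop x ->
  (nf_app w y @[y --> F] --> nf_app w x) <->
  (rnf w y @[y --> F] --> rnf w x) /\ (rnf (nf_i w) y @[y --> F] --> rnf (nf_i w) x).
Proof.
move=> FB bx; rewrite cvg_ReIm nf_appE //=; split=> -[h1 h2]; split.
- by apply: cvg_trans h1; apply: near_eq_cvg; apply: filterS FB => y by_; rewrite nf_appE.
- by apply: cvg_trans h2; apply: near_eq_cvg; apply: filterS FB => y by_; rewrite nf_appE.
- by apply: cvg_trans h1; apply: near_eq_cvg; apply: filterS FB => y by_; rewrite nf_appE.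
- by apply: cvg_trans h2; apply: near_eq_cvg; apply: filterS FB => y by_; rewrite nf_appE.
Qed.

(** The remainder of the series is uniformly small on a ball, which leaves finitely many matrix
    coefficients. *)
Lemma bounded_weak_sw H (F : set_system (H -> H)) (x : H -> H) C {FF : Filter F} : 0 <= C ->
  F [set y | bop y /\ opb C y] -> bop x -> opb C x ->
  (forall u v, rdot (y u) v @[y --> F] --> rdot (x u) v) -> sw_cvg F x.
Proof.
move=> C0 FB bx hx hw w.
apply/nf_app_cvg => //; first by apply: filterS FB => y [].
have main (w' : nfunctional H) : rnf w' y @[y --> F] --> rnf w' x.
  apply/cvgrPdist_lt => e e0.
  have C1 : 0 < 2 * C + 1 by lra.
  have [N HN] := tail_small w' (divr_gt0 (ltac:(lra) : 0 < e / 2) C1).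
  have hS : series (fun n => rdot (y (nf_l w' n)) (nf_r w' n)) N @[y --> F] -->
     series (fun n => rdot (x (nf_l w' n)) (nf_r w' n)) N.
    elim: N {HN} => [|N IH]; rewrite /series /=.
      by rewrite big_geq //; under eq_fun do rewrite big_geq //; exact: cvg_cst.
    rewrite big_nat_recr //=; under eq_fun do rewrite big_nat_recr //=.
    by apply: cvgD; [exact: IH|exact: hw].
  have /cvgrPdist_lt /(_ (e / 2) (ltac:(lra))) hS' := hS.
  apply: filterS2 FB hS' => y [by_ hy] hN.
  have [_ /(_ N) h1] := rnf_spec w' C0 hx; have [_ /(_ N) h2] := rnf_spec w' C0 hy.
  have := mulfVK (lt0r_neq0 C1) (e / 2); have := HN N (leqnn _); set q := _ / _ => h3 h4.
  move: h1 h2 hN; set a := rnf w' x; set b := rnf w' y; set s := series _ N; set s' := series _ N => h1 h2 hN.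
  have -> : a - b = (a - s) + (s - s') - (b - s') by ring.
  apply: le_lt_trans (ler_normB _ _) _; have := ler_normD (a - s) (s - s').
  by have := tail_ge0 w' N; nra.
by split; exact: main.
Qed.

Lemma single_summable H (z : H) : cvgn (series (fun n => `|if n == 0%N then z else 0| ^+ 2)).
Proof.
apply/cvg_ex; exists (`|z| ^+ 2 : R[i]); apply: cvg_near_cst.
exists 1%N => // -[//|n] _; rewrite /series /= big_nat_recl // big1 ?addr0 // => i _.
by rewrite normr0 expr0n.
Qed.

Definition vecf H (u v : H) : nfunctional H :=
  NFunctional (@single_summable _ u) (@single_summable _ v).

Lemma vecfE H (u v : H) (T : H -> H) : nf_app (vecf u v) T = dot H (T u) v.
Proof.
apply: (@cvg_lim (R[i] : numFieldType)) => //; apply: cvg_near_cst.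
exists 1%N => // -[//|n] _; rewrite /series /= big_nat_recl //= big1 ?addr0 // => i _.
by rewrite /= linear0r.
Qed.

End NormalFunctionals.

(** * Weak limits along ultrafilters, and projections onto closed subspaces *)

Section WeakLimits.
Variable R : realType.
Implicit Types H K E : hilbert R.

Lemma ultra_bounded_cvg (T : Type) (F : set_system T) (g : T -> R) M :
  UltraFilter F -> F [set t | `|g t| <= M] -> exists l : R, g t @[t --> F] --> l.
Proof.
move=> UF FM; have PF : ProperFilter F by exact: ultra_proper.
have FI : (g t @[t --> F]) `[(- M), M]%classic.
  by rewrite /=; apply: filterS FM => t /= ht; rewrite /= in_itv /= -ler_norml.
have [l [_ cl]] := @segment_compact R (- M) M _ _ FI.
exists l; apply/cvgrPdist_lt => e e0.
have [//|FC] := in_ultra_setVsetC [set t | `|l - g t| < e] UF.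
have [z [/= h1]] := cl [set x | ~ (`|l - x| < e)] (ball l e) FC (nbhsx_ballx l e e0).
by rewrite /ball /=.
Qed.

Lemma closed_projection H (W : set H) : W 0 ->
  (forall c u v, W u -> W v -> W (c *: u + v)) ->
  (forall x, (forall e, 0 < e -> exists2 y, W y & nm (x - y) < e) -> W x) ->
  exists Q, [/\ bop Q, adj Q = Q, forall x, W (Q x) & forall x, W x -> Q x = x].
Proof.
move=> W0 WL Wc.
pose G u v := W v /\ forall w, W w -> rdot (u - v) w = 0.
have Gex t : exists v, G t v.
  have [] := @hilbert_projection R 'I_1 (fun=> H) [set x | W (x ord0)] (fun=> t).
  - exact: W0.
  - by move=> r x y /= hx hy; rewrite addrC; exact: WL.
  move=> eta [h1 h2]; exists (t - eta ord0); split.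
    apply: Wc => e e0; have [x Wx /(_ ord0) h] := h1 e e0.
    by exists (x ord0) => //; rewrite addrAC.
  move=> w Ww; have := h2 (fun=> w) Ww.
  by rewrite big_ord1 opprB addrC subrK.
have [] := @bounded_extension R H H G 1 ler01.
- move=> c u v u' v' [Wv h] [Wv' h']; split; first exact: WL.
  move=> w Ww; rewrite opprD addrACA -scalerBr rdotDl h' // addr0.
  rewrite scaleE rdotDl !rdotZl h // mulr0 add0r rdotii h ?oppr0 ?mulr0 //.
  by rewrite -['i%C *: w]addr0; exact: WL.
- move=> u v [Wv h]; rewrite mul1r -(@ler_pXn2r _ 2%N) ?nnegrE ?nm_ge0 //.
  have := h v Wv; rewrite rdotBl -nm2E => e.
  have := sqr_ge0 (nm (u - v)); rewrite nm2B; lra.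
- apply/seteqP; split=> // t _; apply: subset_closure; exact: Gex.
move=> Q [bQ _ hQ]; have GQ x : G x (Q x) by have [v g] := Gex x; rewrite (hQ _ _ g).
exists Q; split=> //.
- apply: adj_uniq => // x y.
  have [Wx h1] := GQ x; have [Wy h2] := GQ y.
  have := h1 _ Wy; have := h2 _ Wx; rewrite !rdotBl [rdot (Q y) (Q x)]rdotC [rdot y _]rdotC; lra.
- by move=> x; case: (GQ x).
- move=> x Wx; apply: hQ; split=> // w _; by rewrite subrr rdot0l.
Qed.

(** Weak compactness of balls of operators: along an ultrafilter each bounded matrix coefficient
    converges, and the limit form is represented by an operator through [riesz]. *)
Lemma weak_limit H (T : Type) (F : set_system T) (g : T -> H -> H) M : 0 <= M ->
  UltraFilter F -> F [set t | bop (g t) /\ opb M (g t)] ->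
  exists x, [/\ bop x, opb M x & forall u v, rdot (g t u) v @[t --> F] --> rdot (x u) v].
Proof.
move=> M0 UF FM; have PF : ProperFilter F by exact: ultra_proper.
have /choice [l hl] : forall p : H * H, exists l : R, rdot (g t p.1) p.2 @[t --> F] --> l.
  move=> p; apply: (@ultra_bounded_cvg _ _ _ (M * nm p.1 * nm p.2)) => //.
  apply: filterS FM => t [_ h] /=; apply: le_trans (rdot_abs _ _) _.
  by apply: ler_wpM2r; [exact: nm_ge0|exact: h].
have uniq p a : rdot (g t p.1) p.2 @[t --> F] --> (a : R) -> l p = a.
  by move=> h; apply: cvg_unique (hl p) h => //; exact: norm_hausdorff.
have lb u v : `|l (u, v)| <= M * nm u * nm v.
  apply/ler_addgt0Pr => e e0; have /cvgrPdist_lt /(_ e e0) h := hl (u, v).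
  have [t [/= h1 [_ h2]]] := filter_ex (filterI h FM).
  have := rdot_abs (g t u) v; have := h2 u; have := nm_ge0 v.
  have := ler_normD (l (u, v) - rdot (g t u) v) (rdot (g t u) v); rewrite subrK; nra.
have /choice [x hx] : forall u, exists y, forall v, l (u, v) = rdot v y.
  move=> u; apply: (@riesz _ _ (fun v => l (u, v)) (M * nm u)).
  - move=> v w; apply: uniq => /=; under eq_fun do rewrite rdotDr.
    by apply: cvgD; exact: hl.
  - move=> r v; apply: uniq => /=; under eq_fun do rewrite rdotZr.
    by apply: cvgZr; exact: (hl (u, v)).
  - exact: lb.
have xB : opb M x.
  move=> u; have := nm_ge0 (x u); rewrite le_eqVlt => /orP[/eqP <-|y0].
    by rewrite mulr_ge0 ?nm_ge0.
  rewrite -(ler_pM2r y0) -expr2 nm2E -hx.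
  by apply: le_trans (ler_norm _) _; exact: lb.
have glin : F [set t | linear (g t)] by apply: filterS FM => t [[]].
have near (a b : T -> R) (c : R) : F [set t | a t = b t] -> b t @[t --> F] --> c -> a t @[t --> F] --> c.
  by move=> h; apply: cvg_trans; apply: near_eq_cvg; apply: filterS h => t ->.
have lx : linear x.
  apply: mklin => [u v|r u|u]; apply: rdot_inj => w; rewrite ?rdotDl ?rdotZl ![rdot _ w]rdotC -?hx.
  - apply: uniq => /=; apply: (near _ (fun t => rdot (g t u) w + rdot (g t v) w)).
      by apply: filterS glin => t h; rewrite /= (linopD h) rdotDl.
    by apply: cvgD; [exact: (hl (u, w))|exact: (hl (v, w))].
  - apply: uniq => /=; apply: (near _ (fun t => r * rdot (g t u) w)).
      by apply: filterS glin => t h; rewrite /= (linopZ h) rdotZl.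
    by apply: cvgZr; exact: (hl (u, w)).
  - rewrite rdotC rdotii [rdot (x u) _]rdotC -hx.
    apply: uniq => /=; apply: (near _ (fun t => - rdot (g t u) ('i%C *: w))).
      by apply: filterS glin => t h; rewrite /= (linopZ h) rdotii.
    by apply: cvgN; exact: (hl (u, 'i%C *: w)).
exists x; split=> //; first exact: mkbop lx xB.
by move=> u v; rewrite rdotC -hx; exact: (hl (u, v)).
Qed.

End WeakLimits.

(** * Intertwiners have total range *)

Section Intertwiners.
Variable R : realType.
Implicit Types H K E : hilbert R.

Lemma intertwiner_adj H0 H K (A : set (H0 -> H0)) th ka (S : H -> K) : cstar_algebra A ->
  star_hom A th -> star_hom A ka -> intertwiner A th ka S -> intertwiner A ka th (adj S).
Proof.
move=> cA sth ska [bS hS]; split; first exact: bop_adj.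
move=> a Aa; have Aa' := csa_adj cA Aa; have ba := csa_bop cA Aa.
have bta := shom_bop sth Aa'; have bka := shom_bop ska Aa'.
have := congr1 (@adj R _ _) (hS _ Aa').
rewrite (adj_comp bS bta) (adj_comp bka bS) -(shom_adj sth Aa') -(shom_adj ska Aa') adjK //.
Qed.

Lemma intertwiner_comp H0 H K E (A : set (H0 -> H0)) th ka la (S : H -> K) (T : K -> E) :
  intertwiner A th ka S -> intertwiner A ka la T -> intertwiner A th la (T \o S).
Proof.
move=> [bS hS] [bT hT]; split; first exact: bop_comp.
by move=> a Aa; rewrite -compA hS // compA hT // compA.
Qed.

Lemma id_star_hom H (A : set (H -> H)) : cstar_algebra A -> star_hom A id.
Proof. by move=> cA; split=> // x Ax; exact: csa_bop cA _ Ax. Qed.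

(* If [k] is orthogonal to the ranges of all intertwiners [S : K1 -> K2], the   *)
(* representations on [K1] and on the cyclic space of [k] are disjoint.         *)
Lemma kaplansky_disjoint K1 K2 (A : set (K1 -> K1)) (f : (K1 -> K1) -> K2 -> K2) (k : K2)
    (s : seq K1) (e : R) :
  cstar_algebra A -> star_rep A id -> star_rep A f ->
  (forall S, intertwiner A id f S -> adj S k = 0) -> 0 < e ->
  exists b, [/\ A b, adj b = b, opb 2 b, forall z, z \in s -> nm (b z) < e & nm (f b k - k) < e].
Proof.
move=> cA rid rf hk e0; have sid := srep_hom rid; have sf := srep_hom rf.
(* The orthogonal complement of all intertwiner ranges. Its projection Q satisfies Q S = 0 for S :
   K1 -> K2, S Q = 0 for S : K2 -> K1, and commutes with the self-intertwiners of K2. *)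
pose W : set K2 := [set w | forall S, intertwiner A id f S -> adj S w = 0].
have ladj S : intertwiner A id f S -> linear (adj S) by move=> [bS _]; apply/bop_lin/bop_adj.
have [] := @closed_projection R K2 W.
- by move=> S /ladj lS; rewrite (linop0 lS).
- by move=> c u v Wu Wv S iS; rewrite (ladj _ iS) Wu // Wv // scaler0 addr0.
- move=> x hx S iS; have [M M0 hM] := bop_bound (bop_adj iS.1).
  apply: (@nm_small _ _ _ M) => d d0; have [w Ww xw] := hx d d0.
  have -> : adj S x = adj S (x - w) by rewrite (linopB (ladj _ iS)) Ww // subr0.
  by apply: le_trans (hM _) _; rewrite mulrC ler_wpM2r // ltW.
move=> Q [bQ sQ WQ QW].
have QE x y : rdot (Q x) y = rdot x (Q y) by rewrite adjE // sQ.
have QS S : intertwiner A id f S -> Q \o S = 0.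
  move=> iS; apply/funext => v; apply: rdot_nondeg => w /=.
  by rewrite QE adjE ?(WQ w) ?rdot0r //; exact: iS.1.
have SQ S : intertwiner A f id S -> S \o Q = 0.
  move=> iS; apply/funext => v /=; rewrite -(adjK iS.1) WQ //.
  exact: (intertwiner_adj cA sf sid).
have QSQ S : intertwiner A f f S -> Q \o (S \o Q) = S \o Q.
  move=> iS; apply/funext => v /=; apply: QW => T iT.
  have iS' := intertwiner_adj cA sf sf iS.
  have := WQ v _ (intertwiner_comp iT iS').
  by rewrite (adj_comp iS'.1 iT.1) (adjK iS.1).
have SQQ S : intertwiner A f f S -> S \o Q = Q \o S.
  move=> iS; rewrite -(QSQ _ iS); have iS' := intertwiner_adj cA sf sf iS.
  have := congr1 (@adj R _ _) (QSQ _ iS').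
  rewrite (adj_comp bQ (bop_comp iS'.1 bQ)) (adj_comp iS'.1 bQ) (adjK iS.1) sQ.
  by rewrite -compA => ->.
(* One copy of K1 for each vector of [s] and a single copy of K2; the family y is 0 on the former
   and Q on the latter. *)
pose J := option 'I_(size s).
pose H (j : J) : hilbert R := if j is Some _ then K1 else K2.
pose th (j : J) : (K1 -> K1) -> H j -> H j := match j with Some _ => id | None => f end.
pose y (j : J) : H j -> H j := match j with Some _ => 0 | None => Q end.
pose ze (j : J) : H j := match j with Some i => nth 0 s i | None => k end.
have rep j : star_rep A (th j) by case: j.
have by_ j : bop (y j) by case: j => // ?; exact: bop0.
have sy j : adj (y j) = y j by case: j => // ?; exact: adj0.
have yS i j (S : H i -> H j) : intertwiner A (th i) (th j) S -> S \o y i = y j \o S.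
  case: i j S => [i|] [j|] S iS /=.
  - by apply/funext => v /=; rewrite (linop0 (bop_lin iS.1)).
  - rewrite QS //; apply/funext => v /=; exact: (linop0 (bop_lin iS.1)).
  - exact: SQ.
  - exact: SQQ.
(* 0 and the projection Q are fixed by t |-> 2t/(1+t^2), so x = y can be used in [kaplansky]. *)
have hy j : y j + (y j \o (y j \o y j)) = y j + y j.
  case: j => [i|]; rewrite /y; last by congr (_ + _); apply/funext => v /=; rewrite !(QW (Q _)).
  by congr (_ + _).
have [b [Ab sb hb he]] := @kaplansky R K1 A cA _ H th rep y by_ sy yS y ze e e0 hy.
have Wk : Q k = k by exact: QW.
exists b; split=> //.
  move=> z zs; have iz : (index z s < size s)%N by rewrite index_mem.
  by have := he (Some (Ordinal iz)); rewrite /th /y /ze /= nth_index // => h; rewrite -[b z]subr0; exact: h.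
by have := he None; rewrite /th /y /ze /= Wk.
Qed.

Variable tens : forall H K : hilbert R, htensor H K.
Variable G : lcqg tens.
Local Notation L2 := (qg_L2 G).
Local Notation C0 := (@qg_C0 R tens G).

(** A vector k orthogonal to all ranges would be seen by elements b that tend to 0 on K1. Strictness
    of D1 sends D1 b to 0 on the Hilbert module, the slice identity transports this to D2 (f b), and
    injectivity of D2 contradicts f b k -> k unless k = 0. With equivariance stated through slices,
    the lemma serves for pi and for its inverse alike. *)
Lemma intertwiners_total K1 K2 (A1 N1 : set (K1 -> K1)) (A2 N2 : set (K2 -> K2))
    (D1 : (K1 -> K1) -> tens L2 K1 -> tens L2 K1)
    (D2 : (K2 -> K2) -> tens L2 K2 -> tens L2 K2) f :
  cstar_algebra A1 -> Defs.nondegenerate A1 -> Defs.nondegenerate A2 ->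
  star_hom A1 f -> (forall a, A1 a -> A2 (f a)) -> (forall a, A2 a -> exists2 a', A1 a' & f a' = a) ->
  A1 `<=` N1 -> A2 `<=` N2 -> von_neumann_algebra N1 -> von_neumann_algebra N2 ->
  star_hom N1 D1 -> star_hom N2 D2 -> set_inj N2 D2 -> normal_map N2 D2 ->
  strict_map (G := G) N1 A1 D1 ->
  (forall b a c h h0, A1 b -> A1 a -> C0 c -> A1 (slc (c h) h0 (D1 b) \o a) /\
    f (slc (c h) h0 (D1 b) \o a) = slc (c h) h0 (D2 (f b)) \o f a) ->
  total_set [set v | exists S xi, intertwiner A1 id f S /\ v = S xi].
Proof.
move=> cA n1 n2 sf fA fsurj AN1 AN2 v1 v2 sD1 sD2 injD2 nD2 str star.
have cN1 := vna_cstar v1; have cN2 := vna_cstar v2.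
have rid : star_rep A1 id.
  by split; [exact: id_star_hom|exact: n1].
have tf : total_set [set v | exists a h, A1 a /\ v = f a h].
  have := n2; rewrite /Defs.nondegenerate /total_set; congr (closure (lspan _) = _).
  apply/seteqP; split=> [_ [a [h [Aa ->]]]|_ [a [h [Aa ->]]]].
    by have [a' Aa' <-] := fsurj _ Aa; exists a', h.
  by exists (f a), h; split=> //; exact: fA.
have rf : star_rep A1 f by split.
apply: orth_total => k hk0.
have hk S : intertwiner A1 id f S -> adj S k = 0.
  move=> iS; apply: dot_inj => z; rewrite linear0r -(adj_spec iS.1).2.
  by apply: hk0; exists S, z.
(* The filter base plays the role of a net indexed by finite sets of vectors and tolerances;
   [kaplansky_disjoint] makes its members nonempty. Self-adjointness of b turns strong into *-strong
   convergence. *)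
pose B (p : seq K1 * R) := [set b | [/\ A1 b, adj b = b, opb 2 b,
  forall z, z \in p.1 -> nm (b z) < p.2 & nm (f b k - k) < p.2]].
pose F := filter_from [set p : seq K1 * R | 0 < p.2] B.
have FF : Filter F.
  apply: filter_from_filter; first by exists ([::], 1) => /=.
  move=> [s e] [s' e'] /= e0 e0'; exists (s ++ s', Num.min e e') => /=.
    by rewrite lt_min e0.
  move=> b [Ab sb hb h1]; rewrite lt_min => /andP[h2 h3].
  split; split=> //= z zs.
    by have := h1 z; rewrite mem_cat zs lt_min => /(_ isT) /andP[].
  by have := h1 z; rewrite mem_cat zs orbT lt_min => /(_ isT) /andP[].
have PF : ProperFilter F.
  apply: filter_from_proper => -[s e] /= e0.
  have [b [Ab sb hb h1 h2]] := kaplansky_disjoint s cA rid rf hk e0.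
  by exists b.
have FB p : 0 < p.2 -> F (B p) by move=> p0; exists p.
have F1 := FB ([::], 1) ltr01.
have FA : F A1 by apply: filterS F1 => b [].
have D10 : D1 0 = 0 by exact: (star_hom0 cN1 sD1).
have strF (h : L2) a e : A1 a -> 0 < e ->
    F [set b | forall v, nm (D1 b (pure (tens L2 K1) h (a v))) <= e * nm v].
  move=> Aa e0.
  have hm : hilbert_module (G := G) A1 (fun v => pure (tens L2 K1) h (a v)).
    apply: op_closure_sub; last by apply: lspan_sub; exists h, a.
    apply: lspan_bop => _ [h' [a' [Aa' ->]]].
    exact: (bop_comp (bop_rop tens K1 h') (csa_bop cA Aa')).
  have N10 : N1 0 by exact: (csa0 cN1).
  have e0' : (0 : R[i]) < e%:C by rewrite ltcR.
  have [||||p p0 hp] := @str F 0 (2%:C) PF _ N10 _ _ _ _ hm _ e0'.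
  - by apply: filterS FA; exact: AN1.
  - apply: filterS F1 => b [_ _ hb _ _] v; rewrite !normE -rmorphM lecR; exact: hb.
  - move=> v; apply/cvg_nm => d d0; apply: filterS (FB ([:: v], d) d0) => b [_ _ _ hb _].
    by rewrite subr0; apply: hb; rewrite inE.
  - move=> v; rewrite adj0; apply/cvg_nm => d d0; apply: filterS (FB ([:: v], d) d0) => b [_ sb _ hb _].
    by rewrite subr0 sb; apply: hb; rewrite inE.
  exists p => // b /hp [h1 _] v.
  by have := h1 v; rewrite D10 subr0 !normE -rmorphM lecR.
(* A finer ultrafilter gives the bounded operators f b a weak limit x, which stays in N2. *)
have [U [UU FU]] := ultraFilterLemma PF.
have PU : ProperFilter U by exact: ultra_proper.
have bf b : A1 b -> bop (f b) by exact: shom_bop.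
have [x [bx hx wx]] : exists x, [/\ bop x, opb 2 x &
    forall u v, rdot (f b u) v @[b --> U] --> rdot (x u) v].
  apply: weak_limit => //; apply: FU; apply: filterS F1 => b [Ab _ hb _ _]; split; first exact: bf.
  exact: (star_hom_contractive cA sf Ab _ hb).
have uniqR (g : (K1 -> K1) -> R) (a c : R) : g b @[b --> U] --> a -> g b @[b --> U] --> c -> a = c.
  by move=> h1 h2; apply: cvg_unique h1 h2 => //; exact: norm_hausdorff.
have near (a b : (K1 -> K1) -> R) (c : R) : U [set t | a t = b t] -> b t @[t --> U] --> c -> a t @[t --> U] --> c.
  by move=> h; apply: cvg_trans; apply: near_eq_cvg; apply: filterS h => t ->.
have Nx : N2 x.
  rewrite -(vna_bicommutant v2); split=> // t ct; have bt := ct.1.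
  apply/funext => u; apply: rdot_inj => v /=; rewrite [RHS]adjE //.
  apply: (uniqR _ _ _ (wx (t u) v)); apply: (near _ (fun b => rdot (f b u) (adj t v))); last exact: wx.
  apply: FU; apply: filterS FA => b Ab /=; rewrite -adjE //.
  by have /= -> := congr1 (fun T => T u) (ct.2 _ (AN2 _ (fA _ Ab))).
have sw : sw_cvg (f b @[b --> U]) x.
  apply: (@bounded_weak_sw _ _ _ _ 2) => //.
  apply: FU; apply: filterS F1 => b [Ab _ hb _ _]; split; first exact: bf.
  exact: (star_hom_contractive cA sf Ab _ hb).
have UN2 : (f b @[b --> U]) N2 by apply: FU; apply: filterS FA => b Ab; apply/AN2/fA.
(* Normality of D2 makes D2 x the weak limit of D2 (f b). At the total vectors c h (x) f(a) v, its
   coefficients are those of f applied to slices of D1 b, which are small in norm by [strF] since f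
   is contractive. *)
have D2x : D2 x = 0.
  have bD := shom_bop sD2 Nx.
  have tt := total_pure tens (qg_C0_nondegenerate G) tf.
  apply: (total_eq tt) => //; first exact: bop0.
  move=> _ [_ [_ [[c [h [Cc ->]]] [a [v [Aa ->]]] ->]]].
  set u := pure _ _ _.
  have r0 h0 v' : rdot (D2 x u) (pure (tens L2 K2) h0 v') = 0.
    set w := pure _ h0 v'.
    have := nD2 (f b @[b --> U]) x _ UN2 Nx sw (vecf u w).
    move=> /(_ _) /cvg_ReIm [hre _]; rewrite vecfE in hre.
    have hre' : rdot (D2 (f b) u) w @[b --> U] --> rdot (D2 x u) w.
      by apply: cvg_trans hre; apply: near_eq_cvg; near=> b; rewrite vecfE.
    apply: (uniqR _ _ _ hre'); apply/cvgrPdist_lt => e e0.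
    pose m := nm h0 * nm v * nm v'.
    have m0 : 0 <= m by rewrite !mulr_ge0 ?nm_ge0.
    have m1 : 0 < m + 1 by lra.
    apply: FU; apply: filterS2 FA (strF (c h) a (e / (m + 1)) Aa (divr_gt0 e0 m1)) => b Ab hb.
    rewrite sub0r normrN.
    have [As fs] := star b a c h h0 Ab Aa Cc.
    have -> : rdot (D2 (f b) u) w = rdot (f (slc (c h) h0 (D1 b) \o a) v) v'.
      by rewrite fs /rdot /= slc_dot.
    apply: le_lt_trans (rdot_abs _ _) _.
    have q0 : 0 < e / (m + 1) by rewrite divr_gt0.
    have hs : opb (nm h0 * (e / (m + 1))) (slc (c h) h0 (D1 b) \o a).
      move=> z; rewrite /slc /= -mulrA.
      apply: le_trans (opb_adj (bop_rop tens K1 h0) (nm_ge0 h0) (opb_rop tens h0) _) _.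
      by apply: ler_wpM2l; [exact: nm_ge0|exact: hb].
    have := star_hom_contractive cA sf As (mulr_ge0 (nm_ge0 h0) (ltW q0)) hs v.
    have := mulfVK (lt0r_neq0 m1) e; move: q0; set q := e / _ => q0 <- hv.
    apply: (@le_lt_trans _ _ (q * m)); last by rewrite ltr_pM2l // ltrDl.
    apply: le_trans (ler_wpM2r (nm_ge0 v') hv) _.
    by rewrite /m le_eqVlt; apply/orP; left; apply/eqP; ring.
  apply: (total_orth (pure_total (tens L2 K2))) => _ [h0 [v' ->]].
  rewrite dotC dotE r0.
  have -> : 'i%C *: pure (tens L2 K2) h0 v' = pure (tens L2 K2) h0 ('i%C *: v').
    by rewrite linearZr.
  by rewrite r0; apply/eqP; rewrite eq_complex /= oppr0 !eqxx.
have x0 : x = 0.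
  apply: injD2; [by rewrite inE|by rewrite inE; exact: (csa0 cN2)|].
  by rewrite D2x (star_hom0 cN2 sD2).
(* <f b k, k> tends to |k|^2 by construction of the filter, and to <x k, k> = 0. *)
apply: nm_eq0; apply/eqP; rewrite -sqrf_eq0 nm2E.
apply/eqP; apply: (uniqR (fun b => rdot (f b k) k)); last first.
  by have := wx k k; rewrite x0 rdot0l.
apply/cvgrPdist_lt => e e0; have k1 : 0 < nm k + 1 by have := nm_ge0 k; lra.
apply: FU; apply: filterS (FB ([::], e / (nm k + 1)) (divr_gt0 e0 k1)) => b [_ _ _ _ /= h].
rewrite -rdotBl; apply: le_lt_trans (rdot_abs _ _) _; rewrite nmBC.
have := mulfVK (lt0r_neq0 k1) e; move: h; set q := e / _ => h <-.
by have := nm_ge0 k; have := nm_ge0 (f b k - k); nra.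
Unshelve. all: by end_near.
Qed.

End Intertwiners.

(** * Extension to the von Neumann algebra *)

Section Extension.
Variables (R : realType) (K1 K2 : hilbert R).
Variables (A1 N1 : set (K1 -> K1)) (f : (K1 -> K1) -> K2 -> K2).
Hypothesis cA1 : cstar_algebra A1.
Hypothesis v1 : von_neumann_algebra N1.
Hypothesis AN1 : A1 `<=` N1.
Hypothesis dense1 : N1 `<=` closure (A1 : set {ptws K1 -> K1}).
Hypothesis sf : star_hom A1 f.

Local Notation IS := (intertwiner A1 id f).
Hypothesis tot : total_set [set v | exists S xi, IS S /\ v = S xi].

Lemma commute_dense t x : bop t -> (forall a, A1 a -> t \o a = a \o t) -> N1 x ->
  t \o x = x \o t.
Proof.
move=> bt ct Nx; apply/funext => v /=; apply/subr0_eq.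
have [M M0 hM] := bop_bound bt.
apply: (@nm_small _ _ _ (M + 1)) => e e0.
have cl := dense1 Nx.
have nb (u : K1) : nbhs (x : {ptws K1 -> K1}) [set a : {ptws K1 -> K1} | nm (x u - a u) < e].
  have : {for x, continuous (fun g : {ptws K1 -> K1} => g u)}.
    exact: (@proj_continuous _ (fun=> K1 : topologicalType) u).
  move=> h; apply: (h [set y | nm (x u - y) < e]); apply/nbhs_ballP.
  exists (e%:C) => /=; first by rewrite ltcR.
  by move=> a; rewrite -ball_normE /= normE ltcR.
have [a [Aa [/= h1 h2]]] := cl _ (filterI (nb v) (nb (t v))).
have /= e1 := congr1 (fun T => T v) (ct _ Aa).
have -> : t (x v) - x (t v) = t (x v - a v) - (x (t v) - a (t v)).
  by rewrite (linopB (bop_lin bt)) e1 opprB addrA subrK.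
apply: le_trans (nmB _ _) _; have := hM (x v - a v); nra.
Qed.

Lemma intertwiners_commute S T x : IS S -> IS T -> N1 x ->
  adj T \o S \o x = x \o (adj T \o S).
Proof.
move=> iS iT Nx; have iT' := intertwiner_adj cA1 (id_star_hom cA1) sf iT.
have [b h] := intertwiner_comp iS iT'.
exact: commute_dense.
Qed.

(** Totality of the ranges leaves at most one such X; for x in N1 one exists by
    [column_extension]. *)
Definition vn_extension (x : K1 -> K1) : K2 -> K2 :=
  xget 0 [set X | bop X /\ forall S, IS S -> X \o S = S \o x].
Local Notation rho := vn_extension.

Lemma vn_extension_spec x : N1 x -> bop (rho x) /\ forall S, IS S -> rho x \o S = S \o x.
Proof.
move=> Nx; rewrite /rho; apply: (@xgetPex _ _ [set X | bop X /\ _]).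
have bIS : IS `<=` @bop R K1 K2 by move=> S [].
have [X [bX hX _]] := column_extension (vna_cstar v1) Nx bIS tot
  (fun S T y iS iT Ny => intertwiners_commute iS iT Ny).
by exists X.
Qed.

Lemma bop_vn_extension x : N1 x -> bop (rho x).
Proof. by move=> /vn_extension_spec[]. Qed.

Lemma vn_extensionE x S v : N1 x -> IS S -> rho x (S v) = S (x v).
Proof. by move=> /vn_extension_spec[_ h] /h e; have := congr1 (fun T => T v) e. Qed.

Lemma vn_extension_uniq x X : N1 x -> bop X -> (forall S v, IS S -> X (S v) = S (x v)) -> rho x = X.
Proof.
move=> Nx bX hX; apply: (total_eq tot) => //; first exact: bop_vn_extension.
by move=> _ [S [xi [iS ->]]]; rewrite vn_extensionE // hX.
Qed.

(** On v = T xi this is the commutation of x with adj(S) T. Going back from K2 to K1, it gives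
    compatibility of rho with adjoints and the inverse of rho. *)
Lemma adj_vn_extension x S v : N1 x -> IS S -> adj S (rho x v) = x (adj S v).
Proof.
move=> Nx iS; have bx := vna_bop v1 Nx; have bS := bop_adj iS.1.
have bl : bop (adj S \o rho x) by apply: bop_comp => //; exact: bop_vn_extension.
have br : bop (x \o adj S) by exact: bop_comp.
suff e : adj S \o rho x = x \o adj S by have := congr1 (fun T => T v) e.
apply: (total_eq tot) => // _ [T [xi [iT ->]]] /=.
rewrite vn_extensionE //.
by have := congr1 (fun Y => Y xi) (intertwiners_commute iT iS Nx).
Qed.

Lemma vn_extension_hom : star_hom N1 rho.
Proof.
have cN1 := vna_cstar v1; split.
- exact: bop_vn_extension.
- move=> c x y Nx Ny; have bx := bop_vn_extension Nx; have by_ := bop_vn_extension Ny.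
  apply: vn_extension_uniq; [by apply: csaD => //; exact: csaZ|by apply: bopD => //; exact: bopZ|].
  by move=> S v iS; rewrite !fctE !vn_extensionE // (bop_lin iS.1).
- move=> x y Nx Ny; have bx := bop_vn_extension Nx; have by_ := bop_vn_extension Ny.
  apply: vn_extension_uniq; [exact: csa_mul|exact: bop_comp|].
  by move=> S v iS; rewrite /= !vn_extensionE.
- move=> x Nx; have bx := bop_vn_extension Nx.
  apply: vn_extension_uniq; [exact: csa_adj|exact: bop_adj|].
  move=> S v iS; apply: rdot_inj => w; rewrite adjEr //.
  rewrite (adjE v _ iS.1) (adj_vn_extension _ Nx iS) -(adjEr _ _ (vna_bop v1 Nx)).
  by rewrite (adjE _ w iS.1).
Qed.

Lemma vn_extension_id : N1 id -> rho id = id.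
Proof. by move=> N1id; apply: vn_extension_uniq => //; exact: bop_id. Qed.

Lemma vn_extension_agrees a : A1 a -> rho a = f a.
Proof.
move=> Aa; apply: vn_extension_uniq; [exact: AN1|exact: shom_bop sf _ Aa|].
by move=> S v iS; have := congr1 (fun T => T v) (iS.2 a Aa).
Qed.

(** If t commutes with N2 and S is an intertwiner, so is t S; hence rho x commutes with t on every
    range, and the bicommutant theorem applies. *)
Lemma vn_extension_range (N2 : set (K2 -> K2)) : von_neumann_algebra N2 ->
  (forall a, A1 a -> N2 (f a)) -> forall x, N1 x -> N2 (rho x).
Proof.
move=> v2 fN x Nx; rewrite -(vna_bicommutant v2); have bx := bop_vn_extension Nx.
split=> // t [bt ct]; apply: (total_eq tot); [exact: bop_comp|exact: bop_comp|].
move=> _ [S [xi [iS ->]]] /=.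
have iS' : IS (t \o S).
  split; first exact: bop_comp iS.1.
  move=> a Aa; apply/funext => v /=.
  have /= -> := congr1 (fun T => T v) (iS.2 a Aa).
  by have /= -> := congr1 (fun T => T (S v)) (ct _ (fN _ Aa)).
by rewrite -/((t \o S) xi) vn_extensionE // vn_extensionE.
Qed.

End Extension.

(** * The extension of the inverse *)

Section Inverse.
Variables (R : realType) (K1 K2 : hilbert R).
Variables (A1 N1 : set (K1 -> K1)) (f : (K1 -> K1) -> K2 -> K2).
Variables (A2 N2 : set (K2 -> K2)) (g : (K2 -> K2) -> K1 -> K1).
Hypotheses (cA1 : cstar_algebra A1) (cA2 : cstar_algebra A2).
Hypotheses (v1 : von_neumann_algebra N1) (v2 : von_neumann_algebra N2).
Hypotheses (AN1 : A1 `<=` N1) (AN2 : A2 `<=` N2).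
Hypothesis dense1 : N1 `<=` closure (A1 : set {ptws K1 -> K1}).
Hypothesis dense2 : N2 `<=` closure (A2 : set {ptws K2 -> K2}).
Hypotheses (sf : star_hom A1 f) (sg : star_hom A2 g).
Hypotheses (fA : forall a, A1 a -> A2 (f a)) (gA : forall a, A2 a -> A1 (g a)).
Hypotheses (gf : forall a, A1 a -> g (f a) = a).
Hypothesis tot1 : total_set [set v | exists S xi, intertwiner A1 id f S /\ v = S xi].
Hypothesis tot2 : total_set [set v | exists S xi, intertwiner A2 id g S /\ v = S xi].

(** Adjoints of intertwiners for g are intertwiners for f, so [adj_vn_extension] shows that x
    satisfies the relation defining the extension of g at rho x. *)
Lemma vn_extensionK x : N1 x -> vn_extension A2 g (vn_extension A1 f x) = x.
Proof.
move=> Nx; have Nr : N2 (vn_extension A1 f x).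
  by apply: (vn_extension_range cA1 v1 dense1 sf tot1 v2) => // a Aa; apply/AN2/fA.
apply: (vn_extension_uniq cA2 v2 dense2 sg tot2 Nr); first exact: vna_bop v1 _ Nx.
move=> T v iT; have iS := intertwiner_adj cA2 (id_star_hom cA2) sg iT.
have iS' : intertwiner A1 id f (adj T).
  split; first exact: iS.1.
  by move=> a Aa; have := iS.2 _ (fA Aa); rewrite gf.
by have := adj_vn_extension cA1 v1 dense1 sf tot1 v Nx iS'; rewrite (adjK iT.1).
Qed.

End Inverse.

(** * Normality *)

Section DoubleSeries.
Variable R : realType.

Lemma nonneg_series_cvg (u : nat -> R) M : (forall n, 0 <= u n) ->
  (forall n, series u n <= M) -> cvgn (series u) /\ limn (series u) <= M.
Proof.
move=> u0 uM.
have c : cvgn (series u).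
  apply: nondecreasing_is_cvgn; first by apply: nondecreasing_series.
  by exists M => _ [n _ <-].
by split=> //; apply: limr_le => //; exact: nearW.
Qed.

Lemma series_EFin (u : nat -> R) (l : R) : (forall n, 0 <= u n) ->
  (series u @ \oo --> l) <-> (\sum_(n <oo) (u n)%:E = l%:E)%E.
Proof.
move=> u0.
have fwd m : series u @ \oo --> m -> (\sum_(n <oo) (u n)%:E = m%:E)%E.
  move=> h; apply/cvg_lim => //.
  have -> : (fun n => \sum_(0 <= i < n) (u i)%:E)%E = EFin \o series u.
    by apply/funext => n; rewrite /series /= sumEFin.
  by apply: cvg_EFin; [exact: nearW|exact: h].
split=> [/fwd //|h].
have [|c _] := @nonneg_series_cvg u l u0.
  move=> n; rewrite -lee_fin -h /series /= -sumEFin.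
  by apply: nneseries_lim_ge => k _ _; rewrite lee_fin.
have := fwd _ c; rewrite h => -[->]; exact: c.
Qed.

Lemma nonneg_double_series (b : nat -> nat -> R) (B : nat -> R) (S : R) (e : nat -> nat * nat) :
  set_bij [set: nat] [set: nat * nat] e -> (forall n j, 0 <= b n j) ->
  (forall n, series (b n) @ \oo --> B n) -> series B @ \oo --> S ->
  series (fun q => b (e q).1 (e q).2) @ \oo --> S.
Proof.
move=> be b0 hB hS.
have B0 n : 0 <= B n.
  have := cvg_lim (@Rhausdorff R) (hB n) => <-; apply: limr_ge; first by apply/cvg_ex; exists (B n).
  by apply: nearW => m; apply: sumr_ge0.
apply/series_EFin => //; rewrite -((series_EFin S B0).1 hS).
rewrite nneseries_esumT; last by move=> n; rewrite lee_fin.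
rewrite nneseries_esumT; last by move=> n; rewrite lee_fin.
rewrite -(@reindex_esum R _ _ setT setT e (fun p => (b p.1 p.2)%:E)) //.
transitivity (\esum_(i in [set: nat]) \esum_(j in [set: nat]) (b i j)%:E)%E.
  rewrite esum_esum; last by move=> i j _ _; rewrite lee_fin.
  by congr esum; apply/seteqP; split.
apply: eq_esum => n _; rewrite -nneseries_esumT; last by move=> j; rewrite lee_fin.
exact/(series_EFin _ (b0 n)).
Qed.

Lemma nat_pairing : exists e : nat -> nat * nat, set_bij [set: nat] [set: nat * nat] e.
Proof. by apply/card_set_bijP; rewrite card_eq_sym; exact: card_nat2. Qed.

(** Fubini for absolutely convergent double series: t = (t + a) - a is a difference of nonnegative
    families. *)
Lemma double_series (t a : nat -> nat -> R) (T A : nat -> R) (S s : R) (e : nat -> nat * nat) :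
  set_bij [set: nat] [set: nat * nat] e -> (forall n j, `|t n j| <= a n j) ->
  (forall n, series (a n) @ \oo --> A n) -> series A @ \oo --> S ->
  (forall n, series (t n) @ \oo --> T n) -> series T @ \oo --> s ->
  series (fun q => t (e q).1 (e q).2) @ \oo --> s.
Proof.
move=> be ta hA hS hT hs.
have a0 n j : 0 <= a n j by exact: le_trans (normr_ge0 _) (ta n j).
have seriesD (u v : nat -> R) (l m : R) : series u @ \oo --> l -> series v @ \oo --> m ->
    series (fun n => u n + v n) @ \oo --> l + m.
  move=> hu hv; have -> : series (fun n => u n + v n) = series u \+ series v.
    by apply/funext => n; rewrite /series /= big_split.
  exact: cvgD.
have h1 := nonneg_double_series be a0 hA hS.
have h2 : series (fun q => t (e q).1 (e q).2 + a (e q).1 (e q).2) @ \oo --> s + S.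
  apply: (@nonneg_double_series (fun n j => t n j + a n j) (fun n => T n + A n) (s + S) e be).
  - by move=> n j; have := ta n j; rewrite ler_norml => /andP[]; lra.
  - by move=> n; exact: seriesD.
  - exact: seriesD.
have -> : series (fun q => t (e q).1 (e q).2) =
    series (fun q => t (e q).1 (e q).2 + a (e q).1 (e q).2) \- series (fun q => a (e q).1 (e q).2).
  apply/funext => n; rewrite /series /= -sumrB.
  by apply: eq_bigr => i _; rewrite addrK.
by rewrite -[X in _ --> X](addrK S); exact: cvgB.
Qed.

End DoubleSeries.

Section Normality.
Variables (R : realType) (K1 K2 : hilbert R).
Variables (A1 N1 : set (K1 -> K1)) (f : (K1 -> K1) -> K2 -> K2).
Hypothesis cA1 : cstar_algebra A1.
Hypothesis v1 : von_neumann_algebra N1.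
Hypothesis AN1 : A1 `<=` N1.
Hypothesis dense1 : N1 `<=` closure (A1 : set {ptws K1 -> K1}).
Hypothesis sf : star_hom A1 f.

Local Notation IS := (intertwiner A1 id f).
Hypothesis tot : total_set [set v | exists S xi, IS S /\ v = S xi].

(** The supremum over contractive intertwiners need not be attained, so half of it is accepted; when
    it is 0, S = 0 does. *)
Lemma near_best_contraction (z : K2) : exists S, [/\ IS S, opb 1 S &
  forall T, IS T -> opb 1 T -> nm (adj T z) ^+ 2 <= 2 * nm (adj S z) ^+ 2].
Proof.
pose V : set R := [set r | exists S, [/\ IS S, opb 1 S & r = nm (adj S z) ^+ 2]].
have IS0 : IS 0.
  split; first exact: bop0.
  by move=> a Aa; apply/funext => v /=; rewrite (linop0 (bop_lin (shom_bop sf Aa))).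
have V0 : V 0.
  by exists 0; split=> //; [exact: opb0|rewrite adj0 nm0 expr0n].
have ubV : has_sup V.
  split; first by exists 0.
  exists (nm z ^+ 2) => _ [S [iS hS ->]].
  rewrite ler_pXn2r ?nnegrE ?nm_ge0 //.
  by have := opb_adj iS.1 ler01 hS z; rewrite mul1r.
have [s0|s0] := leP (sup V) 0.
  exists 0; split=> // [|T iT hT]; first exact: opb0.
  rewrite adj0 nm0 expr0n mulr0; apply: le_trans s0.
  by apply: sup_upper_bound => //; exists T.
have [_ [S [iS hS ->]] h] := sup_adherent (ltac:(lra) : 0 < sup V / 2) ubV.
exists S; split=> // T iT hT.
have : nm (adj T z) ^+ 2 <= sup V by apply: sup_upper_bound => //; exists T.
lra.
Qed.

Definition best (z : K2) : K1 -> K2 := projT1 (cid (near_best_contraction z)).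

Lemma bestP z : [/\ IS (best z), opb 1 (best z) &
  forall T, IS T -> opb 1 T -> nm (adj T z) ^+ 2 <= 2 * nm (adj (best z) z) ^+ 2].
Proof. by rewrite /best; case: cid. Qed.

(* [rest k j] is [1 - \sum_(i < j) row k i \o adj (row k i)]; each [row k j] is   *)
(* chosen to remove, up to a factor, as much of [k] as an intertwiner can.        *)
Fixpoint rest (k : K2) (j : nat) : K2 -> K2 :=
  if j is j'.+1 then
    rest k j' - (rest k j' \o (best (rest k j' k) \o (adj (best (rest k j' k)) \o rest k j')))
  else id.

Definition row (k : K2) (j : nat) : K1 -> K2 := rest k j \o best (rest k j k).

Definition positive_contraction (E : K2 -> K2) :=
  [/\ intertwiner A1 f f E, adj E = E & forall v, 0 <= rdot (E v) v <= nm v ^+ 2].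

Lemma positive_contraction_sq E v : positive_contraction E -> nm (E v) ^+ 2 <= rdot (E v) v.
Proof.
move=> [[bE _] sE hE]; have [/andP[p1 _] /andP[_ p2]] := (hE (v - E v), hE (E v)).
have s x y : rdot (E x) y = rdot x (E y) by rewrite adjE // sE.
move: p1; rewrite (linopB (bop_lin bE)) !rdotBl !rdotBr.
rewrite [rdot (E (E v)) v]s -!nm2E; lra.
Qed.

(** With E = [rest k j] and S the chosen contraction, the next operator E - E S adj(S) E is at least
    E - E^2, which is nonnegative by [positive_contraction_sq]. Self-adjointness of E identifies the
    subtracted term with [row k j \o adj (row k j)]. *)
Lemma rest_row k j v : rest k j.+1 v = rest k j v - row k j (adj (row k j) v) /\
  positive_contraction (rest k j).
Proof.
suff P : positive_contraction (rest k j).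
  split=> //; have [[bE _] sE _] := P; have [[bS _] _ _] := bestP (rest k j k).
  by rewrite /row (adj_comp bE bS) sE /= fctE.
elim: j => [|j IH].
  split; [split=> //; exact: bop_id|exact: adj_id|].
  by move=> w; rewrite -nm2E sqr_ge0 lexx.
have [iE sE hE] := IH; have bE := iE.1; set E := rest k j in IH iE sE hE bE *.
have [iS hS _] := bestP (E k); set S := best (E k) in iS hS *; have bS := iS.1.
have -> : rest k j.+1 = E - (E \o (S \o (adj S \o E))) by [].
have iS' := intertwiner_adj cA1 (id_star_hom cA1) sf iS.
have iX := intertwiner_comp (intertwiner_comp (intertwiner_comp iE iS') iS) iE.
set X := E \o _.
have bX : bop X := iX.1.
have sX : adj X = X.
  have bSE := bop_comp (bop_adj bS) bE.
  by rewrite /X (adj_comp bE (bop_comp bS bSE)) (adj_comp bS bSE) (adj_comp (bop_adj bS) bE) sE (adjK bS).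
split.
- split; first exact: bopB.
  move=> a Aa; apply/funext => w; have lf := bop_lin (shom_bop sf Aa).
  have /= e1 := congr1 (fun T => T w) (iE.2 a Aa).
  have /= e2 := congr1 (fun T => T w) (iX.2 a Aa).
  by rewrite /= !fctE (linopB lf) e1 -e2.
- by rewrite (adjB bE bX) sE sX.
- move=> w; rewrite fctE rdotBl.
  have -> : rdot (X w) w = nm (adj S (E w)) ^+ 2.
    by rewrite /X /= (adjE _ _ bE) sE (adjE _ _ bS) nm2E.
  have h1 := positive_contraction_sq w IH.
  have h2 : nm (adj S (E w)) ^+ 2 <= nm (E w) ^+ 2.
    rewrite ler_pXn2r ?nnegrE ?nm_ge0 //.
    by have := opb_adj bS ler01 hS (E w); rewrite mul1r.
  have := hE w => /andP[h3 h4]; have := sqr_ge0 (nm (adj S (E w))) => h5.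
  by apply/andP; split; lra.
Qed.

Lemma restS k j v : rest k j.+1 v = rest k j v - row k j (adj (row k j) v).
Proof. by case: (rest_row k j v). Qed.

Lemma restP k j : positive_contraction (rest k j).
Proof. by case: (rest_row k j 0). Qed.

Lemma rowP k j : IS (row k j).
Proof.
have [iS _ _] := bestP (rest k j k); have [iE _ _] := restP k j.
exact: intertwiner_comp iS iE.
Qed.

Lemma row_sum k v J : \sum_(0 <= j < J) row k j (adj (row k j) v) = v - rest k J v.
Proof.
elim: J => [|J IH]; first by rewrite big_geq //= subrr.
by rewrite big_nat_recr //= IH -/(rest k J.+1) restS opprB addrA addrAC.
Qed.

Lemma row_norm_sum k v J :
  series (fun j => nm (adj (row k j) v) ^+ 2) J = rdot (v - rest k J v) v.
Proof.
rewrite -(row_sum k) rdot_suml /series /=; apply: eq_bigr => j _.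
by rewrite nm2E (adjEr _ _ (rowP k j).1) rdotC.
Qed.

Lemma row_bessel k v J : series (fun j => nm (adj (row k j) v) ^+ 2) J <= nm v ^+ 2.
Proof.
rewrite row_norm_sum rdotBl -nm2E; have [_ _ /(_ v) /andP[h _]] := restP k J; lra.
Qed.

Lemma row_small k e : 0 < e -> exists N, forall n, (N <= n)%N -> nm (adj (row k n) k) ^+ 2 < e.
Proof.
move=> e0.
have [c _] := @nonneg_series_cvg _ (fun j => nm (adj (row k j) k) ^+ 2) _
   (fun n => sqr_ge0 _) (row_bessel k k).
have /cvgrPdist_lt /(_ e e0) [N _ HN] := cvg_series_cvg_0 c.
by exists N => n /HN /=; rewrite sub0r normrN ger0_norm ?sqr_ge0.
Qed.

(** For an intertwiner S bounded by M, the contraction S/M competes in the choice at stage n, so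
    |adj(S) (rest k n k)|^2 <= 2 M^2 |adj(row k n) k|^2. By the Bessel inequality at k this tends to
    0. *)
Lemma rest_weak k z : lspan [set v | exists S xi, IS S /\ v = S xi] z ->
  forall e, 0 < e -> exists N, forall n, (N <= n)%N -> `|rdot (rest k n k) z| < e.
Proof.
move: z; apply: lspan_ind.
  by move=> e e0; exists 0%N => n _; rewrite rdot0r normr0.
move=> c _ v [S [xi [iS ->]]] IH e e0.
have [M M0 hM] := bop_bound iS.1.
have e2 : 0 < e / 2 by lra.
have [N1' h1] := IH _ e2.
pose x := nm (c *: xi) * M; have x0 : 0 <= x by rewrite mulr_ge0 ?nm_ge0 // ltW.
have x1 : 0 < 2 * (x ^+ 2 + 1) by have := sqr_ge0 x; lra.
(* Chosen so that 2 x^2 |adj(row k n) k|^2 < (e/2)^2; the added 1 keeps the denominator positive. *)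
have d0 : 0 < (e / 2) ^+ 2 / (2 * (x ^+ 2 + 1)) by rewrite divr_gt0 // exprn_gt0.
have [N2 h2] := row_small k d0.
exists (maxn N1' N2) => n; rewrite geq_max => /andP[/h1 k1 /h2 k2].
have iT : IS ((M^-1)%:C *: S).
  split; first exact: bopZ iS.1.
  move=> a Aa; apply/funext => w; have lf := bop_lin (shom_bop sf Aa).
  by have /= e1 := congr1 (fun T => T w) (iS.2 a Aa); rewrite /= !fctE (linopZ lf) e1.
have hT : opb 1 ((M^-1)%:C *: S).
  by have := opbZ M^-1 hM; rewrite gtr0_norm ?invr_gt0 // mulVf ?gt_eqF.
have [iB hB best_] := bestP (rest k n k); have [iE sE _] := restP k n.
have h3 := best_ _ iT hT.
have rE : nm (adj (best (rest k n k)) (rest k n k)) ^+ 2 = nm (adj (row k n) k) ^+ 2.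
  by rewrite /row (adj_comp iE.1 iB.1) sE.
rewrite rE (adjZr _ iS.1) fctE nmZr gtr0_norm ?invr_gt0 // exprMn in h3.
have h4 : nm (adj S (rest k n k)) ^+ 2 <= M ^+ 2 * (2 * nm (adj (row k n) k) ^+ 2).
  have M2 : 0 < M ^+ 2 by rewrite exprn_gt0.
  by rewrite exprVn mulrC ler_pdivrMr // mulrC in h3.
have h5 : `|rdot (rest k n k) (S (c *: xi))| < e / 2.
  rewrite -adjEr; last exact: iS.1.
  apply: le_lt_trans (rdot_abs _ _) _.
  rewrite -(@ltr_pXn2r _ 2%N) ?nnegrE ?mulr_ge0 ?nm_ge0 ?invr_ge0 ?(ltW e0) //.
  rewrite exprMn; apply: (@le_lt_trans _ _ (2 * x ^+ 2 * nm (adj (row k n) k) ^+ 2)).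
    have := ler_wpM2r (sqr_ge0 (nm (c *: xi))) h4; rewrite /x exprMn; lra.
  move: k2; rewrite ltr_pdivlMr // => k2.
  have := sqr_ge0 (nm (adj (row k n) k)); have := sqr_ge0 x; nra.
rewrite (_ : rdot _ _ = rdot (rest k n k) (S (c *: xi)) + rdot (rest k n k) v); last first.
  by rewrite (linopZ (bop_lin iS.1)); exact: rdotDr.
by apply: le_lt_trans (ler_normD _ _) _; lra.
Qed.

(** Weak convergence becomes norm convergence through |E k|^2 <= <E k, k>, with the second k
    approximated by a combination of range vectors. *)
Lemma rest_cvg k e : 0 < e -> exists N, forall n, (N <= n)%N -> nm (rest k n k) < e.
Proof.
move=> e0.
have k1 : 0 < nm k + 1 by have := nm_ge0 k; lra.
have e2 : 0 < e ^+ 2 / 2 by rewrite divr_gt0 // exprn_gt0.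
have q0 := divr_gt0 e2 k1; have := mulfVK (lt0r_neq0 k1) (e ^+ 2 / 2).
set q := _ / (nm k + 1) in q0 * => qE.
have [z Lz hz] := totalP tot k q0.
have [N HN] := rest_weak k Lz e2.
exists N => n /HN hn; have P := restP k n.
have h1 := positive_contraction_sq k P.
have h2 : nm (rest k n k) <= nm k.
  rewrite -(@ler_pXn2r _ 2%N) ?nnegrE ?nm_ge0 //; apply: le_trans h1 _.
  by have [_ _ /(_ k) /andP[]] := P.
rewrite -(@ltr_pXn2r _ 2%N) ?nnegrE ?nm_ge0 ?ltW //; apply: le_lt_trans h1 _.
have -> : rdot (rest k n k) k = rdot (rest k n k) (k - z) + rdot (rest k n k) z.
  by rewrite rdotBr subrK.
have := rdot_le (rest k n k) (k - z); have := ler_norm (rdot (rest k n k) z).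
have := nm_ge0 (k - z); have := nm_ge0 (rest k n k); have := nm_ge0 k; nra.
Qed.

Local Notation rho := (vn_extension A1 f).

(** Because rho x R_j = R_j x, the partial sums are <rho x (k - rest k J k), k'>. *)
Lemma vn_extension_series x k k' : N1 x ->
  series (fun j => rdot (x (adj (row k j) k)) (adj (row k j) k')) @ \oo --> rdot (rho x k) k'.
Proof.
move=> Nx; have br := bop_vn_extension cA1 v1 dense1 sf tot Nx; have lr := bop_lin br.
have [M M0 hM] := bop_bound br.
have E J : series (fun j => rdot (x (adj (row k j) k)) (adj (row k j) k')) J =
    rdot (rho x (k - rest k J k)) k'.
  rewrite -(row_sum k) (linop_sum lr) rdot_suml /series /=; apply: eq_bigr => j _.
  by rewrite (vn_extensionE cA1 v1 dense1 sf tot _ Nx (rowP k j)) -adjE //; exact: (rowP k j).1.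
apply/cvgrPdist_lt => e e0.
have D : 0 < M * nm k' + 1 by have := nm_ge0 k'; nra.
have [N HN] := rest_cvg k (divr_gt0 e0 D).
exists N => // n /HN; have := mulfVK (lt0r_neq0 D) e; set q := e / _ => qE hn.
rewrite E (linopB lr) rdotBl opprB addrC subrK; apply: le_lt_trans (rdot_abs _ _) _.
have h := hM (rest k n k); have := nm_ge0 k'; have := nm_ge0 (rest k n k) => a0 b0.
apply: (@le_lt_trans _ _ (M * nm (rest k n k) * nm k')).
  by apply: ler_wpM2r.
rewrite -qE -mulrA [nm _ * nm k']mulrC mulrA.
have : 0 <= M * nm k' by rewrite mulr_ge0 // ltW.
nra.
Qed.

(** Each term <rho x l_n, r_n> is expanded along the rows chosen for l_n. The Bessel inequality
    holds for arbitrary vectors, so both doubly indexed families, from l_n and from r_n, are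
    square-summable and define a normal functional on B(K1) once the pairs are enumerated. *)
Lemma vn_extension_predual (w : nfunctional K2) : exists w' : nfunctional K1,
  forall x, N1 x -> nf_app w (rho x) = nf_app w' x.
Proof.
have [e be] := nat_pairing.
pose l (p : nat * nat) : K1 := adj (row (nf_l w p.1) p.2) (nf_l w p.1).
pose r (p : nat * nat) : K1 := adj (row (nf_l w p.1) p.2) (nf_r w p.1).
have sq (z : nat -> K2) : cvgn (series (fun n => nm (z n) ^+ 2)) ->
   exists A : nat -> R, (forall n, series (fun j => nm (adj (row (nf_l w n) j) (z n)) ^+ 2) @ \oo --> A n)
     /\ cvgn (series A).
  move=> cz; have h n := @nonneg_series_cvg _ (fun j => nm (adj (row (nf_l w n) j) (z n)) ^+ 2) _
    (fun j => sqr_ge0 _) (row_bessel (nf_l w n) (z n)).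
  exists (fun n => limn (series (fun j => nm (adj (row (nf_l w n) j) (z n)) ^+ 2))); split.
    by move=> n; case: (h n).
  apply: (series_le_cvg _ _ _ cz) => n; [|exact: sqr_ge0|by case: (h n)].
  apply: limr_ge; first by case: (h n).
  by apply: nearW => m; apply: sumr_ge0 => j _; exact: sqr_ge0.
have cl := (cvg_sq _).1 (nf_l_summable (n := w)).
have cr := (cvg_sq _).1 (nf_r_summable (n := w)).
have [Al [hAl cAl]] := sq _ cl; have [Ar [hAr cAr]] := sq _ cr.
have suml : cvgn (series (fun q => `|l (e q)| ^+ 2)).
  apply/cvg_sq/cvg_ex; exists (limn (series Al)).
  by apply: (nonneg_double_series be (b := fun n j => nm (l (n, j)) ^+ 2) _ hAl) => // n j; exact: sqr_ge0.
have sumr : cvgn (series (fun q => `|r (e q)| ^+ 2)).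
  apply/cvg_sq/cvg_ex; exists (limn (series Ar)).
  by apply: (nonneg_double_series be (b := fun n j => nm (r (n, j)) ^+ 2) _ hAr) => // n j; exact: sqr_ge0.
exists (@NFunctional R K1 (fun q => l (e q)) (fun q => r (e q)) suml sumr) => x Nx.
set w' := NFunctional _ _.
have br := bop_vn_extension cA1 v1 dense1 sf tot Nx; have bx := vna_bop v1 Nx.
have [M M0 hM] := bop_bound bx; have [M' M'0 hM'] := bop_bound br.
have seriesM (u v : nat -> R) (a b c : R) : series u @ \oo --> a -> series v @ \oo --> b ->
    series (fun n => c * (u n + v n)) @ \oo --> c * (a + b).
  move=> hu hv; have -> : series (fun n => c * (u n + v n)) = (fun n => c * (series u n + series v n)).
    by apply/funext => n; rewrite /series /= -big_split mulr_sumr.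
  by apply: cvgM; [exact: cvg_cst|exact: cvgD].
(* The boolean treats the real and imaginary parts at once: the imaginary part is the real part with
   i r_n in place of r_n. *)
have main (i : bool) : let J := fun z : K2 => if i then 'i%C *: z else z in
    let J' := fun z : K1 => if i then 'i%C *: z else z in
    series (fun q => rdot (x (l (e q))) (J' (r (e q)))) @ \oo -->
    limn (series (fun n => rdot (rho x (nf_l w n)) (J (nf_r w n)))).
  move=> J J'.
  have JE n j : J' (r (n, j)) = adj (row (nf_l w n) j) (J (nf_r w n)).
    by rewrite /J /J' /r; case: (i) => //=; rewrite (linopZ (bop_lin (bop_adj (rowP _ _).1))).
  have nJ z : nm (J' z) = nm z by rewrite /J'; case: (i) => //; rewrite nmZi.
  apply: (double_series be (t := fun n j => rdot (x (l (n, j))) (J' (r (n, j))))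
    (a := fun n j => (M / 2) * (nm (l (n, j)) ^+ 2 + nm (r (n, j)) ^+ 2))
    (T := fun n => rdot (rho x (nf_l w n)) (J (nf_r w n)))
    (A := fun n => (M / 2) * (Al n + Ar n)) (S := (M / 2) * (limn (series Al) + limn (series Ar)))).
  - move=> n j; apply: le_trans (rdot_abs _ _) _; rewrite nJ.
    apply: le_trans (ler_wpM2r (nm_ge0 _) (hM _)) _.
    have := ler_wpM2l (ltW M0) (sqr_ge0 (nm (l (n, j)) - nm (r (n, j)))).
    rewrite sqrrB; lra.
  - by move=> n; exact: (seriesM _ _ _ _ _ (hAl n) (hAr n)).
  - exact: (seriesM _ _ _ _ _ cAl cAr).
  - by move=> n; under eq_fun do rewrite JE; exact: vn_extension_series.
  - have [c1 _] := rnf_spec w (ltW M'0) hM'; have [c2 _] := rnf_spec (nf_i w) (ltW M'0) hM'.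
    by rewrite /J; case: (i); [exact: c2|exact: c1].
rewrite !nf_appE //; apply/eqP; rewrite eq_complex /=; apply/andP; split; apply/eqP; apply/esym.
  by apply/cvg_lim => //; exact: (main false).
by apply/cvg_lim => //; exact: (main true).
Qed.

Lemma vn_extension_normal : normal_map N1 rho.
Proof.
move=> F x PF FN Nx sw w; have [w' hw] := vn_extension_predual w.
rewrite hw //; apply: cvg_trans (sw w'); apply: near_eq_cvg.
by apply: filterS FN => y Ny; rewrite hw.
Qed.

End Normality.

(** * Equivariance *)

Section Equivariance.
Variable R : realType.
Variable tens : forall H K : hilbert R, htensor H K.
Implicit Types H K : hilbert R.
Local Notation ot := (@optens R tens _ _ _ _).

(** For t in the commutant of N, 1 (x) t commutes with the elementary tensors, hence with X; slicing
    shows that t commutes with the slice. *)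
Lemma slc_vn_tens H K (M : set (H -> H)) (N : set (K -> K)) h h0 X :
  M `<=` @bop R H H -> von_neumann_algebra N -> vn_tens (tens := tens) M N X -> N (slc h h0 X).
Proof.
move=> bM vN [bX cX]; rewrite -(vna_bicommutant vN); split; first exact: bop_slc.
move=> t [bt ct]; have bt' := bop_adj bt; have b1 := @bop_id R H.
have bot := bop_optens tens b1 bt.
have /cX e : commutant (elem_tens M N) (ot id t).
  split=> // _ [a [b [Ma Nb ->]]]; have ba := bM _ Ma; have bb := vna_bop vN Nb.
  by rewrite (optens_comp tens b1 bt ba bb) (optens_comp tens ba bb b1 bt) ct.
apply/funext => k; apply: dot_inj => k'; rewrite dotC [RHS]dotC; congr (_^*%C).
rewrite /= slc_dot -[t (slc h h0 X k)]/(t _).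
have -> : dot K (t (slc h h0 X k)) k' = dot K (slc h h0 X k) (adj t k') by rewrite (adj_spec bt).2.
rewrite slc_dot -(optensE tens h k b1 bt) -(optensE tens h0 k' b1 bt') -/(ot id t).
have /= -> := congr1 (fun T => T (pure (tens H K) h k)) e.
by rewrite (adj_spec bot).2 (adj_optens tens b1 bt) adj_id.
Qed.

Lemma opb_sum H K (r : seq nat) (S : nat -> H -> K) (M : nat -> R) :
  (forall i, opb (M i) (S i)) -> opb (\sum_(i <- r) M i) (\sum_(i <- r) S i).
Proof.
move=> h; elim: r => [|i r IH]; first by rewrite !big_nil; exact: opb0.
by rewrite !big_cons; exact: opbD.
Qed.

(** [lslice] is chosen through a weak series condition. Its operator exists as the norm limit of
    finite sums of vector slices, with an explicit rate. *)
Lemma lslice_spec H K (w : nfunctional H) (X : tens H K -> tens H K) C :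
  bop X -> 0 <= C -> opb C X ->
  bop (lslice w X) /\ forall n,
    opb (C * tail w n) (lslice w X - \sum_(0 <= i < n) slc (nf_l w i) (nf_r w i) X).
Proof.
move=> bX C0 hX.
pose P n := \sum_(0 <= i < n) slc (nf_l w i) (nf_r w i) X.
have bP n : bop (P n) by apply: bop_sum => i _; exact: bop_slc.
have hP n m : (n <= m)%N -> opb (C * tail w n) (P m - P n).
  move=> le_nm; apply: (@opb_le _ _ _ _ (C * (series (wt w) m - series (wt w) n))).
    by apply: ler_wpM2l => //; exact: series_tail.
  have -> : P m - P n = \sum_(n <= i < m) slc (nf_l w i) (nf_r w i) X.
    exact: (@sub_series_geq _ (fun i => slc (nf_l w i) (nf_r w i) X)).
  rewrite sub_series_geq // mulr_sumr; apply: opb_sum => i.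
  apply: opb_le (opb_slc _ _ C0 hX); rewrite /wt.
  have := ler_wpM2l C0 (sqr_ge0 (nm (nf_l w i) - nm (nf_r w i))); rewrite sqrrB; lra.
have hC d : 0 < d -> exists N, forall n, (N <= n)%N -> C * tail w n < d.
  move=> d0; have C1 : 0 < C + 1 by lra.
  have [N HN] := tail_small w (divr_gt0 d0 C1); exists N => n /HN.
  have := mulfVK (lt0r_neq0 C1) d; have := tail_ge0 w n; set q := d / _ => t0 <- h; nra.
have [T [bT hT]] := bop_limit bP hP hC.
have rP k k' : rdot (P n k) k' @[n --> \oo] --> rdot (T k) k'.
  apply/cvgrPdist_lt => e e0; pose m := nm k * nm k'.
  have m0 : 0 <= m by rewrite mulr_ge0 ?nm_ge0.
  have m1 : 0 < m + 1 by lra.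
  have [N HN] := hC _ (divr_gt0 e0 m1); exists N => // n /HN hn.
  rewrite /= -rdotBl; apply: le_lt_trans (rdot_abs _ _) _.
  apply: le_lt_trans (ler_wpM2r (nm_ge0 k') (hT n k)) _.
  rewrite -mulrA -/m; have := mulfVK (lt0r_neq0 m1) e; move: hn; set q := e / _ => hn <-.
  have : 0 <= C * tail w n by rewrite mulr_ge0 // tail_ge0.
  nra.
have hlim k k' : dot K (T k) k' = limn (series (fun n =>
    dot (tens H K) (X (pure (tens H K) (nf_l w n) k)) (pure (tens H K) (nf_r w n) k'))
    : nat -> (R[i] : numFieldType)).
  have E n : series (fun n => dot (tens H K) (X (pure (tens H K) (nf_l w n) k))
      (pure (tens H K) (nf_r w n) k')) n = dot K (P n k) k'.
    elim: n => [|n IH]; first by rewrite /series /P /= !big_geq // linear0l.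
    rewrite /P /series /= !big_nat_recr //= !fctE linearDl /= -/(P n) slc_dot; congr (_ + _).
    exact: IH.
  apply/esym/cvg_lim => //; apply/cvg_ReIm; split.
    rewrite (_ : (fun n => complex.Re _) = fun n => rdot (P n k) k'); first exact: rP.
    by apply/funext => n; rewrite /rdot; congr complex.Re; exact: E.
  rewrite -rdotir (_ : (fun n => complex.Im _) = fun n => rdot (P n k) ('i%C *: k')); first exact: rP.
  by apply/funext => n; rewrite rdotir; congr complex.Im; exact: E.
suff -> : lslice w X = T by [].
have [|bL hL] := @xgetPex _ (fun=> 0 : K) [set T | bop T /\ forall k k', dot K (T k) k' =
    limn (series (fun n => dot (tens H K) (X (pure (tens H K) (nf_l w n) k))
                                          (pure (tens H K) (nf_r w n) k')))].
  by exists T.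
apply/funext => k; apply: dot_inj => k'; rewrite dotC [RHS]dotC; congr (_^*%C).
by rewrite hlim; exact: hL.
Qed.

Variable G : lcqg tens.
Local Notation L2 := (qg_L2 G).
Local Notation C0 := (@qg_C0 R tens G).

Variables K1 K2 : hilbert R.
Variables (A1 N1 : set (K1 -> K1)) (N2 : set (K2 -> K2)) (f : (K1 -> K1) -> K2 -> K2).
Variable D1 : (K1 -> K1) -> tens L2 K1 -> tens L2 K1.
Variable D2 : (K2 -> K2) -> tens L2 K2 -> tens L2 K2.
Hypothesis cA1 : cstar_algebra A1.
Hypothesis n1 : Defs.nondegenerate A1.
Hypotheses (v1 : von_neumann_algebra N1) (v2 : von_neumann_algebra N2).
Hypothesis AN1 : A1 `<=` N1.
Hypothesis dense1 : N1 `<=` closure (A1 : set {ptws K1 -> K1}).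
Hypothesis sf : star_hom A1 f.
Hypothesis fN : forall a, A1 a -> N2 (f a).
Local Notation IS := (intertwiner A1 id f).
Hypothesis tot : total_set [set v | exists S xi, IS S /\ v = S xi].
Hypotheses (sD1 : star_hom N1 D1) (sD2 : star_hom N2 D2).
Hypotheses (nD1 : normal_map N1 D1) (nD2 : normal_map N2 D2).
Hypothesis rD1 : forall x, N1 x -> vn_tens (@qg_Linf R tens G) N1 (D1 x).
Hypothesis star : forall b a c h h0, A1 b -> A1 a -> C0 c -> A1 (slc (c h) h0 (D1 b) \o a) /\
    f (slc (c h) h0 (D1 b) \o a) = slc (c h) h0 (D2 (f b)) \o f a.
Local Notation rho := (vn_extension A1 f).

(** Matrix coefficients of the identity D2 (rho x) (1 (x) S) = (1 (x) S) D1 x; in this form it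
    survives sigma-weak limits of x. *)
Definition coefficients_agree (x : K1 -> K1) := forall h h0 S xi k, IS S ->
  dot (tens L2 K2) (D2 (rho x) (pure (tens L2 K2) h (S xi))) (pure (tens L2 K2) h0 k) =
  dot (tens L2 K1) (D1 x (pure (tens L2 K1) h xi)) (pure (tens L2 K1) h0 (adj S k)).

(** The slice identity gives the claim for the vectors c h1 (x) a z. Moving D1 b and D2 (f b) to the
    other side leaves fixed vectors y1 and y2, and nondegeneracy of C_0(G) and of A1 removes c and a
    one leg at a time. *)
Lemma coefficients_agree_dense b : A1 b -> coefficients_agree b.
Proof.
move=> Ab h h0 S xi k iS; rewrite (vn_extension_agrees cA1 v1 AN1 dense1 sf tot Ab).
have bS := iS.1; have bD1 := shom_bop sD1 (AN1 Ab); have bD2 := shom_bop sD2 (fN Ab).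
set v1' := pure _ h0 k; set v2' := pure _ h0 (adj S k).
pose y1 := adj (D2 (f b)) v1'; pose y2 := adj (D1 b) v2'.
rewrite (adj_spec bD2).2 (adj_spec bD1).2 -/y1 -/y2.
have key h' xi' : (exists c h1, C0 c /\ h' = c h1) -> (exists a z, A1 a /\ xi' = a z) ->
   dot (tens L2 K2) (pure (tens L2 K2) h' (S xi')) y1 = dot (tens L2 K1) (pure (tens L2 K1) h' xi') y2.
  move=> [c [h1 [Cc ->]]] [a [z [Aa ->]]].
  rewrite /y1 /y2 -(adj_spec bD2).2 -(adj_spec bD1).2 /v1' /v2' -!slc_dot.
  have [As fs] := star h1 h0 Ab Aa Cc.
  have /= e1 := congr1 (fun T => T z) (iS.2 a Aa).
  have /= e2 := congr1 (fun T => T z) (iS.2 _ As).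
  have /= e3 := congr1 (fun T => T (S z)) fs.
  by rewrite e1 -e3 -e2 (adj_spec bS).2.
have step1 xi' : (exists a z, A1 a /\ xi' = a z) ->
   dot (tens L2 K2) (pure (tens L2 K2) h (S xi')) y1 = dot (tens L2 K1) (pure (tens L2 K1) h xi') y2.
  move=> hxi.
  have e1 h' := (adj_spec (bop_lop tens L2 (S xi'))).2 h' y1.
  have e2 h' := (adj_spec (bop_lop tens L2 xi')).2 h' y2.
  rewrite -/(lop tens (S xi') h) -/(lop tens xi' h) e1 e2.
  suff -> : adj (@lop R tens L2 K2 (S xi')) y1 = adj (@lop R tens L2 K1 xi') y2 by [].
  apply/subr0_eq/(total_orth (qg_C0_nondegenerate G)) => h' hh'.
  by rewrite dotBr -e1 -e2 /lop key ?subrr.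
have e1 xi' : dot (tens L2 K2) (pure (tens L2 K2) h (S xi')) y1 = dot K1 xi' (adj S (adj (@rop R tens L2 K2 h) y1)).
  by rewrite -(adj_spec bS).2 -(adj_spec (bop_rop tens K2 h)).2.
have e2 xi' : dot (tens L2 K1) (pure (tens L2 K1) h xi') y2 = dot K1 xi' (adj (@rop R tens L2 K1 h) y2).
  by rewrite -(adj_spec (bop_rop tens K1 h)).2.
rewrite e1 e2.
suff -> : adj S (adj (@rop R tens L2 K2 h) y1) = adj (@rop R tens L2 K1 h) y2 by [].
apply/subr0_eq/(total_orth n1) => xi' hxi.
by rewrite dotBr -e1 -e2 step1 ?subrr.
Qed.

(** Here x = 2 y (1 + y^2)^-1 with y in N1, and y commutes with all self-intertwiners of K1 because
    A1 is strongly dense in N1. *)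
Lemma bounded_density x (s : seq K1) q e : N1 x -> adj x = x -> 0 <= q < 1 -> opb q x -> 0 < e ->
  exists b, [/\ A1 b, opb 2 b & forall z, z \in s -> nm (b z - x z) < e].
Proof.
move=> Nx sx q01 hx e0.
have [y [Ny sy xy]] := csa_inverse_transform (vna_cstar v1) Nx sx q01 hx.
have rid : star_rep A1 id by split; [exact: id_star_hom|exact: n1].
have yS (i j : 'I_(size s)) (S : K1 -> K1) : intertwiner A1 id id S -> S \o y = y \o S.
  by move=> [bS cS]; exact: (commute_dense dense1).
have by_ := vna_bop v1 Ny.
have [b [Ab _ hb h]] := @kaplansky R K1 A1 cA1 _ (fun _ : 'I_(size s) => K1) (fun=> id) (fun=> rid)
  (fun=> y) (fun=> by_) (fun=> sy) yS (fun=> x) (fun i => nth 0 s i) e e0 (fun=> xy).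
exists b; split=> // z zs; have iz : (index z s < size s)%N by rewrite index_mem.
by have := h (Ordinal iz); rewrite /= nth_index.
Qed.

(** Along a filter of bounded approximants from A1, normality of D1, of rho and of D2 makes both
    sides converge to their values at x. *)
Lemma coefficients_agree_sa x q : N1 x -> adj x = x -> 0 <= q < 1 -> opb q x -> coefficients_agree x.
Proof.
move=> Nx sx q01 hx h h0 S xi k iS; have bx := vna_bop v1 Nx.
pose B (p : seq K1 * R) := [set b | [/\ A1 b, opb 2 b & forall z, z \in p.1 -> nm (b z - x z) < p.2]].
pose F := filter_from [set p : seq K1 * R | 0 < p.2] B.
have FF : Filter F.
  apply: filter_from_filter; first by exists ([::], 1) => /=.
  move=> [s e] [s' e'] /= e0 e0'; exists (s ++ s', Num.min e e') => /=.
    by rewrite lt_min e0.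
  move=> b [Ab hb h1]; split; split=> //= z zs.
    by have := h1 z; rewrite mem_cat zs lt_min => /(_ isT) /andP[].
  by have := h1 z; rewrite mem_cat zs orbT lt_min => /(_ isT) /andP[].
have PF : ProperFilter F.
  apply: filter_from_proper => -[s e] /= e0.
  by have [b hb] := bounded_density s Nx sx q01 hx e0; exists b.
have FB p : 0 < p.2 -> F (B p) by move=> p0; exists p.
have F1 := FB ([::], 1) ltr01.
have FA : F A1 by apply: filterS F1 => b [].
have FN : F N1 by apply: filterS FA; exact: AN1.
have sw : sw_cvg F x.
  apply: (@bounded_weak_sw _ _ _ _ 2) => //.
  - by apply: filterS F1 => b [Ab hb _]; split=> //; exact: csa_bop cA1 _ Ab.
  - by apply: opb_le hx; have /andP[_] := q01; lra.
  move=> u v; apply/cvgrPdist_lt => e e0; have v1' : 0 < nm v + 1 by have := nm_ge0 v; lra.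
  apply: filterS (FB ([:: u], e / (nm v + 1)) (divr_gt0 e0 v1')) => b [_ _ /= hb].
  rewrite -rdotBl; apply: le_lt_trans (rdot_abs _ _) _; rewrite nmBC.
  have := hb u; rewrite inE eqxx => /(_ isT).
  have := mulfVK (lt0r_neq0 v1') e; set p := e / _ => <- h'.
  by have := nm_ge0 v; have := nm_ge0 (b u - x u); nra.
have nr := vn_extension_normal cA1 v1 dense1 sf tot.
have rN y : N1 y -> N2 (rho y) by apply: (vn_extension_range cA1 v1 dense1 sf tot v2).
have FrN : (rho b @[b --> F]) N2 by apply: filterS FN => b; exact: rN.
set u2 := pure (tens L2 K2) h (S xi); set w2 := pure (tens L2 K2) h0 k.
set u1 := pure (tens L2 K1) h xi; set w1 := pure (tens L2 K1) h0 (adj S k).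
have l1 := @nD1 F x PF FN Nx sw (vecf u1 w1).
have l2 := @nD2 (rho b @[b --> F]) (rho x) _ FrN (rN _ Nx) (nr F x PF FN Nx sw) (vecf u2 w2).
have {}l2 := l2 (fmap_proper_filter _ PF).
have l3 : nf_app (vecf u2 w2) (D2 (rho b)) @[b --> F] --> nf_app (vecf u1 w1) (D1 x).
  apply: cvg_trans l1; apply: near_eq_cvg; apply: filterS FA => b Ab /=.
  by rewrite !vecfE; apply/esym/coefficients_agree_dense.
have hd : hausdorff_space (R[i] : numFieldType) by [].
by rewrite -!vecfE -(cvg_lim hd l2) -(cvg_lim hd l3).
Qed.

Lemma coefficients_agreeP c x y : N1 x -> N1 y -> coefficients_agree x -> coefficients_agree y ->
  coefficients_agree (c *: x + y).
Proof.
move=> Nx Ny hx hy h h0 S xi k iS; have sr := vn_extension_hom cA1 v1 dense1 sf tot.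
have rN z : N1 z -> N2 (rho z) by apply: (vn_extension_range cA1 v1 dense1 sf tot v2).
rewrite (shom_linear sr _ Nx Ny) (shom_linear sD2 _ (rN _ Nx) (rN _ Ny)) (shom_linear sD1 _ Nx Ny).
by rewrite !fctE !linearDl !linearZl_LR /= hx // hy.
Qed.

Lemma coefficients_agree_all x : N1 x -> coefficients_agree x.
Proof.
move=> Nx; have cN := vna_cstar v1.
have N0 : N1 0 by exact: csa0.
have a0 : coefficients_agree 0.
  by apply: (@coefficients_agree_sa 0 0) => //; [exact: adj0|rewrite lexx ltr01|exact: opb0].
have saP y : N1 y -> adj y = y -> coefficients_agree y.
  move=> Ny sy; have [M M0 hM] := bop_bound (vna_bop v1 Ny).
  have M1 : 0 < 2 * M by lra.
  (* Rescaled to norm at most 1/2; the summand 0 matches the shape of [coefficients_agreeP]. *)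
  have -> : y = (2 * M)%:C *: (((2 * M)^-1)%:C *: y) + 0.
    by rewrite addr0 scalerA -rmorphM mulfV ?gt_eqF // scale1r.
  apply: coefficients_agreeP => //; first exact: csaZ.
  apply: (@coefficients_agree_sa _ (1/2)).
  - exact: csaZ.
  - by rewrite (adjZr _ (vna_bop v1 Ny)) sy.
  - by apply/andP; split; lra.
  - have := opbZ (2 * M)^-1 hM; rewrite gtr0_norm ?invr_gt0 //; apply: opb_le.
    by rewrite mulrC ler_pdivrMr //; lra.
have bx := vna_bop v1 Nx; have bx' := bop_adj bx; have Nx' : N1 (adj x) by exact: csa_adj.
(* Real and imaginary parts of x, so that x = x1 + i x2. *)
pose x1 := (1/2)%:C *: (x + adj x); pose x2 := (- (1/2))%:C *: ('i%C *: (x - adj x)).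
have N1x1 : N1 x1 by apply: csaZ => //; exact: csaD.
have N1x2 : N1 x2 by apply: csaZ => //; apply: csaZ => //; exact: csaB.
have sx1 : adj x1 = x1 by rewrite /x1 (adjZr _ (bopD bx bx')) (adjD bx bx') (adjK bx) addrC.
have sx2 : adj x2 = x2.
  rewrite /x2 (adjZr _ (bopZ _ (bopB bx bx'))) (adjZi (bopB bx bx')) (adjB bx bx') (adjK bx).
  by congr (_ *: _); rewrite -scalerN opprB.
have -> : x = 'i%C *: x2 + x1.
  have -> : 'i%C *: x2 = (1/2)%:C *: (x - adj x).
    rewrite /x2 !scalerA; congr (_ *: _).
    by rewrite mulrAC -expr2 sqr_i mulN1r -rmorphN opprK.
  rewrite /x1 -scalerDr addrACA addNr addr0 scalerDr -scalerDl.
  by rewrite -rmorphD /= (_ : 1/2 + 1/2 = 1) ?scale1r //; lra.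
by apply: coefficients_agreeP => //; exact: saP.
Qed.

Lemma slc_extension x h h0 : N1 x ->
  N1 (slc h h0 (D1 x)) /\ slc h h0 (D2 (rho x)) = rho (slc h h0 (D1 x)).
Proof.
move=> Nx; have Ns : N1 (slc h h0 (D1 x)).
  by apply: slc_vn_tens (rD1 Nx) => //; exact: vna_bop (qg_vna G).
have rN z : N1 z -> N2 (rho z) by apply: (vn_extension_range cA1 v1 dense1 sf tot v2).
split=> //; apply/esym/(vn_extension_uniq cA1 v1 dense1 sf tot Ns).
  by apply: bop_slc; exact: shom_bop sD2 _ (rN _ Nx).
move=> S v iS; apply: dot_inj => k; rewrite dotC [RHS]dotC; congr (_^*%C).
by rewrite slc_dot coefficients_agree_all // (adj_spec iS.1).2 slc_dot.
Qed.

(** For vector slices this is [slc_extension]. A general slice is a norm limit of finite sums of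
    them, and rho is linear and contractive. *)
Lemma vn_extension_equivariant x : N1 x -> vn_id_tens rho (D1 x) (D2 (rho x)).
Proof.
move=> Nx; have cN := vna_cstar v1; have sr := vn_extension_hom cA1 v1 dense1 sf tot.
have rN z : N1 z -> N2 (rho z) by apply: (vn_extension_range cA1 v1 dense1 sf tot v2).
have b1 := shom_bop sD1 Nx; have b2 := shom_bop sD2 (rN _ Nx).
split=> // w.
have [C1 C10 h1] := bop_bound b1; have [C2 C20 h2] := bop_bound b2.
have [bT1 hT1] := lslice_spec w b1 (ltW C10) h1.
have [bT2 hT2] := lslice_spec w b2 (ltW C20) h2.
have NP n : N1 (\sum_(0 <= i < n) slc (nf_l w i) (nf_r w i) (D1 x)) /\
   rho (\sum_(0 <= i < n) slc (nf_l w i) (nf_r w i) (D1 x)) =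
   \sum_(0 <= i < n) slc (nf_l w i) (nf_r w i) (D2 (rho x)).
  elim: n => [|n [IH1 IH2]].
    by rewrite !big_geq //; split; [exact: csa0|exact: (star_hom0 cN sr)].
  have [Ns es] := slc_extension (nf_l w n) (nf_r w n) Nx.
  rewrite !big_nat_recr //=; split; first exact: csaD.
  by rewrite (star_homD cN sr IH1 Ns) IH2 es.
have sm C d : 0 < C -> 0 < d -> exists n, C * tail w n < d.
  move=> C0 d0; have [N HN] := tail_small w (divr_gt0 d0 C0); exists N.
  by have := HN N (leqnn _); rewrite ltr_pdivlMr // mulrC.
have NT : N1 (lslice w (D1 x)).
  apply: (csa_lim cN) => // e e0; have [n hn] := sm _ _ C10 e0.
  by exists (\sum_(0 <= i < n) slc (nf_l w i) (nf_r w i) (D1 x)); [case: (NP n)|apply: opb_le (hT1 n); exact: ltW].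
apply: opb_eq => e e0; have C0 : 0 < C1 + C2 by lra.
have [n hn] := sm _ _ C0 e0; have [Pn eP] := NP n.
have t0 := tail_ge0 w n.
have h3 := star_hom_contractive cN sr (csaB cN NT Pn) (mulr_ge0 (ltW C10) t0) (hT1 n).
rewrite (star_homB cN sr NT Pn) eP in h3.
have := opbD (hT2 n) (opbBC h3); rewrite subrKA; apply: opb_le.
by rewrite -mulrDl addrC; exact: ltW.
Qed.

End Equivariance.

Lemma inverse_star_hom (R : realType) (K1 K2 : hilbert R) (A1 : set (K1 -> K1))
    (A2 : set (K2 -> K2)) (f : (K1 -> K1) -> K2 -> K2) (g : (K2 -> K2) -> K1 -> K1) :
  cstar_algebra A1 -> star_hom A1 f -> set_inj A1 f ->
  (forall b, A2 b -> A1 (g b)) -> (forall b, A2 b -> f (g b) = b) ->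
  cstar_algebra A2 -> star_hom A2 g.
Proof.
move=> cA1 sf injf gA fg cA2.
have eq a b : A1 a -> A1 b -> f a = f b -> a = b.
  by move=> Aa Ab; apply: injf; rewrite inE.
split.
- by move=> b Ab; exact: csa_bop cA1 _ (gA _ Ab).
- move=> c x y Ax Ay; have gx := gA _ Ax; have gy := gA _ Ay.
  have Axy : A2 (c *: x + y) by apply: csaD => //; exact: csaZ.
  apply: eq; [exact: gA|by apply: csaD => //; exact: csaZ|].
  by rewrite (shom_linear sf c gx gy) !fg.
- move=> x y Ax Ay; have gx := gA _ Ax; have gy := gA _ Ay; have Axy := csa_mul cA2 Ax Ay.
  by apply: eq; [exact: gA|exact: csa_mul|rewrite (shom_mul sf gx gy) !fg].
- move=> x Ax; have gx := gA _ Ax; have Ax' := csa_adj cA2 Ax.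
  by apply: eq; [exact: gA|exact: csa_adj|rewrite (shom_adj sf gx) !fg].
Qed.

Lemma vna_id (R : realType) (H : hilbert R) (M : set (H -> H)) : von_neumann_algebra M -> M id.
Proof.
by move=> vM; rewrite -(vna_bicommutant vM); split; [exact: bop_id|].
Qed.

Unset Implicit Arguments.

Theorem proposition3p5 (R : realType)
    (tens : forall H K : hilbert R, htensor H K)
    (G : lcqg tens) (K1 K2 : hilbert R)
    (N1 : set (K1 -> K1))
    (DeltaN1 : (K1 -> K1) -> (tens (qg_L2 G) K1 -> tens (qg_L2 G) K1))
    (N2 : set (K2 -> K2))
    (DeltaN2 : (K2 -> K2) -> (tens (qg_L2 G) K2 -> tens (qg_L2 G) K2))
    (D1 : set (K1 -> K1))
    (DeltaD1 : (K1 -> K1) -> (tens (qg_L2 G) K1 -> tens (qg_L2 G) K1))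
    (D2 : set (K2 -> K2))
    (DeltaD2 : (K2 -> K2) -> (tens (qg_L2 G) K2 -> tens (qg_L2 G) K2))
    (pi : (K1 -> K1) -> (K2 -> K2))
    (qhs1 : quantum_homogeneous_space (G := G) N1 DeltaN1)
    (qhs2 : quantum_homogeneous_space (G := G) N2 DeltaN2)
    (version1 : cstar_version (G := G) N1 DeltaN1 D1 DeltaD1)
    (version2 : cstar_version (G := G) N2 DeltaN2 D2 DeltaD2)
    (pi_iso : g_isomorphism (G := G) D1 DeltaD1 D2 DeltaD2 pi) :
  exists rho : (K1 -> K1) -> (K2 -> K2),
    (forall d, D1 d -> rho d = pi d) /\
    vn_g_isomorphism (G := G) N1 DeltaN1 N2 DeltaN2 rho.
Proof.
have [co1 _ _] := qhs1; have [co2 _ _] := qhs2; have [gm [pifun piinj pisurj]] := pi_iso.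
have g1 := cv_gcstar version1; have g2 := cv_gcstar version2.
have c1 := gc_cstar g1; have c2 := gc_cstar g2.
have n1 := gc_nondegenerate g1; have n2 := gc_nondegenerate g2.
have v1 := coact_vna co1; have v2 := coact_vna co2.
have s1 := coact_hom co1; have s2 := coact_hom co2.
have dn1 := cv_dense version1; have dn2 := cv_dense version2.
have sub1 := cv_sub version1; have sub2 := cv_sub version2.
have sf := cmor_hom (gm_mor gm).
have fA a : D1 a -> D2 (pi a) by exact: pifun.
(* The inverse of pi as a total function, with an arbitrary value off D2. *)
have /choice [g hg] : forall b, exists a, D2 b -> D1 a /\ pi a = b.
  move=> b; have [Db|nDb] := pselect (D2 b); last by exists 0.
  by have [a Da <-] := pisurj _ Db; exists a.
have gA b : D2 b -> D1 (g b) by move=> /hg[].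
have fg b : D2 b -> pi (g b) = b by move=> /hg[].
have gf a : D1 a -> g (pi a) = a.
  by move=> Da; apply: piinj; rewrite ?inE; [exact/gA/fA|done|exact/fg/fA].
have sg := inverse_star_hom c1 sf piinj gA fg c2.
(* On D1 and D2 the C*-algebraic coactions are the restrictions of those of N1 and N2. *)
have starf b a c h h0 : D1 b -> D1 a -> @qg_C0 R tens G c ->
    D1 (slc (c h) h0 (DeltaN1 b) \o a) /\
    pi (slc (c h) h0 (DeltaN1 b) \o a) = slc (c h) h0 (DeltaN2 (pi b)) \o pi a.
  move=> Db Da Cc; have := slc_equivariant g1 g2 gm fA h h0 Db Da Cc.
  by rewrite (cv_restr version1 Db) (cv_restr version2 (fA _ Db)).
(* Equivariance of the inverse: the identity for pi at g b and g a, with g applied to both sides. *)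
have starg b a c h h0 : D2 b -> D2 a -> @qg_C0 R tens G c ->
    D2 (slc (c h) h0 (DeltaN2 b) \o a) /\
    g (slc (c h) h0 (DeltaN2 b) \o a) = slc (c h) h0 (DeltaN1 (g b)) \o g a.
  move=> Db Da Cc; have [h1 h2] := starf _ _ _ h h0 (gA _ Db) (gA _ Da) Cc.
  by rewrite !fg // in h2; rewrite -h2; split; [exact: fA|exact: gf].
have tot1 := intertwiners_total c1 n1 n2 sf fA (fun b Db => ex_intro2 _ _ (g b) (gA b Db) (fg b Db))
  sub1 sub2 v1 v2 s1 s2 (coact_inj co2) (coact_normal co2) (cv_strict version1) starf.
have tot2 := intertwiners_total c2 n2 n1 sg gA (fun a Da => ex_intro2 _ _ (pi a) (fA a Da) (gf a Da))
  sub2 sub1 v2 v1 s2 s1 (coact_inj co1) (coact_normal co1) (cv_strict version2) starg.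
have fN a : D1 a -> N2 (pi a) by move=> /fA/sub2.
have gN b : D2 b -> N1 (g b) by move=> /gA/sub1.
have rK := vn_extensionK c1 c2 v1 v2 sub2 dn1 dn2 sf sg fA gf tot1 tot2.
have rK' := vn_extensionK c2 c1 v2 v1 sub1 dn2 dn1 sg sf gA fg tot2 tot1.
have rN := vn_extension_range c1 v1 dn1 sf tot1 v2 fN.
have rN' := vn_extension_range c2 v2 dn2 sg tot2 v1 gN.
exists (vn_extension D1 pi); split.
  by move=> d; exact: (vn_extension_agrees c1 v1 sub1 dn1 sf tot1).
split.
- exact: (vn_extension_hom c1 v1 dn1 sf tot1).
- exact: (vn_extension_id c1 v1 dn1 sf tot1 (vna_id v1)).
- split; first exact: rN.
    by move=> x y; rewrite !inE => Nx Ny e; rewrite -(rK _ Nx) -(rK _ Ny) e.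
  by move=> y Ny; exists (vn_extension D2 g y); [exact: rN'|exact: rK'].
- exact: (vn_extension_normal c1 v1 dn1 sf tot1).
- exact: (vn_extension_equivariant c1 n1 v1 v2 sub1 dn1 sf fN tot1 s1 s2
    (coact_normal co1) (coact_normal co2) (coact_range co1) starf).
Qed.
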